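(* Let $C_0$ be a copula satisfying the nondegeneracy condition that $C_0^{\mathbb{S},2}(\sigma,\sigma)-C_0^{\mathbb{S}}(\sigma)^2\neq0$ for some $\sigma\in\mathbb{S}$, and let $k_n\le n$, $n\in\mathbb{N}$, with $k_n\to\infty$. For a random permutation $\Pi_n$ generated by an i.i.d. sample of size $n$ from a copula $C$, let $\mathrm{CvM}^{GF}_{n,k}=n\sum_{\sigma\in\mathbb{S}^{\le}_k}p_\sigma|\sigma|^{-2}\bigl(t(\Pi_n,\sigma)-C_0^{\mathbb{S}}(\sigma)\bigr)^2$, and let $c_{n,k,\alpha}=\inf\{t\in\mathbb{R}:P_{C_0}(\mathrm{CvM}^{GF}_{n,k}>t)\le\alpha\}$ be the upper $\alpha$-quantile of its distribution when $C=C_0$, for a fixed $\alpha\in(0,1)$. Then $\lim_{n\to\infty}P_{C_0}(\mathrm{CvM}^{GF}_{n,k_n}\ge c_{n,k_n,\alpha})=\alpha$, and $\lim_{n\to\infty}P_{C}(\mathrm{CvM}^{GF}_{n,k_n}\ge c_{n,k_n,\alpha})=1$ for every copula $C\neq C_0$.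
   Context: $\mathbb{S}_k$ is the set of permutations of $[k]$, $\mathbb{S}=\bigsqcup_k\mathbb{S}_k$, $|\sigma|=k$ for $\sigma\in\mathbb{S}_k$, and $\mathbb{S}^{\le}_k=\bigsqcup_{m=1}^k\mathbb{S}_m$. For $\pi\in\mathbb{S}_n$, $\sigma\in\mathbb{S}_m$ ($m\le n$), $t(\pi,\sigma)$ is the proportion of $m$-element subsets $A=\{i_1<\dots<i_m\}\subset[n]$ for which $(\pi(i_1),\dots,\pi(i_m))$ is order-isomorphic to $(\sigma(1),\dots,\sigma(m))$; $t(\pi,\sigma)=0$ if $m>n$. A copula is the distribution function of a probability measure on $[0,1]^2$ with uniform marginals. For points $(u_i,v_i)$, $i\le n$, with no ties in either coordinate, $\Pi_n$ is the unique $\pi\in\mathbb{S}_n$ with $u_i<u_j\iff v_{\pi(i)}<v_{\pi(j)}$; the random permutation generated by an i.i.d. sample is $\Pi_n$ applied to it. For a copula $C$ and independent $Z_1,Z_2,Z_2',\dots$ with distribution function $C$: $C^{\mathbb{S}}(\sigma)=\mathbb{P}(\Pi_k(Z_1,\dots,Z_k)=\sigma)$ ($\sigma\in\mathbb{S}_k$), and $C^{\mathbb{S},2}(\sigma,\tau)=\mathbb{P}(\Pi_k(Z_1,Z_2,\dots,Z_k)=\sigma,\Pi_j(Z_1,Z_2',\dots,Z_j')=\tau)$ ($\sigma\in\mathbb{S}_k,\tau\in\mathbb{S}_j$). Weights: $p_\sigma=\gamma\,|\sigma|!^{-2}2^{-|\sigma|}$ with $\gamma=e^{-1/2}(1-e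^{-1/2})^{-1}$.
   Formalization: The generated permutation is the standard one (sort points by first coordinate, read ranks of the second), since the literal rule u_i<u_j iff v_π(i)<v_π(j) gives a copula and its transpose the same law, which makes the power claim false. *)

(* Defs.v *)
From HB Require Import structures.
From mathcomp Require Import all_boot all_order all_algebra.
From mathcomp Require Import fingroup perm.
From mathcomp Require Import all_classical all_reals all_analysis.
Set Implicit Arguments. Unset Strict Implicit. Unset Printing Implicit Defensive.
Import Order.TTheory GRing.Theory Num.Theory.
Import numFieldTopology.Exports.
Local Open Scope ring_scope.
Local Open Scope classical_set_scope.

Section Defs.
Variable R : realType.
Notation pt := (R * R)%type.

(* A copula, given through its underlying probability measure mu on R x R:
   uniform marginals on [0,1] (and support in [0,1]^2). *)
Definition is_copula (mu : probability pt R) : Prop :=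
  mu (~` ([set p : pt | 0 <= p.1 <= 1 /\ 0 <= p.2 <= 1])) = 0%E /\
  (forall x : R, 0 <= x <= 1 -> mu [set p : pt | p.1 <= x] = x%:E) /\
  (forall x : R, 0 <= x <= 1 -> mu [set p : pt | p.2 <= x] = x%:E).

Definition copula_df (mu : probability pt R) (u v : R) : R :=
  fine (mu [set p : pt | p.1 <= u /\ p.2 <= v]).

Fixpoint iter_int (mu : probability pt R) (m : nat)
    (f : seq pt -> \bar R) (s : seq pt) : \bar R :=
  match m with
  | 0 => f s
  | m'.+1 => (\int[mu]_z iter_int mu m' f (rcons s z))%E
  end.

Definition iid_prob (mu : probability pt R) (n : nat) (E : seq pt -> Prop) : R :=
  fine (iter_int mu n (fun s => if pselect (E s) then 1%E else 0%E) [::]).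

(* gen s pi : the points s (of size n) have no ties in either coordinate and
   the permutation they generate is pi: rho orders the points by their first
   coordinate, and pi (rho i) is the rank of the second coordinate of point i. *)
Definition gen (n : nat) (s : seq pt) (pi : 'S_n) : Prop :=
  size s = n /\
  exists rho : 'S_n, forall i j : 'I_n,
    ((nth (0, 0) s i).1 < (nth (0, 0) s j).1) = (rho i < rho j)%N /\
    ((nth (0, 0) s i).2 < (nth (0, 0) s j).2) = (pi (rho i) < pi (rho j))%N.

Definition tdens (n m : nat) (pi : 'S_n) (sigma : 'S_m) : R :=
  if (m <= n)%N then
    #|[set f : {ffun 'I_m -> 'I_n} |
        [forall i : 'I_m, forall j : 'I_m, (i < j)%N ==> (f i < f j)%N] &&
        [forall i : 'I_m, forall j : 'I_m,
           (pi (f i) < pi (f j))%N == (sigma i < sigma j)%N]]|%:R / ('C(n, m))%:R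
  else 0.

Definition CS (mu : probability pt R) (k : nat) (sigma : 'S_k) : R :=
  iid_prob mu k (fun s => gen s sigma).

(* C^{S,2}(sigma, tau): sample Z_1, Z_2..Z_k, Z_2'..Z_j' (k + j - 1 points) *)
Definition CS2 (mu : probability pt R) (k j : nat) (sigma : 'S_k) (tau : 'S_j) : R :=
  iid_prob mu (k + j - 1)
    (fun s => gen (take k s) sigma /\ gen (head (0, 0) s :: drop k s) tau).

Definition gamma : R := expR (- (1 / 2)) / (1 - expR (- (1 / 2))).

Definition pw (m : nat) : R := gamma / ((m`!)%:R ^+ 2 * 2 ^+ m).

Definition cvm (mu0 : probability pt R) (n k : nat) (pi : 'S_n) : R :=
  n%:R * \sum_(1 <= m < k.+1) \sum_(sigma : 'S_m)
     pw m * (m%:R ^+ 2)^-1 * (tdens pi sigma - CS mu0 sigma) ^+ 2.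

Definition cvm_prob (mu mu0 : probability pt R) (n k : nat) (P : R -> Prop) : R :=
  iid_prob mu n (fun s => exists pi : 'S_n, gen s pi /\ P (cvm mu0 k pi)).

Definition cq (mu0 : probability pt R) (n k : nat) (alpha : R) : R :=
  inf [set t : R | cvm_prob mu0 mu0 n k (fun x => t < x) <= alpha].

End Defs.

(* Main.v *)
(** Level. The quantile [c] satisfies [P(X > c) <= alpha <= P(X >= c)], so the
    error of the level is at most the atom [P(X = c)], and it is enough that the
    largest atom of the statistic [X] vanishes as [n] grows; no limit law is
    needed.  Give each of the first [q] sample points an independent
    alternative, [q] fixed.  As a function on the cube [{0,1}^q] of choices,
    [n / 2 * X] has second differences which, up to an error of order
    [1 / sqrt n], do not depend on the remaining choices: they are the values at
    the two pairs of points of the positive semidefinite kernel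
    [sum_sigma w_sigma m^2 (h_sigma(a') - h_sigma(a)) (h_sigma(b') - h_sigma(b))],
    where [h_sigma] is the first Hoeffding projection.  Nondegeneracy makes the
    kernel nonzero with positive probability.  Split the cube into rows and
    columns: first differences in a row direction are strictly monotone in many
    column directions, hence by a Littlewood-Offord (LYM) argument rarely
    small; when they are not small, [X] is strictly monotone in many row
    directions, and the same argument bounds the proportion of the cube on
    which [X = x].

    Power. Two pattern occurrences on disjoint index sets are independent, so
    [Var t(Pi_n, sigma) <= m^2 / n]; under [C_0] the mean of [X] is bounded and
    so are the quantiles.  If all pattern probabilities of two copulas agree,
    so do the laws of the ranks, which approximate the coordinates of the
    points; hence [C <> C_0] is detected by some pattern, for which
    [n (t - C_0(sigma))^2] tends to infinity. *)

Require Import Defs.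
From HB Require Import structures.
From mathcomp Require Import all_boot all_order all_algebra.
From mathcomp Require Import fingroup perm.
From mathcomp Require Import all_classical all_reals all_analysis.
From mathcomp Require Import measurable_realfun.
From mathcomp Require Import ring lra zify.
Import Order.TTheory GRing.Theory Num.Theory.
Import numFieldTopology.Exports.
Local Open Scope ring_scope.
Local Open Scope classical_set_scope.
Set Implicit Arguments. Unset Strict Implicit. Unset Printing Implicit Defensive.

(** * Integration over finitely many sample points *)

(** The truncation [k] may be as large as [n], so every estimate has to be uniform in [k]. The
    errors attached to a pattern of size [m] are at most a constant times [m^4], and the weights sum
    [m^4] over all patterns to at most [2 * gamma].

    First differences of the statistic contain the fluctuating factor [t - C_0(sigma)]. Second
    differences lose it, because the second difference of a square is twice the product of the two
    first differences plus small terms. With the alternatives stored at the indices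
    [n, ..., 2n - 1], a corner of the cube is an injective reindexing of the sample and has the same
    law, so [P(X = x)] is the mean proportion of corners at which [X = x].

    Rows and columns play unequal roles. A first difference in a row direction must beat the total
    influence of the other rows, which grows with their number [r]; the number of columns is
    therefore chosen after [r], large enough to make failure rare. The size [n] comes last, so that
    all approximation errors, one for each corner and each pair of coordinates, are small
    together. *)

Section Sample.
Variable R : realType.
Notation pt := (R * R)%type.
Notation sample := (nat -> pt).

Definition depends (A : Type) (P : nat -> Prop) (f : sample -> A) :=
  forall w w' : sample, (forall i, P i -> w i = w' i) -> f w = f w'.

(* Testing against families of measurable maps avoids a sigma-algebra on
   samples and makes closure under reindexing and partial integration
   immediate. *)
Definition smeas d' (U : measurableType d') (f : sample -> U) :=
  forall d (T : measurableType d) (phi : nat -> T -> pt),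
    (forall i, measurable_fun setT (phi i)) ->
    measurable_fun setT (fun x => f (fun i => phi i x)).

Definition findep (A : Type) (f : sample -> A) :=
  exists N : nat, depends (fun i => (i < N)%N) f.

Definition cyl d' (U : measurableType d') (f : sample -> U) := findep f /\ smeas f.

Definition bcyl (f : sample -> R) :=
  cyl f /\ exists B : R, forall w, `|f w| <= B.

Lemma dependsW (A : Type) (P Q : nat -> Prop) (f : sample -> A) :
  (forall i, P i -> Q i) -> depends P f -> depends Q f.
Proof. by move=> PQ fP w w' ww'; apply: fP => i /PQ; exact: ww'. Qed.

Lemma findep2 (A B C : Type) (f : sample -> A) (g : sample -> B) (h : A -> B -> C) :
  findep f -> findep g -> findep (fun w => h (f w) (g w)).
Proof.
move=> [N fN] [M gM]; exists (maxn N M) => w w' ww'; congr h.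
  by apply: fN => i iN; apply: ww'; rewrite leq_max iN.
by apply: gM => i iN; apply: ww'; rewrite leq_max iN orbT.
Qed.

Lemma findep1 (A B : Type) (f : sample -> A) (h : A -> B) :
  findep f -> findep (fun w => h (f w)).
Proof. by move=> [N fN]; exists N => w w' ww'; congr h; exact: fN. Qed.

Lemma cyl_cst d' (U : measurableType d') (c : U) : cyl (fun _ => c).
Proof. by split; [exists 0%N | move=> *; exact: measurable_cst]. Qed.

Lemma cyl_fst i : cyl (fun w : sample => (w i).1 : R).
Proof.
split; first by exists i.+1 => w w' ->.
by move=> d T phi mphi; apply: measurableT_comp; [exact: measurable_fst|exact: mphi].
Qed.

Lemma cyl_snd i : cyl (fun w : sample => (w i).2 : R).
Proof.
split; first by exists i.+1 => w w' ->.
by move=> d T phi mphi; apply: measurableT_comp; [exact: measurable_snd|exact: mphi].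
Qed.

Lemma cylD (f g : sample -> R) : cyl f -> cyl g -> cyl (fun w => f w + g w).
Proof.
move=> [df mf] [dg mg]; split; first exact: findep2.
by move=> d T phi mphi; apply: measurable_funD; [exact: mf|exact: mg].
Qed.

Lemma cylM (f g : sample -> R) : cyl f -> cyl g -> cyl (fun w => f w * g w).
Proof.
move=> [df mf] [dg mg]; split; first exact: findep2.
by move=> d T phi mphi; apply: measurable_funM; [exact: mf|exact: mg].
Qed.

Lemma cyl_norm (f : sample -> R) : cyl f -> cyl (fun w => `|f w|).
Proof.
move=> [df mf]; split; first exact: (findep1 Num.norm).
by move=> d T phi mphi; apply: measurableT_comp; [exact: normr_measurable|exact: mf].
Qed.

Lemma cyl_lt (f g : sample -> R) : cyl f -> cyl g -> cyl (fun w => f w < g w).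
Proof.
move=> [df mf] [dg mg]; split; first exact: (findep2 (fun x y => x < y)).
by move=> d T phi mphi; apply: measurable_fun_ltr; [exact: mf|exact: mg].
Qed.

Lemma cyl_le (f g : sample -> R) : cyl f -> cyl g -> cyl (fun w => f w <= g w).
Proof.
move=> [df mf] [dg mg]; split; first exact: (findep2 (fun x y => x <= y)).
by move=> d T phi mphi; apply: measurable_fun_ler; [exact: mf|exact: mg].
Qed.

Lemma cyl_eq (f g : sample -> R) : cyl f -> cyl g -> cyl (fun w => f w == g w).
Proof.
move=> [df mf] [dg mg]; split; first exact: (findep2 (fun x y => x == y)).
by move=> d T phi mphi; apply: measurable_fun_eqr; [exact: mf|exact: mg].
Qed.

Lemma cyl_and (f g : sample -> bool) : cyl f -> cyl g -> cyl (fun w => f w && g w).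
Proof.
move=> [df mf] [dg mg]; split; first exact: (findep2 andb).
by move=> d T phi mphi; apply: measurable_and; [exact: mf|exact: mg].
Qed.

Lemma cyl_neg (f : sample -> bool) : cyl f -> cyl (fun w => ~~ f w).
Proof.
move=> [df mf]; split; first exact: (findep1 negb).
by move=> d T phi mphi; apply: measurable_neg; exact: mf.
Qed.

Lemma cyl_eqb (f : sample -> bool) (b : bool) : cyl f -> cyl (fun w => f w == b).
Proof.
by case: b => cf; [under eq_fun do rewrite eqb_id
                  |under eq_fun do rewrite eqbF_neg; exact: cyl_neg].
Qed.

Lemma cyl_all (I : finType) (b : I -> sample -> bool) :
  (forall i, cyl (b i)) -> cyl (fun w => [forall i, b i w]).
Proof.
move=> cb; rewrite (_ : (fun _ => _) = fun w => all (b^~ w) (enum I)).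
  elim: (enum I) => [|i s IH] /=; first exact: cyl_cst.
  by apply: cyl_and.
apply/funext => w; apply/forallP/allP => [H i _|H i]; first exact: H.
by apply: H; rewrite mem_enum.
Qed.

Lemma cyl_ex (I : finType) (b : I -> sample -> bool) :
  (forall i, cyl (b i)) -> cyl (fun w => [exists i, b i w]).
Proof.
move=> cb; rewrite (_ : (fun _ => _) = fun w => ~~ [forall i, ~~ b i w]).
  by apply/cyl_neg/cyl_all => i; exact: cyl_neg.
by apply/funext => w; rewrite negb_forall; apply: eq_existsb => i; rewrite negbK.
Qed.

Lemma cyl_comp d' (U : measurableType d') (f : sample -> U) (th : nat -> nat) :
  cyl f -> cyl (fun w => f (fun i => w (th i))).
Proof.
move=> [[N fN] mf]; split; last by move=> d T phi mphi; apply: mf => i; exact: mphi.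
exists (\max_(i < N) (th i)).+1 => w w' ww'; apply: fN => i iN; apply: ww'.
by rewrite ltnS (leq_bigmax (Ordinal iN)).
Qed.

Lemma bcyl_cst (c : R) : bcyl (fun _ => c).
Proof. by split; [exact: cyl_cst | exists `|c|]. Qed.

Lemma bcylD (f g : sample -> R) : bcyl f -> bcyl g -> bcyl (fun w => f w + g w).
Proof.
move=> [cf [B fB]] [cg [C gC]]; split; first exact: cylD.
by exists (B + C) => w; apply: (le_trans (ler_normD _ _)); exact: lerD.
Qed.

Lemma bcylM (f g : sample -> R) : bcyl f -> bcyl g -> bcyl (fun w => f w * g w).
Proof.
move=> [cf [B fB]] [cg [C gC]]; split; first exact: cylM.
by exists (B * C) => w; rewrite normrM; exact: ler_pM.
Qed.

Lemma bcylZ (c : R) (f : sample -> R) : bcyl f -> bcyl (fun w => c * f w).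
Proof. by apply: bcylM; exact: bcyl_cst. Qed.

Lemma bcylN (f : sample -> R) : bcyl f -> bcyl (fun w => - f w).
Proof. by move=> /(bcylZ (-1)); under eq_fun do rewrite mulN1r. Qed.

Lemma bcylB (f g : sample -> R) : bcyl f -> bcyl g -> bcyl (fun w => f w - g w).
Proof. by move=> bf bg; apply: bcylD => //; exact: bcylN. Qed.

Lemma bcylX (f : sample -> R) n : bcyl f -> bcyl (fun w => f w ^+ n).
Proof.
move=> bf; elim: n => [|n IH]; first exact: bcyl_cst.
by under eq_fun do rewrite exprS; exact: bcylM.
Qed.

Lemma bcyl_norm (f : sample -> R) : bcyl f -> bcyl (fun w => `|f w|).
Proof.
move=> [cf [B fB]]; split; first exact: cyl_norm.
by exists B => w; rewrite normr_id.
Qed.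

Lemma bcyl_sum (I : Type) (s : seq I) (P : pred I) (f : I -> sample -> R) :
  (forall i, P i -> bcyl (f i)) -> bcyl (fun w => \sum_(i <- s | P i) f i w).
Proof.
move=> bf; elim: s => [|i s IH].
  by under eq_fun do rewrite big_nil; exact: bcyl_cst.
under eq_fun do rewrite big_cons.
by case: (boolP (P i)) => Pi //; apply: bcylD => //; exact: bf.
Qed.

Lemma bcyl_nat (b : sample -> bool) : cyl b -> bcyl (fun w => (b w)%:R).
Proof.
move=> [[N bN] mb]; split; last first.
  by exists 1 => w; case: (b w) => /=; rewrite ?normr1 ?normr0.
split; first by exists N => w w' ww'; congr (_%:R); rewrite (bN _ _ ww').
move=> d T phi mphi.
rewrite (_ : (fun _ => _) = fun x : T => if b (fun i => phi i x) then 1 else 0).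
  by apply: measurable_fun_ifT => //; exact: mb.
by apply/funext => x; case: (b _).
Qed.

Lemma bcyl_comp (f : sample -> R) (th : nat -> nat) :
  bcyl f -> bcyl (fun w => f (fun i => w (th i))).
Proof. by move=> [cf [B fB]]; split; [exact: cyl_comp|exists B => w]. Qed.

Definition upd (w : sample) (i : nat) (z : pt) : sample :=
  fun j => if j == i then z else w j.

Lemma updC w i j x y : i != j -> upd (upd w i x) j y = upd (upd w j y) i x.
Proof.
move=> ij; apply/funext => k; rewrite /upd; have [->|//] := eqVneq k j.
by rewrite eq_sym (negbTE ij).
Qed.

Variable mu : probability pt R.

(** The result stays a function of the whole sample, so that it acts as the conditional expectation
    given all points but the [i]-th. *)
Definition Int (i : nat) (f : sample -> R) : sample -> R :=
  fun w => \int[mu]_z f (upd w i z).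

Lemma bcyl_integrable (f : sample -> R) w i :
  bcyl f -> mu.-integrable setT (EFin \o (fun z => f (upd w i z))).
Proof.
move=> [[df mf] [B fB]]; apply: measurable_bounded_integrable => //.
- exact: le_lt_trans (probability_le1 mu measurableT) (ltry 1).
- apply: (mf _ _ (fun k z => upd w i z k)) => k; rewrite /upd.
  by case: eqP => _; [exact: measurable_id|exact: measurable_cst].
- by exists B; split; [exact: num_real|move=> C /ltW BC x _; exact: le_trans (fB _) BC].
Qed.

Lemma EFin_Int i (f : sample -> R) w : bcyl f ->
  (Int i f w)%:E = (\int[mu]_z (f (upd w i z))%:E)%E.
Proof.
move=> bf; rewrite /Int /Rintegral fineK//.
by apply: integrable_fin_num => //; exact: bcyl_integrable.
Qed.

Lemma Int_cst i (c : R) w : Int i (fun _ => c) w = c.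
Proof.
rewrite /Int Rintegral_cst// -[RHS]mulr1; congr (_ * _).
exact: (congr1 fine (probability_setT mu)).
Qed.

Lemma le_Int i (f g : sample -> R) w : bcyl f -> bcyl g -> (forall w, f w <= g w) ->
  Int i f w <= Int i g w.
Proof. by move=> bf bg fg; apply: le_Rintegral => //; exact: bcyl_integrable. Qed.

Lemma IntD i (f g : sample -> R) w : bcyl f -> bcyl g ->
  Int i (fun w => f w + g w) w = Int i f w + Int i g w.
Proof. by move=> bf bg; apply: RintegralD => //; exact: bcyl_integrable. Qed.

Lemma IntMl i (f g : sample -> R) w : bcyl f -> depends (fun j => j != i) g ->
  Int i (fun w => g w * f w) w = g w * Int i f w.
Proof.
move=> bf dg; rewrite /Int -RintegralZl//; last exact: bcyl_integrable.
apply: eq_Rintegral => z _; congr (_ * _); apply: dg => j ji.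
by rewrite /upd (negbTE ji).
Qed.

Lemma Int_indep i (f : sample -> R) w : depends (fun j => j != i) f ->
  Int i f w = f w.
Proof.
move=> df; rewrite -[RHS]mulr1 -[in RHS](Int_cst i 1 w) -IntMl//; last exact: bcyl_cst.
by apply: eq_Rintegral => z _; rewrite mulr1.
Qed.

Lemma depends_Int i (P : nat -> Prop) (f : sample -> R) :
  depends P f -> depends (fun j => P j /\ j <> i) (Int i f).
Proof.
move=> df w w' ww'; apply: eq_Rintegral => z _; apply: df => j Pj.
by rewrite /upd; case: eqP => // ?; exact: ww'.
Qed.

Lemma bcyl_Int i (f : sample -> R) : bcyl f -> bcyl (Int i f).
Proof.
move=> bf; have [[[N fN] mf] [B fB]] := bf.
split; last first.
  exists B => w; rewrite ler_norml; apply/andP; split.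
    rewrite -{1}(Int_cst i (- B) w); apply: le_Int => //; first exact: bcyl_cst.
    by move=> w'; have := fB w'; rewrite ler_norml => /andP[].
  rewrite -{1}(Int_cst i B w); apply: le_Int => //; first exact: bcyl_cst.
  by move=> w'; have := fB w'; rewrite ler_norml => /andP[].
split; first by exists N; apply: dependsW (depends_Int fN) => j [].
move=> d T phi mphi.
(* Tonelli measurability is available for nonnegative integrands, hence the shift by [|B|]. *)
have -> : (fun x => Int i f (fun j => phi j x)) = (fun x =>
    fine (fubini_F mu (fun p : T * pt =>
      (f (upd (fun j => phi j p.1) i p.2) + `|B|)%:E) x) - `|B|).
  apply/funext => x; have bB := bcyl_cst `|B|.
  rewrite /fubini_F/= -(EFin_Int _ _ (bcylD bf bB))/= IntD//.
  by rewrite Int_cst addrK.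
apply: measurable_funB => //.
apply: measurableT_comp; first exact: fine_measurable.
apply: measurable_fun_fubini_tonelli_F; last first.
  move=> p; rewrite lee_fin -lerBlDr sub0r.
  have := fB (upd (fun j => phi j p.1) i p.2).
  by move=> /(le_trans)/(_ (ler_norm B)); rewrite ler_norml => /andP[].
apply/measurable_EFinP; apply: measurable_funD => //.
apply: (mf _ _ (fun k (p : T * pt) => upd (fun j => phi j p.1) i p.2 k)) => k.
rewrite /upd; case: eqP => _; first exact: measurable_snd.
by apply: measurableT_comp; [exact: mphi|exact: measurable_fst].
Qed.

Lemma IntC i j (f : sample -> R) w : bcyl f -> Int i (Int j f) w = Int j (Int i f) w.
Proof.
move=> bf; have [->//|ij] := eqVneq i j.
apply: EFin_inj; rewrite !EFin_Int//; try exact: bcyl_Int.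
under eq_integral do rewrite EFin_Int//.
under [RHS]eq_integral do rewrite EFin_Int//.
have [[_ mf] [B fB]] := bf.
pose F (p : pt * pt) := (f (upd (upd w i p.1) j p.2))%:E.
have intF : (mu \x mu)%E.-integrable setT F.
  apply: measurable_bounded_integrable => //.
  - have E := @product_measure1E _ _ _ _ R mu mu setT setT measurableT measurableT.
    rewrite setXTT in E; apply: (eq_ind_r (fun x => (x < +oo)%E) _ E).
    have E1 : mu setT = 1%E := probability_setT mu.
    by apply: (eq_ind_r (fun x => (x * x < +oo)%E) _ E1); rewrite mul1e ltry.
  - apply: (mf _ _ (fun k (p : pt * pt) => upd (upd w i p.1) j p.2 k)) => k.
    rewrite /upd; case: eqP => _; first exact: measurable_snd.
    by case: eqP => _; [exact: measurable_fst|exact: measurable_cst].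
  - by exists B; split; [exact: num_real|move=> C /ltW BC x _; exact: le_trans (fB _) BC].
have := Fubini intF; rewrite /F/= => ->.
by apply: eq_integral => y _; apply: eq_integral => x _; rewrite updC.
Qed.

Definition iter_Int (l : seq nat) (f : sample -> R) : sample -> R := foldr Int f l.

Lemma bcyl_Ints l f : bcyl f -> bcyl (iter_Int l f).
Proof. by move=> bf; elim: l => //= i l IH; exact: bcyl_Int. Qed.

Lemma eq_Int i (f g : sample -> R) w : f =1 g -> Int i f w = Int i g w.
Proof. by move=> fg; apply: eq_Rintegral => z _; exact: fg. Qed.

Lemma Ints_IntC l i f w : bcyl f -> iter_Int l (Int i f) w = Int i (iter_Int l f) w.
Proof.
move=> bf; elim: l w => //= j l IH w.
by rewrite (eq_Int _ _ IH) IntC//; exact: bcyl_Ints.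
Qed.

Lemma eq_Ints l (f g : sample -> R) w : f =1 g -> iter_Int l f w = iter_Int l g w.
Proof. by move=> fg; elim: l w => //= i l IH w; exact: eq_Int. Qed.

Lemma le_Ints l (f g : sample -> R) w : bcyl f -> bcyl g -> (forall w, f w <= g w) ->
  iter_Int l f w <= iter_Int l g w.
Proof.
move=> bf bg fg; elim: l w => //= i l IH w.
by apply: le_Int => //; exact: bcyl_Ints.
Qed.

Lemma IntsD l (f g : sample -> R) w : bcyl f -> bcyl g ->
  iter_Int l (fun w => f w + g w) w = iter_Int l f w + iter_Int l g w.
Proof.
move=> bf bg; elim: l w => //= i l IH w; rewrite (eq_Int _ _ IH) IntD//;
  exact: bcyl_Ints.
Qed.

Lemma IntsMl l (f g : sample -> R) w : bcyl f -> depends (fun j => j \notin l) g ->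
  iter_Int l (fun w => g w * f w) w = g w * iter_Int l f w.
Proof.
move=> bf; elim: l w => //= i l IH w dg.
rewrite -IntMl; last 2 first.
- exact: bcyl_Ints.
- by apply: dependsW dg => j; rewrite inE negb_or => /andP[].
apply: eq_Int => u; apply: IH; apply: dependsW dg => j.
by rewrite inE negb_or => /andP[].
Qed.

Lemma Ints_cst l (c : R) w : iter_Int l (fun _ => c) w = c.
Proof. by elim: l w => //= i l IH w; rewrite (eq_Int _ _ IH) Int_cst. Qed.

Lemma Ints_indep l f w : depends (fun j => j \notin l) f -> iter_Int l f w = f w.
Proof.
move=> df; rewrite -[RHS]mulr1 -[in RHS](Ints_cst l 1 w) -IntsMl//; last exact: bcyl_cst.
by apply: eq_Ints => u; rewrite mulr1.
Qed.

Lemma depends_Ints l (P : nat -> Prop) (f : sample -> R) :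
  depends P f -> depends (fun j => P j /\ j \notin l) (iter_Int l f).
Proof.
elim: l => [|i l IH] df /=; first by apply: dependsW df => j.
apply: dependsW (depends_Int (IH df)) => j [[Pj jl] ji]; split=> //.
by rewrite inE negb_or jl andbT; apply/eqP.
Qed.

Lemma Int_comp (th : nat -> nat) i f w : injective th ->
  Int (th i) (fun w => f (fun k => w (th k))) w = Int i f (fun k => w (th k)).
Proof.
move=> th_inj; apply: eq_Rintegral => z _; congr f; apply/funext => k.
by rewrite /upd (inj_eq th_inj).
Qed.

Lemma Ints_comp (th : nat -> nat) l f w : injective th ->
  iter_Int (map th l) (fun w => f (fun k => w (th k))) w = iter_Int l f (fun k => w (th k)).
Proof.
move=> th_inj; elim: l w => //= i l IH w.
by rewrite (eq_Int _ _ IH) Int_comp.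
Qed.

Definition w0 : sample := fun _ => (0, 0).

(** Choosing a bound makes the expectation a function of [f] alone; by [Ints_full] neither this
    choice nor the base point [w0] matters. *)
Definition support_bound (f : sample -> R) : nat :=
  xget 0%N [set N | depends (fun i => (i < N)%N) f].

Definition iid_expectation (f : sample -> R) : R := iter_Int (iota 0 (support_bound f)) f w0.

Lemma depends_support f : findep f -> depends (fun i => (i < support_bound f)%N) f.
Proof.
move=> df; rewrite /support_bound.
by case: xgetP => [N -> //|H]; case: df => N /H.
Qed.

(** Both iterated integrals are constant functions, so integrating either over the list of the other
    changes nothing; commuting the two lists identifies the constants. *)
Lemma Ints_full l f w : bcyl f -> depends (fun i => i \in l) f -> iter_Int l f w = iid_expectation f.
Proof.
move=> bf dl; have ds := depends_support bf.1.1.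
set s := iota 0 (support_bound f).
have E1 (g : sample -> R) (P : nat -> Prop) k : depends P g -> (forall i, P i -> i \in k) ->
    forall u u', iter_Int k g u = iter_Int k g u'.
  move=> dP Pk u u'; apply: (@depends_Ints k P g dP) => i [/Pk ik].
  by rewrite ik.
have cl : forall u u', iter_Int l f u = iter_Int l f u' by exact: E1 dl _.
have cs : forall u u', iter_Int s f u = iter_Int s f u'.
  by apply: E1 ds _ => i; rewrite mem_iota add0n.
have H k1 k2 u : (forall u u', iter_Int k1 f u = iter_Int k1 f u') ->
    iter_Int k2 (iter_Int k1 f) u = iter_Int k1 f u.
  move=> c; rewrite -[RHS](Ints_cst k2 _ u); apply: eq_Ints => u'; exact: c.
have {}ds : depends (fun i => i \in s) f.
  by apply: dependsW ds => i; rewrite mem_iota add0n.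
have E2 k1 k2 u : depends (fun i => i \in k2) f -> iter_Int k1 (iter_Int k2 f) u = iter_Int k2 (iter_Int k1 f) u.
  move=> _; elim: k1 u => //= i k1 IH u.
  by rewrite (eq_Int _ _ IH) Ints_IntC//; exact: bcyl_Ints.
by rewrite /iid_expectation -/s -(H l s)// E2// (H s l)//; exact: cs.
Qed.
End Sample.

Section Expectation.
Variable R : realType.
Notation pt := (R * R)%type.
Notation sample := (nat -> pt).
Variable mu : probability pt R.
Notation Ints := (iter_Int mu).
Notation Ex := (iid_expectation mu).

(** Passes through the hybrid sample that agrees with [w] on [P] and with [w'] elsewhere. *)
Lemma dependsI (A : Type) (P Q : nat -> Prop) (f : sample -> A) :
  depends P f -> depends Q f -> depends (fun i => P i /\ Q i) f.
Proof.
move=> fP fQ w w' ww'.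
rewrite (fP w (fun i => if `[< P i >] then w i else w' i)).
  by apply: fQ => i Qi; case: asboolP => // Pi; exact: ww'.
by move=> i Pi; case: asboolP.
Qed.

Lemma Ex_iota (f : sample -> R) N w : bcyl f -> depends (fun i => (i < N)%N) f ->
  Ints (iota 0 N) f w = Ex f.
Proof.
move=> bf dN; apply: Ints_full => //; apply: dependsW dN => i.
by rewrite mem_iota add0n.
Qed.

Lemma Ex_cst (c : R) : Ex (fun _ => c) = c.
Proof. exact: Ints_cst. Qed.

Lemma findepP2 (f g : sample -> R) : bcyl f -> bcyl g ->
  exists N, depends (fun i => (i < N)%N) f /\ depends (fun i => (i < N)%N) g.
Proof.
move=> [[[N fN] _] _] [[[M gM] _] _]; exists (maxn N M).
by split; [apply: dependsW fN|apply: dependsW gM] => i H; rewrite leq_max H ?orbT.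
Qed.

Lemma ExD (f g : sample -> R) : bcyl f -> bcyl g ->
  Ex (fun w => f w + g w) = Ex f + Ex g.
Proof.
move=> bf bg; have [N [fN gN]] := findepP2 bf bg.
rewrite -(Ex_iota (@w0 R) bf fN) -(Ex_iota (@w0 R) bg gN) -IntsD//.
rewrite (Ex_iota (N := N))//; first exact: bcylD.
by move=> w w' ww'; congr (_ + _); [exact: fN|exact: gN].
Qed.

Lemma eq_Ex (f g : sample -> R) : f =1 g -> Ex f = Ex g.
Proof. by move=> /funext ->. Qed.

Lemma ExZ (c : R) (f : sample -> R) : bcyl f -> Ex (fun w => c * f w) = c * Ex f.
Proof.
move=> bf; have [N fN] := bf.1.1.
rewrite -(Ex_iota (@w0 R) bf fN) -IntsMl// (Ex_iota (N := N))//; first exact: bcylZ.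
by move=> w w' ww'; congr (_ * _); exact: fN.
Qed.

Lemma ExN (f : sample -> R) : bcyl f -> Ex (fun w => - f w) = - Ex f.
Proof. by move=> bf; under eq_Ex do rewrite -mulN1r; rewrite ExZ// mulN1r. Qed.

Lemma ExB (f g : sample -> R) : bcyl f -> bcyl g ->
  Ex (fun w => f w - g w) = Ex f - Ex g.
Proof. by move=> bf bg; rewrite ExD ?ExN//; exact: bcylN. Qed.

Lemma Ex_sum (I : Type) (s : seq I) (P : pred I) (f : I -> sample -> R) :
  (forall i, P i -> bcyl (f i)) ->
  Ex (fun w => \sum_(i <- s | P i) f i w) = \sum_(i <- s | P i) Ex (f i).
Proof.
move=> bf; elim: s => [|i s IH].
  by under eq_Ex do rewrite big_nil; rewrite big_nil Ex_cst.
under eq_Ex do rewrite big_cons.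
rewrite big_cons; case: (boolP (P i)) => // Pi.
by rewrite ExD ?IH//; [exact: bf|exact: bcyl_sum].
Qed.

Lemma le_Ex (f g : sample -> R) : bcyl f -> bcyl g -> (forall w, f w <= g w) ->
  Ex f <= Ex g.
Proof.
move=> bf bg fg; have [N [fN gN]] := findepP2 bf bg.
by rewrite -(Ex_iota (@w0 R) bf fN) -(Ex_iota (@w0 R) bg gN); exact: le_Ints.
Qed.

Lemma Ex_ge0 (f : sample -> R) : bcyl f -> (forall w, 0 <= f w) -> 0 <= Ex f.
Proof. by move=> bf f0; rewrite -(Ex_cst 0); apply: le_Ex => //; exact: bcyl_cst. Qed.

Lemma Ex_le_cst (f : sample -> R) c : bcyl f -> (forall w, f w <= c) -> Ex f <= c.
Proof. by move=> bf fc; rewrite -(Ex_cst c); apply: le_Ex => //; exact: bcyl_cst. Qed.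

Lemma ler_norm_Ex (f : sample -> R) : bcyl f -> `|Ex f| <= Ex (fun w => `|f w|).
Proof.
move=> bf; rewrite ler_norml -ExN ?bcyl_norm//; last exact: bcyl_norm.
apply/andP; split; apply: le_Ex; try exact: bcyl_norm; try exact: bf.
- by apply/bcylN/bcyl_norm.
- by move=> w; rewrite lerNl -normrN ler_norm.
- by move=> w; exact: ler_norm.
Qed.

(** The tower property: conditional expectations are introduced through this equation. *)
Lemma Ex_Ints l (f : sample -> R) : bcyl f -> Ex (Ints l f) = Ex f.
Proof.
move=> bf; have [N fN] := bf.1.1; have bl := bcyl_Ints mu l bf.
have lN := depends_Ints mu (l := l) fN.
rewrite -(Ex_iota (@w0 R) (N := N) bl); last by apply: dependsW lN => i [].
have H k w : Ints k (Ints l f) w = Ints l (Ints k f) w.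
  elim: k w => //= i k IH w.
  by rewrite (eq_Int _ _ _ IH) Ints_IntC//; exact: bcyl_Ints.
rewrite H (eq_Ints _ _ _ (g := fun _ => Ex f)) ?Ints_cst// => w.
exact: Ex_iota.
Qed.

(** Exchangeability of the sample, from which all symmetry arguments below are drawn: shifts,
    occurrences of a pattern and corners of the cube are injective reindexings. *)
Lemma Ex_comp (f : sample -> R) (th : nat -> nat) : injective th -> bcyl f ->
  Ex (fun w => f (fun i => w (th i))) = Ex f.
Proof.
move=> thI bf; have [N fN] := bf.1.1; have bc := bcyl_comp th bf.
rewrite -(Ex_Ints (map th (iota 0 N)) bc).
rewrite (eq_Ex (g := fun _ => Ex f)) ?Ex_cst// => w.
by rewrite Ints_comp//; exact: Ex_iota.
Qed.

(** Integrating out the points in [P] leaves [g] untouched and replaces [f] by its mean. *)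
Lemma Ex_indep (P : nat -> Prop) (f g : sample -> R) : bcyl f -> bcyl g ->
  depends P f -> depends (fun i => ~ P i) g ->
  Ex (fun w => f w * g w) = Ex f * Ex g.
Proof.
move=> bf bg dP dQ; have [N fN] := bf.1.1.
pose l := [seq i <- iota 0 N | `[< P i >]].
rewrite -(Ex_Ints l (bcylM bf bg)).
rewrite (eq_Ex (g := fun w => Ex f * g w)) ?ExZ// => w.
rewrite (eq_Ints _ _ _ (g := fun w => g w * f w)); last by move=> u; rewrite mulrC.
rewrite IntsMl//; last first.
  by apply: dependsW dQ => i nP; rewrite mem_filter; case: asboolP.
rewrite mulrC Ints_full//; apply: dependsW (dependsI dP fN) => i [Pi iN].
rewrite mem_filter mem_iota add0n iN !andbT; exact/asboolP.
Qed.

Lemma Ex_markov (f : sample -> R) (b : sample -> bool) (c : R) : bcyl f -> cyl b ->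
  0 < c -> (forall w, 0 <= f w) -> (forall w, b w -> c <= f w) ->
  Ex (fun w => (b w)%:R) <= Ex f / c.
Proof.
move=> bf cb c0 f0 bc; rewrite mulrC -ExZ//; apply: le_Ex.
- exact: bcyl_nat.
- exact: bcylZ.
- move=> w; rewrite ler_pdivlMl//; case: (boolP (b w)) => [/bc|_].
    by rewrite mulr1.
  by rewrite mulr0.
Qed.

(* Replaces Cauchy-Schwarz: [2 |x| <= l + x^2 / l] *)
Lemma Ex_norm_le (f : sample -> R) (l : R) : bcyl f -> 0 < l ->
  Ex (fun w => `|f w|) <= (l + Ex (fun w => f w ^+ 2) / l) / 2.
Proof.
move=> bf l0.
have bs := bcylX 2 bf.
have -> : (l + Ex (fun w => f w ^+ 2) / l) / 2 =
    Ex (fun w => l / 2 + (l^-1 / 2) * f w ^+ 2).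
  rewrite ExD; [|exact: bcyl_cst|exact: bcylZ].
  by rewrite Ex_cst ExZ//; field; rewrite gt_eqF.
apply: le_Ex; first exact: bcyl_norm.
  by apply: bcylD; [exact: bcyl_cst|exact: bcylZ].
move=> w; rewrite -subr_ge0 -[f w ^+ 2]real_normK ?num_real//.
have -> : l / 2 + l^-1 / 2 * `|f w| ^+ 2 - `|f w| = (`|f w| - l) ^+ 2 / (2 * l).
  by field; rewrite gt_eqF.
by rewrite divr_ge0 ?sqr_ge0// mulr_ge0// ltW.
Qed.

Lemma mkseq_rcons_upd (w : sample) j z : rcons (mkseq w j) z = mkseq (upd w j z) j.+1.
Proof.
rewrite -[in RHS]addn1 /mkseq iotaD map_cat cats1/= add0n /upd eqxx; congr rcons.
apply/eq_in_map => i; rewrite mem_iota add0n => /andP[_ ij].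
by rewrite ltn_eqF.
Qed.

(** Links the recursion on lists with expectations on sequences: after [j] draws the list is
    [mkseq w j], and the points [j, ..., n - 1] remain to be integrated. *)
Lemma iid_probE n (E : seq pt -> Prop) :
  cyl (fun w : sample => `[< E (mkseq w n) >]) ->
  iid_prob mu n E = Ex (fun w => `[< E (mkseq w n) >]%:R).
Proof.
move=> cE; have bE := bcyl_nat cE.
have H m : forall j w, (m + j)%N = n ->
   iter_int mu m (fun s => if pselect (E s) then 1%E else 0%E) (mkseq w j) =
   (Ints (iota j m) (fun w => `[< E (mkseq w n) >]%:R) w)%:E.
  elim: m => [|m IH] j w /= mjn.
    rewrite add0n in mjn; rewrite mjn.
    by case: pselect => EE /=; [rewrite asboolT|rewrite asboolF].
  rewrite EFin_Int; last exact: bcyl_Ints.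
  apply: eq_integral => z _; rewrite mkseq_rcons_upd IH//.
  by rewrite addnS.
rewrite /iid_prob -[[::]]/(mkseq (@w0 R) 0) H ?addn0//= Ex_iota//.
move=> w w' ww'; congr ((asbool (E _))%:R).
by apply/eq_in_map => i; rewrite mem_iota add0n => /andP[_]; exact: ww'.
Qed.
End Expectation.

(** * Littlewood-Offord bounds on the cube *)

Section LittlewoodOfford.
Variable R : realType.

Lemma leq_bin_half n k : ('C(n, k) <= 'C(n, n./2))%N.
Proof.
have H j : (j <= n./2)%N -> ('C(n, n./2 - j) <= 'C(n, n./2))%N.
  elim: j => [|j IH] jn; first by rewrite subn0.
  apply: leq_trans (IH (ltnW jn)); set m := (n./2 - j.+1)%N.
  have mE : (n./2 - j)%N = m.+1 by rewrite /m; lia.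
  rewrite mE -(@leq_pmul2l m.+1)// mul_bin_left leq_mul2r.
  have : (m < n./2)%N by rewrite /m; lia.
  by have := odd_double_half n; lia.
have [kn|nk] := leqP k n; last by rewrite bin_small.
have [kh|hk] := leqP k n./2; first by have := H _ (leq_subr k n./2); rewrite subKn.
rewrite -bin_sub//; have := H (n./2 - (n - k))%N (leq_subr _ _).
by rewrite subKn//; have := odd_double_half n; lia.
Qed.

(** The proportion of the [n]-cube in its middle layer, which is Sperner's bound for an antichain;
    of the order [1 / sqrt n]. *)
Definition rho (n : nat) : R := 'C(n, n./2)%:R / 2 ^+ n.

Lemma rho_ge0 n : 0 <= rho n.
Proof. by rewrite divr_ge0// exprn_ge0. Qed.

(** By Pascal's rule the central binomial coefficient at most doubles when [n] grows by one. *)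
Lemma le_rho m n : (m <= n)%N -> rho n <= rho m.
Proof.
move=> /subnK <-; elim: (n - m)%N => // j; apply: le_trans.
rewrite addSn; move: (j + m)%N => {n j} n.
rewrite /rho exprS ler_pdivrMr ?mulr_gt0 ?exprn_gt0//.
have -> : 'C(n, n./2)%:R / 2 ^+ n * (2 * 2 ^+ n) = ('C(n, n./2) + 'C(n, n./2))%:R :> R.
  by rewrite natrD; field; rewrite expf_neq0.
rewrite ler_nat; have c0 : (0 < 'C(n, n./2))%N by rewrite bin_gt0; lia.
case: (n.+1./2) => [|k]; first by rewrite bin0 addn_gt0 c0.
by rewrite binS leq_add// leq_bin_half.
Qed.

(** With [a = 2n + 1], passing from [n] to [n + 1] multiplies the left-hand side by
    [a (a + 2) / (a + 1)^2], which is below one. *)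
Lemma rho_even n : rho n.*2 ^+ 2 * n.*2.+1%:R <= 1.
Proof.
rewrite /rho doubleK; elim: n => [|n IH]; first by rewrite bin0 expr0 divr1 expr1n mul1r.
have E : (n.+1%:R * 'C(n.+1.*2, n.+1)%:R = 2 * n.*2.+1%:R * 'C(n.*2, n)%:R :> R).
  have E1 := mul_bin_diag n.*2.+2 n; have E2 := mul_bin_down n.*2.+1 n.
  rewrite (_ : n.*2.+1 - n = n.+1)%N/= in E2; last lia.
  by rewrite -!natrM doubleS; congr (_%:R); rewrite -E1 -mulnA E2/= mulnA; congr muln; lia.
have {E}E : 'C(n.+1.*2, n.+1)%:R = 2 * n.*2.+1%:R * 'C(n.*2, n)%:R / n.+1%:R :> R.
  by rewrite -E mulrAC mulfV ?mul1r ?pnatr_eq0.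
apply: le_trans IH; rewrite E doubleS !exprS.
set c : R := 'C(_, _)%:R; set p : R := 2 ^+ n.*2.
have p0 : 0 < p by rewrite exprn_gt0.
have -> : n.*2.+3%:R = n.*2.+1%:R + 2 :> R by rewrite -natrD addn2.
have : n.+1%:R = (n.*2.+1%:R + 1) / 2 :> R.
  by rewrite -!natr1 -addnn natrD; field.
move=> ->; set a : R := n.*2.+1%:R; have a0 : 0 < a by rewrite ltr0n.
rewrite -subr_ge0 !expr0 !mulr1.
set L := (X in 0 <= X).
have -> : L = a * (c / p) ^+ 2 / (a + 1) ^+ 2.
  by rewrite /L; field; rewrite !gt_eqF// addr_gt0.
by rewrite divr_ge0 ?sqr_ge0// mulr_ge0 ?sqr_ge0// ltW.
Qed.

Lemma rho_to0 (e : R) : 0 < e -> exists n, rho n <= e.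
Proof.
move=> e0; pose n := Num.truncn (e ^- 2); exists n.*2.
have H : e ^- 2 <= n.*2.+1%:R.
  apply: le_trans (ltW (truncnS_gt _)) _; by rewrite ler_nat -/n; lia.
rewrite -(@ler_pXn2r _ 2) ?nnegrE ?rho_ge0 ?(ltW e0)//.
have n0 : 0 < n.*2.+1%:R :> R by rewrite ltr0n.
apply: (@le_trans _ _ (n.*2.+1%:R)^-1).
  by rewrite -[leRHS]mul1r ler_pdivlMr// rho_even.
by rewrite -[leRHS]invrK lef_pV2// posrE ?invr_gt0 exprn_gt0.
Qed.

Variable T : finType.
Implicit Types (A B C D I J : {set T}) (f g : {set T} -> R).

(** A uniform maximal chain from the empty set to [B] meets [A] with probability
    [1 / 'C(#|B|, #|A|)]; the recursion conditions on its last set before [B], which is [B :\ b] for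
    a uniform [b]. *)
Lemma sum_binV_rec B (F : {set T} -> R) : (0 < #|B|)%N ->
  \sum_(A : {set T} | A \subset B) F A / 'C(#|B|, #|A|)%:R =
  F B + #|B|%:R^-1 * \sum_(b in B) \sum_(A : {set T} | A \subset B :\ b)
           F A / 'C(#|B :\ b|, #|A|)%:R.
Proof.
move=> B0; rewrite (bigD1 B)//= binn divr1; congr (_ + _).
have cD1 b : b \in B -> #|B :\ b| = #|B|.-1 by move=> bB; rewrite (cardsD1 b B) bB.
rewrite mulr_sumr.
under [RHS]eq_bigr do rewrite mulr_sumr.
rewrite (exchange_big_dep (fun A : {set T} => (A \subset B) && (A != B)))/=; last first.
  move=> b A bB /subsetD1P[AB bA]; rewrite AB/=.
  by apply: contraNneq bA => ->.
apply: eq_bigr => A /andP[AB AneB].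
rewrite (eq_bigl (fun b => b \in B :\: A)); last first.
  by move=> b; rewrite subsetD1 AB/= inE andbC.
rewrite (eq_bigr (fun=> #|B|%:R^-1 * (F A / 'C(#|B|.-1, #|A|)%:R))); last first.
  by move=> b; rewrite inE => /andP[_ /cD1 ->].
rewrite sumr_const cardsD (finset.setIidPr AB).
have ltAB : (#|A| < #|B|)%N by rewrite proper_card// finset.properEneq AneB.
have E := mul_bin_down #|B| #|A|.
have C1 : 'C(#|B|, #|A|)%:R != 0 :> R by rewrite pnatr_eq0 -lt0n bin_gt0 ltnW.
have C2 : 'C(#|B|.-1, #|A|)%:R != 0 :> R.
  by rewrite pnatr_eq0 -lt0n bin_gt0 -ltnS prednK.
have B1 : #|B|%:R != 0 :> R by rewrite pnatr_eq0 -lt0n.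
have {}E : #|B|%:R * 'C(#|B|.-1, #|A|)%:R = (#|B| - #|A|)%:R * 'C(#|B|, #|A|)%:R :> R.
  by rewrite -!natrM E.
rewrite -[RHS]mulr_natl; have -> : (#|B| - #|A|)%:R = #|B|%:R * 'C(#|B|.-1, #|A|)%:R / 'C(#|B|, #|A|)%:R :> R.
  by rewrite E mulfK.
by field; rewrite B1 C1 C2.
Qed.

(* The left-hand side is the expected number of sets of a random maximal chain
   below [B] on which [f] lies in [[x, x + d]]; along a chain [f] grows by [s]
   at each step. *)
Lemma lym_interval f (s x d : R) B : 0 < s -> 0 <= d ->
  (forall A i, A \subset B -> i \in A -> f (A :\ i) + s <= f A) ->
  \sum_(A : {set T} | A \subset B) (x <= f A <= x + d)%R%:R / 'C(#|B|, #|A|)%:R <=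
  (if f B < x then 0 else (Num.min (f B) (x + d) - x) / s + 1 : R).
Proof.
move=> s0 d0; pose L y : R := if y < x then 0 else (Num.min y (x + d) - x) / s + 1.
rewrite -/(L (f B)).
have L0 y : 0 <= L y.
  rewrite /L; case: ltP => // xy; rewrite addr_ge0// divr_ge0 ?(ltW s0)// subr_ge0.
  by rewrite le_min xy lerDl.
have Lmono y z : y <= z -> L y <= L z.
  move=> yz; rewrite {2}/L; case: ltP => zx; first by rewrite /L (le_lt_trans yz zx).
  rewrite /L; case: ltP => yx.
    by rewrite addr_ge0// divr_ge0 ?(ltW s0)// subr_ge0 le_min zx lerDl.
  rewrite lerD2r ler_pM2r ?invr_gt0// lerD2r le_min !ge_min yz/= lexx orbT.
  by [].
(* A set with value in the window uses up one unit of the bound, and the next set of the chain has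
   value at most [y - s]. *)
have Lstep y : x <= y -> y <= x + d -> 1 + L (y - s) <= L y.
  move=> xy yd; rewrite /L; case: ltP => ysx; rewrite ltNge xy/=.
    by rewrite addr0 lerDr divr_ge0 ?(ltW s0)// subr_ge0 le_min xy lerDl.
  rewrite addrC lerD2r !min_l//; last by rewrite lerBlDr (le_trans yd)// lerDl ltW.
  have -> : y - s - x = (y - x) - s by ring.
  by rewrite mulrBl divff ?gt_eqF// subrK.
elim: {B}#|B| {-2}B (erefl #|B|) => [|n IH] B Bn H.
  have -> : B = finset.set0 by apply/eqP; rewrite -cards_eq0 Bn.
  rewrite (eq_bigl (fun A => A == finset.set0)); last by move=> A; rewrite finset.subset0.
  rewrite big_pred1_eq cards0 bin0 divr1.
  case: (boolP (_ <= _ <= _)) => [/andP[h1 h2]|_ //=].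
  by apply: le_trans (Lstep _ h1 h2); rewrite lerDl.
rewrite sum_binV_rec ?Bn//.
have avg : n.+1%:R^-1 * \sum_(b in B) \sum_(A : {set T} | A \subset B :\ b)
    (x <= f A <= x + d)%R%:R / 'C(#|B :\ b|, #|A|)%:R <= L (f B - s).
  rewrite ler_pdivrMl ?ltr0n// mulr_natl -Bn -sumr_const.
  apply: ler_sum => b bB; apply: le_trans (Lmono _ _ _); last first.
    by rewrite lerBrDr; apply: H bB.
  apply: IH => [|A i AB iA]; first by move: Bn; rewrite (cardsD1 b B) bB => -[].
  by apply: H => //; exact: fintype.subset_trans AB (finset.subsetDl _ _).
case: (boolP (_ <= _ <= _)) => [/andP[h1 h2]|_] /=.
  by apply: le_trans (Lstep _ h1 h2); rewrite lerD2l.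
by rewrite add0r; apply: le_trans avg _; apply: Lmono; rewrite lerBlDr lerDl ltW.
Qed.

(** Each chain probability [1 / 'C(#|B|, #|A|)] is at least that of the middle layer, so
    [lym_interval] also bounds the plain count. *)
Lemma card_monotone_interval f (s x d : R) B : 0 < s -> 0 <= d ->
  (forall A i, A \subset B -> i \in A -> f (A :\ i) + s <= f A) ->
  \sum_(A : {set T} | A \subset B) (x <= f A <= x + d)%R%:R <=
  (d / s + 1) * rho #|B| * 2 ^+ #|B|.
Proof.
move=> s0 d0 H; rewrite -mulrA divfK ?expf_neq0//.
set c : R := 'C(_, _)%:R; have c0 : 0 < c by rewrite ltr0n bin_gt0; lia.
rewrite -ler_pdivrMr// mulr_suml.
apply: (@le_trans _ _ (\sum_(A : {set T} | A \subset B)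
    (x <= f A <= x + d)%R%:R / 'C(#|B|, #|A|)%:R)).
  apply: ler_sum => A AB; rewrite ler_wpM2l// lef_pV2 ?posrE ?ltr0n ?bin_gt0 ?subset_leq_card//.
    by rewrite ler_nat leq_bin_half.
  lia.
apply: le_trans (lym_interval x s0 d0 H) _.
case: ltP => _; first by rewrite addr_ge0// divr_ge0 ?(ltW s0).
rewrite lerD2r ler_pM2r ?invr_gt0// lerBlDr addrC ge_min lexx orbT.
by [].
Qed.
End LittlewoodOfford.

Section QuadraticLO.
Local Open Scope set_scope.
Variable R : realType.
Variable T : finType.
Implicit Types (A B C D I J : {set T}) (f g : {set T} -> R).

Definition diff1 (i : T) f : {set T} -> R := fun A => f (i |: A) - f (A :\ i).

(** Exchanging presence and absence of those elements of [I] along which [f] decreases makes [f]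
    increasing on the subsets of [I]. *)
Lemma card_signed_interval f (sg : T -> bool) (s x d : R) I : 0 < s -> 0 <= d ->
  (forall A i, A \subset I -> i \in I -> s <= (-1) ^+ sg i * diff1 i f A) ->
  \sum_(A : {set T} | A \subset I) (x <= f A <= x + d)%R%:R <=
  (d / s + 1) * rho R #|I| * 2 ^+ #|I|.
Proof.
move=> s0 d0 H.
pose flip A := [set i | (i \in A) (+) (sg i && (i \in I))].
have flipK : involutive flip.
  by move=> A; apply/setP => i; rewrite !inE -addbA addbb addbF.
have flipI A : A \subset I -> flip A \subset I.
  move=> /fintype.subsetP AI; apply/fintype.subsetP => i; rewrite inE.
  by case: (boolP (i \in A)) => [/AI //|_]; rewrite addFb => /andP[].
rewrite (reindex_onto flip flip)/=; last by move=> A _; exact: flipK.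
rewrite (eq_bigl (fun A : {set T} => A \subset I)); last first.
  move=> A; rewrite flipK eqxx andbT; apply/idP/idP => [/flipI|/flipI//].
  by rewrite flipK.
apply: (card_monotone_interval (f := f \o flip)) => // A i AI iA /=.
have iI : i \in I by exact: fintype.subsetP AI i iA.
have := H _ i (flipI _ AI) iI; rewrite /diff1; case: (boolP (sg i)) => sgi /=.
  have -> : i |: flip A = flip (A :\ i).
    apply/setP => j; rewrite !inE; case: (eqVneq j i) => [->|//].
    by rewrite sgi iI.
  have -> : flip A :\ i = flip A.
    apply/setP => j; rewrite !inE; case: (eqVneq j i) => [->|//].
    by rewrite sgi iI iA.
  by rewrite expr1 => h; lra.
have -> : i |: flip A = flip A.
  apply/setP => j; rewrite !inE; case: (eqVneq j i) => [->|//].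
  by rewrite (negbTE sgi) iA.
have -> : flip A :\ i = flip (A :\ i).
  apply/setP => j; rewrite !inE; case: (eqVneq j i) => [->|//].
  by rewrite (negbTE sgi).
by rewrite expr0 => h; lra.
Qed.

Lemma sum_fibers (F : {set T} -> R) I (c : R) :
  (forall C, C \subset ~: I -> \sum_(D : {set T} | D \subset I) F (C :|: D) <= c * 2 ^+ #|I|) ->
  \sum_A F A <= c * 2 ^+ #|T|.
Proof.
move=> H; rewrite (partition_big (fun A => A :\: I) (fun C => C \subset ~: I))/=; last first.
  by move=> A _; rewrite finset.setDE finset.subsetIr.
apply: (@le_trans _ _ (\sum_(C : {set T} | C \subset ~: I) c * 2 ^+ #|I|)).
  apply: ler_sum => C CI; apply: le_trans (H _ CI).
  have CI0 : C :&: I = finset.set0.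
    by apply/eqP; rewrite finset.setI_eq0 finset.disjoints_subset.
  rewrite (reindex_onto (fun D => C :|: D) (fun A => A :&: I))/=; last first.
    by move=> A /eqP <-; rewrite finset.setUC finset.setID.
  rewrite le_eqVlt; apply/orP; left; apply/eqP; apply: eq_bigl => D.
  apply/andP/idP => [[_ /eqP <-]|DI]; first exact: finset.subsetIr.
  rewrite finset.setDUl finset.setIUl CI0 finset.set0U (finset.setIidPl DI) eqxx.
  split=> //; rewrite finset.setDE (finset.setIidPl CI).
  by rewrite (_ : D :\: I = finset.set0) ?finset.setU0//; apply/eqP; rewrite finset.setD_eq0.
rewrite sumr_const (eq_card (B := powerset (~: I))); last first.
  by move=> C; rewrite !inE.
rewrite card_powerset -[leLHS]mulr_natl natrX mulrCA -exprD addnC cardsC.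
by [].
Qed.

Lemma card_LO f (sg : T -> bool) (s x d : R) I : 0 < s -> 0 <= d ->
  (forall A i, i \in I -> s <= (-1) ^+ sg i * diff1 i f A) ->
  \sum_A (x <= f A <= x + d)%R%:R <= (d / s + 1) * rho R #|I| * 2 ^+ #|T|.
Proof.
move=> s0 d0 H; apply: (@sum_fibers _ I) => C CI.
apply: (card_signed_interval (f := fun D => f (C :|: D)) (sg := sg)) => // A i AI iI.
apply: le_trans (H (C :|: A) i iI) _; rewrite le_eqVlt; apply/orP; left; apply/eqP.
congr (_ * _); rewrite /diff1 finset.setUCA; congr (_ - f _).
apply/setP => j; rewrite !inE andb_orr; congr orb.
case: (eqVneq j i) => //= ->; apply/esym/negP => iC.
by have := fintype.subsetP CI i iC; rewrite inE iI.
Qed.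

(** The elements of [D] are added one at a time; each changes the first difference by a second
    difference, hence by at most [Bd]. *)
Lemma diff1_lipschitz f (Bd : R) (j : T) J C D : 
  (forall A i, i \in J -> i != j -> `|diff1 i (diff1 j f) A| <= Bd) ->
  D \subset J -> j \notin D -> [disjoint C & J]%B ->
  `|diff1 j f (C :|: D) - diff1 j f C| <= #|D|%:R * Bd.
Proof.
move=> H; elim: {D}#|D| {-2}D (erefl #|D|) => [|n IH] D Dn DJ jD CJ.
  have -> : D = finset.set0 by apply/eqP; rewrite -cards_eq0 Dn.
  by rewrite finset.setU0 subrr normr0 cards0 mul0r.
have /card_gt0P[i iD] : (0 < #|D|)%N by rewrite Dn.
have iJ : i \in J by exact: fintype.subsetP DJ i iD.
have ij : i != j by apply: contraNneq jD => <-.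
have Dn1 : #|D :\ i| = n by move: Dn; rewrite (cardsD1 i D) iD => -[].
have sub : D :\ i \subset D := finset.subsetDl _ _.
have := IH _ Dn1 (fintype.subset_trans sub DJ) (contra (fintype.subsetP sub j) jD) CJ.
have := H (C :|: (D :\ i)) i iJ ij; rewrite {1}/diff1 finset.setUCA finset.setD1K//.
have -> : (C :|: D :\ i) :\ i = C :|: D :\ i.
  apply/setP => k; rewrite !inE; case: (eqVneq k i) => //= ->.
  by rewrite (disjointFl CJ iJ).
rewrite Dn1 => h1 h2; rewrite Dn -natr1 mulrDl mul1r [leRHS]addrC.
apply: le_trans (lerD h1 h2); apply: le_trans (ler_normD _ _).
by rewrite addrA subrK.
Qed.

(** Littlewood-Offord is used twice. For a row [j] in [J], the difference [diff1 j f] moves by at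
    least [kap / 2], with the sign of [K j i], along each of at least [N'] columns, so it is rarely
    small. If it is large for all rows of [J], then [f] is strictly monotone along at least [r']
    rows and rarely hits [x]. *)
Lemma quadratic_LO f (Rr M : {set T}) (K : T -> T -> R) (kap Bd x : R) (r' N' : nat) :
  0 < kap -> 0 < Bd -> [disjoint Rr & M]%B ->
  (forall A i j, i \in Rr -> j \in Rr -> i != j -> `|diff1 i (diff1 j f) A| <= Bd) ->
  (forall A i j, i \in M -> j \in Rr -> `|diff1 i (diff1 j f) A - K j i| <= kap / 2) ->
  (r' <= #|[set j in Rr | N' <= #|[set i in M | (kap <= `|K j i|)%R]|]|)%N ->
  \sum_A (f A == x)%:R <=
  (rho R r' + #|Rr|%:R * ((4 * #|Rr|%:R * Bd / kap + 1) * rho R N')) * 2 ^+ #|T|.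
Proof.
move=> kap0 B0 dRM HR HM; set J := [set j in Rr | _] => Jr.
have JR : J \subset Rr by apply/fintype.subsetP => j; rewrite inE => /andP[].
have JN j : j \in J -> (N' <= #|[set i in M | (kap <= `|K j i|)%R]|)%N.
  by rewrite inE => /andP[].
clearbody J.
(* Changing the other rows of [J] moves a first difference by at most [th - Bd]; one that starts
   beyond [th] keeps its sign and a size of at least [Bd]. *)
pose th := #|Rr|%:R * Bd; have th0 : 0 <= th by rewrite mulr_ge0// ltW.
(* Removing [J] makes badness a property of the choices outside [J], hence constant on the fibres
   over which [f] is later shown monotone. *)
pose bad j A := `|diff1 j f (A :\: J)| <= th.
have badP j : j \in J ->
    \sum_A (bad j A)%:R <= (4 * #|Rr|%:R * Bd / kap + 1) * rho R N' * 2 ^+ #|T|.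
  move=> jJ; have jR := fintype.subsetP JR j jJ.
  pose I := [set i in M | (kap <= `|K j i|)%R].
  have NI : (N' <= #|I|)%N by exact: JN.
  have sum_eq : \sum_A (bad j A)%:R =
      \sum_A (- th <= diff1 j f (A :\: J) <= - th + 2 * th)%R%:R :> R.
    apply: eq_bigr => A _; congr (nat_of_bool _)%:R; rewrite /bad ler_norml.
    by congr andb; congr (_ <= _); ring.
  (* The window [[- th, th]] has length [2 * th]. The step is [kap / 2], since entries of size [kap]
     are known up to [kap / 2]. *)
  rewrite sum_eq; apply: (@le_trans _ _ ((2 * th / (kap / 2) + 1) * rho R #|I| * 2 ^+ #|T|)).
    apply: (@card_LO (fun A => diff1 j f (A :\: J)) (fun i => K j i < 0)).
    - by rewrite divr_gt0.
    - by rewrite mulr_ge0.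
    - move=> A i; rewrite inE => /andP[iM Ki].
      have iJ : i \notin J.
        by apply: (contra (fintype.subsetP JR i)); rewrite (disjointFl dRM iM).
      have := HM (A :\: J) i j iM jR; rewrite {1 3}/diff1.
      have -> : i |: (A :\: J) = (i |: A) :\: J.
        by apply/setP => k; rewrite !inE; case: (eqVneq k i) => // ->; rewrite (negbTE iJ).
      have -> : (A :\: J) :\ i = (A :\ i) :\: J.
        by apply/setP => k; rewrite !inE andbCA.
      move: Ki; rewrite ler_norml; case: ltP => K0 /=.
        by rewrite ltr0_norm// expr1 => h1 /andP[h2 h3]; lra.
      by rewrite ger0_norm// expr0 => h1 /andP[h2 h3]; lra.
  rewrite ler_pM2r ?exprn_gt0// (_ : 2 * th / (kap / 2) = 4 * #|Rr|%:R * Bd / kap).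
    apply: ler_pM => //; [|exact: rho_ge0|exact: le_rho].
    by rewrite addr_ge0// divr_ge0 ?(ltW kap0)// !mulr_ge0// ltW.
  by rewrite /th; field; rewrite gt_eqF.
pose good A := [forall j in J, ~~ bad j A].
have goodP : \sum_A ((f A == x) && good A)%:R <= rho R r' * 2 ^+ #|T|.
  apply: (@le_trans _ _ (rho R #|J| * 2 ^+ #|T|)); last first.
    by rewrite ler_pM2r ?exprn_gt0//; exact: le_rho.
  apply: (@sum_fibers _ J) => C CJ.
  have dCJ : [disjoint C & J]%B by rewrite finset.disjoints_subset.
  have CDJ D : D \subset J -> (C :|: D) :\: J = C.
    move=> DJ; rewrite finset.setDUl (_ : D :\: J = finset.set0).
      by rewrite finset.setU0 finset.setDE (finset.setIidPl CJ).
    by apply/eqP; rewrite finset.setD_eq0.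
  case: (boolP (good C)) => gC; last first.
    rewrite big1 ?mulr_ge0 ?rho_ge0// => D DJ.
    case: (boolP (_ && _)) => // /andP[_ gD]; case/negP: gC.
    apply/forall_inP => j jJ; have := forall_inP gD j jJ.
    by rewrite /bad CDJ// finset.setDE (finset.setIidPl CJ).
  have gCj j : j \in J -> th < `|diff1 j f C|.
    move=> jJ; have := forall_inP gC j jJ; rewrite /bad -ltNge.
    by rewrite finset.setDE (finset.setIidPl CJ).
  (* The window has length zero: up to signs, the level set of a strictly monotone function is an
     antichain. *)
  have := @card_signed_interval (fun D => f (C :|: D)) (fun j => diff1 j f C < 0) Bd x 0 J B0 (lexx 0).
  rewrite mul0r add0r mul1r => /(_ _)/(le_trans _); apply; last first.
    move=> D j DJ jJ.
    have -> : diff1 j (fun D => f (C :|: D)) D = diff1 j f (C :|: (D :\ j)).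
      rewrite /diff1 finset.setUCA; congr (f _ - f _).
        by apply/setP => k; rewrite !inE; case: eqVneq => //; rewrite orbT.
      apply/setP => k; rewrite !inE; case: (eqVneq k j) => //= ->.
      by rewrite (disjointFl dCJ jJ).
    have sub : D :\ j \subset J by exact: fintype.subset_trans (finset.subsetDl _ _) DJ.
    have := @diff1_lipschitz f Bd j J C (D :\ j) _ sub _ dCJ.
    rewrite !inE eqxx => /(_ _ isT) h.
    have {}h : `|diff1 j f (C :|: D :\ j) - diff1 j f C| <= th - Bd.
      apply: le_trans (h _) _.
        move=> A i iJ ij; apply: HR => //; exact: fintype.subsetP JR _ _.
      have -> : th - Bd = (#|Rr|%:R - 1) * Bd by rewrite /th; ring.
      rewrite ler_pM2r// lerBrDr natr1 ler_nat.
      apply: leq_trans (subset_leq_card JR).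
      rewrite (cardsD1 j J) jJ add1n ltnS; apply: subset_leq_card.
      exact: finset.setSD.
    have := gCj j jJ; move: h; rewrite ler_norml; case: (ltP (diff1 j f C) 0) => K0 /=.
      by rewrite ltr0_norm// expr1 => /andP[h2 h3] h1; lra.
    by rewrite ger0_norm// expr0 => /andP[h2 h3] h1; lra.
  apply: ler_sum => D DJ; rewrite ler_nat addr0.
  case: (boolP (_ && _)) => // /andP[/eqP -> _].
  by rewrite lexx.
apply: (@le_trans _ _ (\sum_A (((f A == x) && good A)%:R + \sum_(j in J) (bad j A)%:R))).
  apply: ler_sum => A _; case: (boolP (f A == x)) => fx /=; last by rewrite add0r sumr_ge0.
  case: (boolP (good A)) => gA; first by rewrite lerDl sumr_ge0.
  move: gA; rewrite negb_forall => /existsP[j]; rewrite negb_imply negbK => /andP[jJ bj].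
  by rewrite (bigD1 j)//= bj add0r lerDl sumr_ge0.
rewrite big_split/= mulrDl; apply: lerD => //.
rewrite exchange_big/= -[leRHS]mulrA.
apply: (@le_trans _ _ (((4 * #|Rr|%:R * Bd / kap + 1) * rho R N' * 2 ^+ #|T|) *+ #|J|)).
  by rewrite -sumr_const; apply: ler_sum.
rewrite -[leLHS]mulr_natl ler_wpM2r ?ler_nat ?subset_leq_card//.
by rewrite !mulr_ge0 ?rho_ge0 ?exprn_ge0// addr_ge0// divr_ge0 ?(ltW kap0)// !mulr_ge0// ltW.
Qed.
End QuadraticLO.

(** * U-statistics as averages over injections *)

Section InjectionAverage.
Variables (R : realType) (n m : nat).
Hypothesis mn : (m <= n)%N.
Implicit Types (f : {ffun 'I_m -> 'I_n}).

(** Injections are used instead of subsets because the symmetric groups of both sides act on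
    them. *)
Definition avg (F : {ffun 'I_m -> 'I_n} -> R) : R :=
  (n ^_ m)%:R^-1 * \sum_(f : {ffun 'I_m -> 'I_n} | injectiveb f) F f.

Lemma ffact_neq0 : (n ^_ m)%:R != 0 :> R.
Proof. by rewrite pnatr_eq0 -lt0n ffact_gt0. Qed.

Lemma avgD F G : avg (fun f => F f + G f) = avg F + avg G.
Proof. by rewrite /avg big_split mulrDr. Qed.

Lemma avgZ c F : avg (fun f => c * F f) = c * avg F.
Proof. by rewrite /avg -mulr_sumr mulrCA. Qed.

Lemma avgZr c F : avg (fun f => F f * c) = avg F * c.
Proof. by rewrite /avg -mulr_suml mulrA. Qed.

Lemma avgB F G : avg (fun f => F f - G f) = avg F - avg G.
Proof.
by rewrite -mulN1r -avgZ -avgD; congr avg; apply/funext => f; rewrite mulN1r.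
Qed.

Lemma avg_sum (I : Type) (s : seq I) (P : pred I) (F : I -> {ffun 'I_m -> 'I_n} -> R) :
  avg (fun f => \sum_(i <- s | P i) F i f) = \sum_(i <- s | P i) avg (F i).
Proof. by rewrite /avg exchange_big/= mulr_sumr. Qed.

Lemma eq_avg F G : (forall f, injective f -> F f = G f) -> avg F = avg G.
Proof. by move=> FG; congr (_ * _); apply: eq_bigr => f /injectiveP; exact: FG. Qed.

Lemma le_avg F G : (forall f, injective f -> F f <= G f) -> avg F <= avg G.
Proof.
move=> FG; rewrite /avg ler_wpM2l ?invr_ge0//.
by apply: ler_sum => f /injectiveP; exact: FG.
Qed.

Lemma avg_cst c : avg (fun _ => c) = c.
Proof.
rewrite /avg sumr_const -cardsE card_inj_ffuns !card_ord -[X in _ * X]mulr_natl.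
by rewrite mulKf// ffact_neq0.
Qed.

Lemma avg_ge0 F : (forall f, injective f -> 0 <= F f) -> 0 <= avg F.
Proof. by move=> F0; rewrite -(avg_cst 0); exact: le_avg. Qed.

Lemma avg_permr (s : 'S_m) F : avg (fun f => F [ffun a => f (s a)]) = avg F.
Proof.
rewrite /avg; congr (_ * _); rewrite [RHS](reindex_onto
  (fun f => [ffun a => f (s a)]) (fun f => [ffun a => f ((s^-1)%g a)]))/=; last first.
  by move=> f _; apply/ffunP => a; rewrite !ffunE permK.
apply: eq_bigl => f; have -> : [ffun a => [ffun a0 => f (s a0)] ((s^-1)%g a)] = f.
  by apply/ffunP => a; rewrite !ffunE permKV.
rewrite eqxx andbT; apply/injectiveP/injectiveP => fI a b.
  by rewrite !ffunE => /fI/perm_inj.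
move=> fab; apply: (@perm_inj _ (s^-1)%g); apply: fI.
by rewrite !ffunE !permKV.
Qed.

Lemma avg_perml (s : 'S_n) F : avg (fun f => F [ffun a => s (f a)]) = avg F.
Proof.
rewrite /avg; congr (_ * _); rewrite [RHS](reindex_onto
  (fun f => [ffun a => s (f a)]) (fun f => [ffun a => (s^-1)%g (f a)]))/=; last first.
  by move=> f _; apply/ffunP => a; rewrite !ffunE permKV.
apply: eq_bigl => f; have -> : [ffun a => (s^-1)%g ([ffun a0 => s (f a0)] a)] = f.
  by apply/ffunP => a; rewrite !ffunE permK.
rewrite eqxx andbT; apply/injectiveP/injectiveP => fI a b.
  by rewrite !ffunE => /perm_inj/fI.
by move=> fab; apply: fI; rewrite !ffunE fab.
Qed.

(** By symmetry all values of [f a] are equally likely, and their frequencies add up to one. *)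
Lemma avg_hit1 (a : 'I_m) (i : 'I_n) : avg (fun f => (f a == i)%:R) = n%:R^-1.
Proof.
have H k : avg (fun f => (f a == k)%:R) = avg (fun f => (f a == i)%:R).
  rewrite -(avg_perml (tperm i k)); apply: eq_avg => f _; rewrite ffunE.
  by rewrite (canF_eq (tpermK i k)) tpermR.
have n0 : n%:R != 0 :> R by rewrite pnatr_eq0 -lt0n (leq_ltn_trans _ (ltn_ord i)).
apply: (mulfI n0); rewrite divff//.
transitivity (\sum_(k < n) avg (fun f => (f a == k)%:R)).
  by under eq_bigr do rewrite H; rewrite sumr_const card_ord mulr_natl.
rewrite -avg_sum -[RHS]avg_cst; apply: eq_avg => f _.
by rewrite (bigD1 (f a))//= eqxx big1 ?addr0// => k; rewrite eq_sym => /negbTE ->.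
Qed.

Lemma avg_hit2 (a b : 'I_m) (i j : 'I_n) : a != b -> i != j ->
  avg (fun f => ((f a == i) && (f b == j))%:R) = (n%:R * n.-1%:R)^-1.
Proof.
move=> ab ij.
have H k : k != i -> avg (fun f => ((f a == i) && (f b == k))%:R) =
    avg (fun f => ((f a == i) && (f b == j))%:R).
  move=> ki; rewrite -(avg_perml (tperm j k)); apply: eq_avg => f _; rewrite !ffunE.
  by rewrite !(canF_eq (tpermK j k)) tpermR tpermD// eq_sym.
have n1 : n.-1%:R != 0 :> R.
  rewrite pnatr_eq0; move: ij; rewrite -val_eqE/=.
  by have := ltn_ord i; have := ltn_ord j; lia.
rewrite invfM; apply: (mulfI n1); rewrite [RHS]mulrCA divff// mulr1 -(avg_hit1 a i).
transitivity (\sum_(k < n | k != i) avg (fun f => ((f a == i) && (f b == k))%:R)).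
  rewrite (eq_bigr (fun=> avg (fun f => ((f a == i) && (f b == j))%:R))) => [|k /H//].
  rewrite sumr_const -[RHS]mulr_natl; congr (_%:R * _).
  by have := cardC1 i; rewrite card_ord => <-; apply: eq_card => k; rewrite !inE.
rewrite -avg_sum; apply: eq_avg => f fI.
case: eqP => [fai|_] /=; last by rewrite big1.
rewrite (bigD1 (f b))/=; last by rewrite -fai (inj_eq fI) eq_sym.
by rewrite eqxx big1 ?addr0// => k /andP[_]; rewrite eq_sym => /negbTE ->.
Qed.

End InjectionAverage.

Section UStatistic.
Variable R : realType.
Notation pt := (R * R)%type.
Notation sample := (nat -> pt).
Variable mu : probability pt R.
Notation Ex := (iid_expectation mu).
Variables (n m : nat).
Hypothesis mn : (m <= n)%N.
Implicit Types (f : {ffun 'I_m -> 'I_n}).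

(* The values [n + k] off the domain of [f] keep [relabel f] injective. *)
Definition relabel (f : {ffun 'I_m -> 'I_n}) (k : nat) : nat :=
  if insub k is Some a then f a else (n + k)%N.

Lemma relabel_ord f (a : 'I_m) : relabel f a = f a.
Proof. by rewrite /relabel valK. Qed.

Lemma relabel_inj f : injective f -> injective (relabel f).
Proof.
move=> fI k l; rewrite /relabel; case: insubP => [a _ <-|_]; case: insubP => [b _ <-|_].
- by move=> /val_inj/fI ->.
- by have := ltn_ord (f a); lia.
- by have := ltn_ord (f b); lia.
- by move=> /addnI.
Qed.

Definition sub (w : sample) f : sample := fun k => w (relabel f k).

Variable g : sample -> R.
Hypothesis bg : bcyl g.
Hypothesis dg : depends (fun i => (i < m)%N) g.
Hypothesis g01 : forall w, 0 <= g w <= 1.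

Lemma depends_sub f : depends (fun k => exists a : 'I_m, k = f a) (fun w => g (sub w f)).
Proof.
move=> w w' ww'; apply: dg => k km; rewrite /sub.
by rewrite -[k]/(val (Ordinal km)) relabel_ord; apply: ww'; exists (Ordinal km).
Qed.

Lemma bcyl_sub f : bcyl (fun w => g (sub w f)).
Proof. exact: bcyl_comp. Qed.

Lemma Ex_sub f : injective f -> Ex (fun w => g (sub w f)) = Ex g.
Proof. by move=> fI; rewrite /sub Ex_comp//; exact: relabel_inj. Qed.

Lemma bcyl_avg (F : {ffun 'I_m -> 'I_n} -> sample -> R) : (forall f, bcyl (F f)) ->
  bcyl (fun w => avg (F^~ w)).
Proof. by move=> bF; apply: bcylZ; apply: bcyl_sum => f _. Qed.

Lemma Ex_avg (F : {ffun 'I_m -> 'I_n} -> sample -> R) : (forall f, bcyl (F f)) ->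
  Ex (fun w => avg (F^~ w)) = avg (fun f => Ex (F f)).
Proof.
move=> bF; rewrite /avg ExZ; last by apply: bcyl_sum => f _.
by rewrite Ex_sum// => f _.
Qed.

Lemma Ex_sqr_avg (F : {ffun 'I_m -> 'I_n} -> sample -> R) : (forall f, bcyl (F f)) ->
  Ex (fun w => avg (F^~ w) ^+ 2) = avg (fun f => avg (fun f' => Ex (fun w => F f w * F f' w))).
Proof.
move=> bF; rewrite (eq_Ex _ (g := fun w => avg (fun f => avg (fun f' => F f w * F f' w)))).
  rewrite (Ex_avg (F := fun f w => avg (fun f' => F f w * F f' w))); last first.
    by move=> f; apply: bcyl_avg => f'; exact: bcylM.
  by apply: eq_avg => f _; rewrite (Ex_avg (F := fun f' w => F f w * F f' w))// => f'; exact: bcylM.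
by move=> w; rewrite expr2 -avgZ; apply: eq_avg => f _; rewrite avgZ mulrC.
Qed.

Definition Ustat (w : sample) : R := avg (fun f => g (sub w f)).

Lemma Ex_g01 : 0 <= Ex g <= 1.
Proof.
apply/andP; split; first by apply: Ex_ge0 => // w; case/andP: (g01 w).
by apply: Ex_le_cst => // w; case/andP: (g01 w).
Qed.

Lemma norm_sub01 (x y : R) : 0 <= x <= 1 -> 0 <= y <= 1 -> `|x - y| <= 1.
Proof. by move=> /andP[? ?] /andP[? ?]; rewrite ler_norml; apply/andP; split; lra. Qed.

Lemma Ex_normM_le1 (F G : sample -> R) : bcyl F -> bcyl G ->
  (forall w, `|F w| <= 1) -> (forall w, `|G w| <= 1) -> Ex (fun w => F w * G w) <= 1.
Proof.
move=> bF bG F1 G1; apply: Ex_le_cst; first exact: bcylM.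
move=> w; apply: le_trans (ler_norm _) _; rewrite normrM -[leRHS]mulr1.
by apply: ler_pM.
Qed.

Lemma Ustat_variance : Ex (fun w => (Ustat w - Ex g) ^+ 2) <= m%:R ^+ 2 / n%:R.
Proof.
pose Y f w := g (sub w f) - Ex g.
have bY f : bcyl (Y f) by apply: bcylB; [exact: bcyl_sub|exact: bcyl_cst].
have Y1 f w : `|Y f w| <= 1 by apply: norm_sub01; [exact: g01|exact: Ex_g01].
rewrite (eq_Ex _ (g := fun w => avg (Y^~ w) ^+ 2)); last first.
  by move=> w; rewrite /Y avgD avg_cst.
rewrite Ex_sqr_avg//.
(* Occurrences on disjoint sets of points contribute zero, the others at most one. The double sum
   counts coincidences: [m^2] pairs of positions, each coinciding with frequency [1 / n]. *)
apply: (@le_trans _ _ (avg (fun f => avg (fun f' =>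
    \sum_(a : 'I_m) \sum_(b : 'I_m) (f' b == f a)%:R)))).
  apply: le_avg => f fI; apply: le_avg => f' f'I.
  case: (boolP [exists a, [exists b, f' b == f a]]) => [/existsP[a /existsP[b fab]]|H].
    apply: le_trans (Ex_normM_le1 (bY f) (bY f') (Y1 f) (Y1 f')) _.
    rewrite (bigD1 a)//= (bigD1 b)//= fab -addrA lerDl addr_ge0// ?sumr_ge0//.
    by move=> ? _; rewrite sumr_ge0.
  rewrite (@Ex_indep _ mu (fun k => exists a : 'I_m, k = f a))//.
  - have -> : Ex (Y f) = 0.
      rewrite /Y ExB; [|exact: bcyl_sub|exact: bcyl_cst].
      by rewrite Ex_sub// Ex_cst subrr.
    by rewrite mul0r sumr_ge0// => a _; rewrite sumr_ge0.
  - by move=> w w' ww'; congr (_ - _); exact: depends_sub.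
  - move=> w w' ww'; congr (_ - _); apply: depends_sub => k [b kb]; apply: ww'.
    move=> [a ka]; case/negP: H; apply/existsP; exists a; apply/existsP; exists b.
    by apply/eqP/val_inj; rewrite /= -kb -ka.
under eq_avg => f fI.
  rewrite avg_sum.
  under eq_bigr do [rewrite avg_sum; under eq_bigr do rewrite avg_hit1//].
  over.
rewrite /= avg_cst// !sumr_const card_ord -mulrnA -[leLHS]mulr_natl natrM expr2.
by [].
Qed.
End UStatistic.

(** * The first Hoeffding projection *)

Section Projection.
Variable R : realType.
Notation pt := (R * R)%type.
Notation sample := (nat -> pt).
Variable mu : probability pt R.
Notation Ex := (iid_expectation mu).
Variables (n p : nat).
Hypothesis pn : (p.+1 <= n)%N.
Variable g : sample -> R.
Hypothesis bg : bcyl g.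
Hypothesis dg : depends (fun i => (i < p.+1)%N) g.
Hypothesis g01 : forall w, 0 <= g w <= 1.

(** The uncentred projection, that is the conditional mean of [g] given that the point of index 0 is
    [z]; the other values of the constant sample are integrated away. *)
Definition pproj (z : pt) : R := iter_Int mu (iota 1 p) g (fun _ => z).

Lemma proj_Ints w : iter_Int mu (iota 1 p) g w = pproj (w 0%N).
Proof.
apply: (depends_Ints mu dg) => k [kp]; rewrite mem_iota add1n.
by case: k kp => // k kp; rewrite /= kp.
Qed.

Lemma bcyl_proj i : bcyl (fun w : sample => pproj (w i)).
Proof.
have := bcyl_comp (fun k => (k + i)%N) (bcyl_Ints mu (iota 1 p) bg).
by under eq_fun do rewrite proj_Ints.
Qed.

Lemma pproj01 z : 0 <= pproj z <= 1.
Proof.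
apply/andP; split.
  rewrite -(Ints_cst mu (iota 1 p) 0 (fun _ => z)); apply: le_Ints => //.
    exact: bcyl_cst.
  by move=> w; case/andP: (g01 w).
rewrite -[leRHS](Ints_cst mu (iota 1 p) 1 (fun _ => z)); apply: le_Ints => //.
  exact: bcyl_cst.
by move=> w; case/andP: (g01 w).
Qed.

Lemma Ex_proj i : Ex (fun w => pproj (w i)) = Ex g.
Proof.
have thI : injective (fun k => (k + i)%N) by move=> a b /addIn.
rewrite -(Ex_Ints mu (iota 1 p) bg) -(Ex_comp mu thI (bcyl_Ints mu _ bg)).
by apply: eq_Ex => w; rewrite proj_Ints.
Qed.

(** The event [f ord0 = i] has frequency [1 / n], so the factor [n] makes this the mean of [g] over
    the occurrences with point [i] in position 0. *)
Definition hit_avg (i : 'I_n) (w : sample) : R :=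
  n%:R * avg (fun f : {ffun 'I_p.+1 -> 'I_n} => (f ord0 == i)%:R * g (sub w f)).

Lemma bcyl_hit_avg i : bcyl (hit_avg i).
Proof.
apply: bcylZ; apply: (bcyl_avg (F := fun f w => (f ord0 == i)%:R * g (sub w f))) => f.
by apply: bcylZ; exact: bcyl_sub.
Qed.

(** Given point [i], this is a U-statistic in the other points with mean [pproj (w i)]. Two
    occurrences sharing only [i] are conditionally uncorrelated, and each of the [p^2] pairs of
    remaining positions coincides with conditional frequency [1 / (n - 1)]. *)
Lemma hit_avg_variance (i : 'I_n) :
  Ex (fun w => (hit_avg i w - pproj (w i)) ^+ 2) <= 2 * p.+1%:R ^+ 2 / n%:R.
Proof.
have n0 : n%:R != 0 :> R by rewrite pnatr_eq0 -lt0n (leq_ltn_trans _ pn).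
pose Y (f : {ffun 'I_p.+1 -> 'I_n}) (w : sample) := (f ord0 == i)%:R * (g (sub w f) - pproj (w i)).
have bd f : bcyl (fun w : sample => g (sub w f) - pproj (w i)).
  by apply: bcylB; [exact: bcyl_sub|exact: bcyl_proj].
have bY f : bcyl (Y f) by apply: bcylZ.
rewrite (eq_Ex _ (g := fun w => n%:R ^+ 2 * avg (Y^~ w) ^+ 2)); last first.
  move=> w; rewrite -exprMn; congr (_ ^+ 2).
  have H1 : pproj (w i) = n%:R *
      (avg (fun f : {ffun 'I_p.+1 -> 'I_n} => (f ord0 == i)%:R) * pproj (w i)).
    by rewrite avg_hit1// mulrA divff// mul1r.
  rewrite /hit_avg [X in _ - X]H1 -mulrBr; congr (_ * _).
  by rewrite -avgZr -[X in _ + X]mulN1r -avgZ -avgD; apply: eq_avg => f _; rewrite /Y; ring.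
rewrite ExZ; last by apply: bcylX; exact: bcyl_avg.
rewrite Ex_sqr_avg//.
pose hit (f : {ffun 'I_p.+1 -> 'I_n}) (a : 'I_p.+1) (l : 'I_n) : R :=
  ((f ord0 == i) && (f a == l))%:R.
apply: (@le_trans _ _ (n%:R ^+ 2 * avg (fun f => avg (fun f' =>
    \sum_(a : 'I_p.+1 | a != ord0) \sum_(b : 'I_p.+1 | b != ord0)
      \sum_(l : 'I_n | l != i) hit f a l * hit f' b l)))).
  rewrite ler_wpM2l ?sqr_ge0//; apply: le_avg => f fI; apply: le_avg => f' f'I.
  have R0 (P Q : pred 'I_p.+1) : 0 <= \sum_(a : 'I_p.+1 | P a) \sum_(b : 'I_p.+1 | Q b)
      \sum_(l : 'I_n | l != i) hit f a l * hit f' b l.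
    by apply: sumr_ge0 => a _; apply: sumr_ge0 => b _; apply: sumr_ge0 => l _; rewrite mulr_ge0.
  have [f0|f0] := eqVneq (f ord0) i; last first.
    rewrite (eq_Ex _ (g := fun _ => 0)) ?Ex_cst ?R0// => w.
    by rewrite /Y (negbTE f0) !mul0r.
  have [f'0|f'0] := eqVneq (f' ord0) i; last first.
    rewrite (eq_Ex _ (g := fun _ => 0)) ?Ex_cst ?R0// => w.
    by rewrite /Y (negbTE f'0) mul0r mulr0.
  have YE w : Y f w = g (sub w f) - pproj (w i) by rewrite /Y f0 eqxx mul1r.
  have Y'E w : Y f' w = g (sub w f') - pproj (w i) by rewrite /Y f'0 eqxx mul1r.
  have Y1 w : `|Y f w| <= 1 by rewrite YE; apply: norm_sub01; [exact: g01|exact: pproj01].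
  have Y'1 w : `|Y f' w| <= 1 by rewrite Y'E; apply: norm_sub01; [exact: g01|exact: pproj01].
  case: (boolP [exists a, [exists b, [&& a != ord0, b != ord0 & f' b == f a]]]).
    move=> /existsP[a /existsP[b /and3P[a0 b0 /eqP fab]]].
    apply: le_trans (Ex_normM_le1 mu (bY f) (bY f') Y1 Y'1) _.
    have fai : f a != i by rewrite -f0 (inj_eq fI).
    rewrite (bigD1 a)//= (bigD1 b)//= (bigD1 (f a))//=.
    rewrite /hit f0 f'0 fab !eqxx mul1r -!addrA lerDl.
    by do ?apply: addr_ge0; do ?(apply: sumr_ge0 => ? _); rewrite ?mulr_ge0.
  move=> H; apply: le_trans (R0 _ _); rewrite le_eqVlt; apply/orP; left; apply/eqP.
  (* These are the points of the first occurrence other than [i]; the second occurrence avoids them,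
     and integrating them out annihilates the first factor. *)
  pose l := [seq relabel f k | k <- iota 1 p].
  rewrite -(Ex_Ints mu l (bcylM (bY f) (bY f'))) (eq_Ex _ (g := fun _ => 0)) ?Ex_cst// => w.
  rewrite (eq_Ints _ _ _ (g := fun w => Y f' w * Y f w)); last by move=> u; rewrite mulrC.
  have lP k : k \in l -> exists2 a : 'I_p.+1, a != ord0 & k = f a.
    move=> /mapP[c]; rewrite mem_iota add1n => /andP[c0 cp] ->.
    exists (Ordinal cp); first by rewrite -val_eqE/= -lt0n.
    by rewrite -[c]/(val (Ordinal cp)) relabel_ord.
  have il : (i : nat) \notin l.
    apply/negP => /lP[a a0 /val_inj/eqP]; rewrite -f0 (inj_eq fI) eq_sym.
    exact/negP.
  have dproj : depends (fun k => k \notin l) (fun w : sample => pproj (w i)).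
    by move=> u u' uu'; congr pproj; exact: uu'.
  rewrite IntsMl//; last first.
    move=> u u' uu'; rewrite !Y'E; congr (_ - _); last exact: dproj.
    apply: depends_sub => // k [b kb]; apply: uu'; apply/negP => /lP[a a0 ka].
    case/negP: H; apply/existsP; exists a; apply/existsP; exists b.
    have fab : f' b = f a by apply/val_inj; rewrite /= -kb -ka.
    rewrite a0 fab eqxx andbT/=; apply/eqP => b0.
    by move: fab; rewrite b0 f'0 -f0 => /fI a0'; rewrite -a0' eqxx in a0.
  rewrite (eq_Ints _ _ _ (g := fun w => g (sub w f) + - pproj (w i))); last exact: YE.
  rewrite IntsD; [|exact: bcyl_sub|by apply: bcylN; exact: bcyl_proj].
  rewrite [X in _ + X]Ints_indep; last by move=> u u' uu'; congr (- _); exact: dproj.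
  rewrite /sub /l Ints_comp; last exact: relabel_inj.
  by rewrite proj_Ints -[0%N]/(val (@ord0 p)) relabel_ord f0 subrr mulr0.
(* For [p = 0] the sums are empty, and [n - 1] may vanish. *)
have [p0|p0] := posnP p.
  rewrite (_ : avg _ = 0); first by rewrite mulr0 divr_ge0// mulr_ge0// sqr_ge0.
  rewrite -[RHS](avg_cst pn 0); apply: eq_avg => f _; rewrite -[RHS](avg_cst pn 0).
  apply: eq_avg => f' _; rewrite big1// => a; rewrite -val_eqE/=.
  by have := ltn_ord a; lia.
have n1 : n.-1%:R != 0 :> R by rewrite pnatr_eq0; lia.
have E : avg (fun f => avg (fun f' =>
    \sum_(a : 'I_p.+1 | a != ord0) \sum_(b : 'I_p.+1 | b != ord0)
      \sum_(l : 'I_n | l != i) hit f a l * hit f' b l)) =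
    \sum_(a : 'I_p.+1 | a != ord0) \sum_(b : 'I_p.+1 | b != ord0)
      \sum_(l : 'I_n | l != i) (n%:R * n.-1%:R)^-1 ^+ 2.
  transitivity (avg (fun f => \sum_(a : 'I_p.+1 | a != ord0) \sum_(b : 'I_p.+1 | b != ord0)
      \sum_(l : 'I_n | l != i) hit f a l * (n%:R * n.-1%:R)^-1)).
    apply: eq_avg => f _; rewrite avg_sum; apply: eq_bigr => a _.
    rewrite avg_sum; apply: eq_bigr => b b0; rewrite avg_sum; apply: eq_bigr => l li.
    by rewrite avgZ /hit avg_hit2// eq_sym.
  rewrite avg_sum; apply: eq_bigr => a a0; rewrite avg_sum; apply: eq_bigr => b _.
  rewrite avg_sum; apply: eq_bigr => l li.
  by rewrite avgZr /hit avg_hit2 ?expr2// eq_sym.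
rewrite E !sumr_const !cardC1 !card_ord /= -!mulrnA -[X in _ * X]mulr_natl !natrM.
have nn : n%:R = n.-1%:R + 1 :> R by rewrite natr1 prednK//; lia.
have n1_ge1 : 1 <= n.-1%:R :> R by rewrite ler1n; lia.
move: n1 n0 n1_ge1; rewrite -[p.+1]addn1 natrD nn; set N : R := n.-1%:R; set P : R := p%:R => n1 n0 N1.
have P0 : 0 <= P by rewrite ler0n.
set L := (X in X <= _).
have -> : L = P ^+ 2 / N by rewrite /L; field; rewrite n1 n0.
have N0 : 0 < N by lra.
rewrite ler_pdivrMr// mulrAC ler_pdivlMr; last lra.
rewrite mulrAC.
by nra.
Qed.
End Projection.

(** * Patterns *)

Section Patterns.
Variable R : realType.
Notation pt := (R * R)%type.
Notation sample := (nat -> pt).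

(* [v] lists points by increasing first coordinate, with pattern [s]. *)
Definition sorted_pattern m (s : 'S_m) (v : 'I_m -> pt) : bool :=
  [forall i, forall j, (((v i).1 < (v j).1)%R == (i < j)%N) &&
                       (((v i).2 < (v j).2)%R == (s i < s j)%N)].

Definition has_pattern m (s : 'S_m) (w : sample) : bool :=
  [exists r : 'S_m, sorted_pattern s (fun i => w (r i))].

Lemma sorted_patternP m (s : 'S_m) (v : 'I_m -> pt) :
  reflect (forall i j, (((v i).1 < (v j).1)%R = (i < j)%N) /\
                       (((v i).2 < (v j).2)%R = (s i < s j)%N))
          (sorted_pattern s v).
Proof.
apply: (iffP forallP) => [H i j|H i].
  by have /forallP/(_ j)/andP[/eqP -> /eqP ->] := H i.
by apply/forallP => j; have [-> ->] := H i j; rewrite !eqxx.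
Qed.

(** [gen] ranks the points while [sorted_pattern] lists them in order; the two permutations are
    inverse to each other. *)
Lemma has_patternE m (s : 'S_m) (w : sample) :
  has_pattern s w = `[< gen (mkseq w m) s >].
Proof.
have nthE (i : 'I_m) : nth (0, 0) (mkseq w m) i = w i by rewrite nth_mkseq.
apply/existsP/asboolP => [[r /sorted_patternP H]|[_ [r H]]].
  split; first by rewrite size_mkseq.
  exists (r^-1)%g => i j; rewrite !nthE.
  by have := H ((r^-1)%g i) ((r^-1)%g j); rewrite !permKV.
exists (r^-1)%g; apply/sorted_patternP => i j.
by have := H ((r^-1)%g i) ((r^-1)%g j); rewrite !nthE !permKV.
Qed.

Lemma cyl_has_pattern m (s : 'S_m) : cyl (has_pattern s).
Proof.
apply: cyl_ex => r; apply: cyl_all => i; apply: cyl_all => j.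
apply: cyl_and; apply: cyl_eqb; apply: cyl_lt.
- exact: cyl_fst. - exact: cyl_fst. - exact: cyl_snd. - exact: cyl_snd.
Qed.

Definition kern m (s : 'S_m) (w : sample) : R := (has_pattern s w)%:R.

Lemma bcyl_kern m (s : 'S_m) : bcyl (kern s).
Proof. by apply: bcyl_nat; exact: cyl_has_pattern. Qed.

Lemma depends_has_pattern m (s : 'S_m) : depends (fun i => (i < m)%N) (has_pattern s).
Proof.
move=> w w' ww'; apply: eq_existsb => r; congr sorted_pattern.
by apply/funext => i; exact: ww'.
Qed.

Lemma depends_kern m (s : 'S_m) : depends (fun i => (i < m)%N) (kern s).
Proof. by move=> w w' ww'; congr (nat_of_bool _)%:R; exact: depends_has_pattern. Qed.

Lemma kern01 m (s : 'S_m) w : 0 <= kern s w <= 1.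
Proof. by rewrite /kern; case: has_pattern; rewrite ?lexx ler01. Qed.

Lemma card_perm_lt m (s : 'S_m) (i : 'I_m) : #|finset (fun j => (s j < s i)%N)| = s i.
Proof.
rewrite cardsE -sum1_card; transitivity (\sum_(k < m | (k < s i)%N) 1)%N.
  by rewrite [RHS](reindex_inj (@perm_inj _ s)).
by rewrite (big_ord_narrow (ltnW (ltn_ord (s i)))) sum1_card card_ord.
Qed.

(** Expressing both permutations by ranks that depend on [v] alone gives the uniqueness of the
    sorting permutation and of the pattern. *)
Lemma sorted_pattern_rank m (s r : 'S_m) (v : 'I_m -> pt) i :
  sorted_pattern s (v \o r) ->
  (r^-1)%g i = #|finset (fun j => (v j).1 < (v i).1)| :> nat /\
  s ((r^-1)%g i) = #|finset (fun j => (v j).2 < (v i).2)| :> nat.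
Proof.
move=> /sorted_patternP H.
have H' a b : ((v a).1 < (v b).1) = ((r^-1)%g a < (r^-1)%g b)%N /\
    ((v a).2 < (v b).2) = (s ((r^-1)%g a) < s ((r^-1)%g b))%N.
  by have := H ((r^-1)%g a) ((r^-1)%g b); rewrite /= !permKV.
split.
  by rewrite -[LHS]card_perm_lt; apply: eq_card => j; rewrite !inE; case: (H' j i).
have := card_perm_lt (r^-1 * s)%g i; rewrite permM => <-.
by apply: eq_card => j; rewrite !inE !permM; case: (H' j i).
Qed.

Lemma has_pattern_uniq m (s s' : 'S_m) w : has_pattern s w -> has_pattern s' w -> s = s'.
Proof.
move=> /existsP[r Hr] /existsP[r' Hr'].
have E i : (r^-1)%g i = (r'^-1)%g i.
  apply: val_inj => /=; have [-> _] := sorted_pattern_rank (v := fun i => w i) i Hr.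
  by have [-> _] := sorted_pattern_rank (v := fun i => w i) i Hr'.
apply/permP => k; apply: val_inj; rewrite -[k](permK r) /=.
have [_ ->] := sorted_pattern_rank (v := fun i => w i) (r k) Hr.
by rewrite E; have [_ ->] := sorted_pattern_rank (v := fun i => w i) (r k) Hr'.
Qed.

(** Uniqueness of the sorting permutation turns the existential into a sum, which averages over
    injections can handle. *)
Lemma kern_sum m (s : 'S_m) w :
  kern s w = \sum_(r : 'S_m) (sorted_pattern s (fun i => w (r i)))%:R.
Proof.
rewrite /kern; case: (boolP (has_pattern s w)) => [/existsP[r Hr]|H]; last first.
  rewrite big1// => r _; case: (boolP (sorted_pattern _ _)) => // Hr.
  by case/negP: H; apply/existsP; exists r.
rewrite (bigD1 r)//= Hr big1 ?addr0// => r' r'r.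
case: (boolP (sorted_pattern _ _)) => // Hr'; case/eqP: r'r.
apply: invg_inj; apply/permP => i; apply: val_inj => /=.
have [-> _] := sorted_pattern_rank (v := fun i => w i) i Hr.
by have [-> _] := sorted_pattern_rank (v := fun i => w i) i Hr'.
Qed.

Lemma sub_permE n m (w : sample) (f : {ffun 'I_m -> 'I_n}) (r : 'S_m) i :
  sub w f (r i) = sub w [ffun a => f (r a)] i.
Proof. by rewrite /sub !relabel_ord ffunE. Qed.

Lemma kern_sub_perm n m (s : 'S_m) (w : sample) (f : {ffun 'I_m -> 'I_n}) (r : 'S_m) :
  kern s (sub w [ffun a => f (r a)]) = kern s (sub w f).
Proof.
rewrite !kern_sum (reindex_inj (mulIg (r^-1)%g))/=; apply: eq_bigr => r' _.
congr (nat_of_bool (sorted_pattern _ _))%:R; apply/funext => i.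
by rewrite -sub_permE permM permKV.
Qed.

Definition density n m (s : 'S_m) (w : sample) : R := Ustat n m (kern s) w.

(** Of the [m!] injections with a given image exactly one lists the points by increasing first
    coordinate; this factor turns [n ^_ m] into ['C(n, m)]. *)
Lemma tdensE n m (pi : 'S_n) (s : 'S_m) w : (m <= n)%N -> has_pattern pi w ->
  tdens R pi s = density n s w.
Proof.
move=> mn /existsP[r /sorted_patternP Hr]; rewrite /tdens mn.
pose S f := sorted_pattern s (fun i => sub w (f : {ffun 'I_m -> 'I_n}) i).
(* The [m!] orderings of an occurrence have equal averages, and composing with [r] makes [f] take
   its values among ranks, as in [tdens]. *)
have -> : density n s w = m`!%:R * avg (fun f => (S [ffun a => r (f a)])%:R).
  rewrite (avg_perml r (fun f => (S f)%:R)) /density /Ustat.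
  rewrite (eq_avg (G := fun f => \sum_(q : 'S_m) (S [ffun a => f (q a)])%:R)); last first.
    move=> f _; rewrite kern_sum; apply: eq_bigr => q _; congr (nat_of_bool (sorted_pattern _ _))%:R.
    by apply/funext => i; rewrite sub_permE.
  rewrite avg_sum (eq_bigr (fun=> avg (fun f => (S f)%:R))); last first.
    by move=> q _; rewrite (avg_permr q (fun f => (S f)%:R)).
  by rewrite sumr_const card_Sn mulr_natl.
rewrite /avg mulrA; have -> : m`!%:R / (n ^_ m)%:R = ('C(n, m)%:R)^-1 :> R.
  have C0 : 'C(n, m)%:R != 0 :> R by rewrite pnatr_eq0 -lt0n bin_gt0.
  by rewrite -bin_ffact natrM; field; rewrite C0 pnatr_eq0 -lt0n fact_gt0.
rewrite mulrC; congr (_ * _); rewrite -sum1_card natr_sum.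
rewrite big_mkcond [RHS]big_mkcond /=; apply: eq_bigr => f _.
set c := (X in (if X then 1%:R else _)).
have cP : reflect (forall i j : 'I_m, (f i < f j)%N = (i < j)%N /\
    (pi (f i) < pi (f j))%N = (s i < s j)%N) c.
  rewrite /c unfold_in /in_set /mkset asboolb; apply: (iffP andP) => [[/forallP H1 /forallP H2] i j|H].
    split; last by have /forallP/(_ j)/eqP := H2 i.
    have H (i' j' : 'I_m) : (i' < j')%N -> (f i' < f j')%N by have /forallP/(_ j')/implyP := H1 i'.
    case: (ltngtP i j) => [/H -> //|/H|/val_inj ->]; last by rewrite ltnn.
    by move=> /ltnW; rewrite leqNgt => /negbTE.
  split; apply/forallP => i; apply/forallP => j; have [h1 h2] := H i j.
    by rewrite h1; apply/implyP.
  by rewrite h2.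
have -> : S [ffun a => r (f a)] = c.
  have E (i : 'I_m) : sub w [ffun a => r (f a)] i = w (r (f i)) by rewrite /sub relabel_ord ffunE.
  apply/sorted_patternP/cP => H i j; have := H i j; rewrite ?E.
    by have [-> ->] := Hr (f i) (f j).
  by move=> [<- <-]; exact: Hr.
case: cP => [H|_]; last by case: injectiveb.
rewrite ifT//; apply/injectiveP => i j fij.
have [Hij _] := H i j; have [Hji _] := H j i.
move: Hij Hji; rewrite fij ltnn => /esym/negbT + /esym/negbT; rewrite -!leqNgt => ji ij.
by apply/val_inj/anti_leq; rewrite ij ji.
Qed.

Definition no_ties n (w : sample) : bool :=
  [forall i : 'I_n, forall j : 'I_n, (i != j) ==>
     ((w i).1 != (w j).1)%R && ((w i).2 != (w j).2)%R].

Lemma rank_perm n (u : 'I_n -> R) : injective u ->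
  exists r : 'S_n, forall i j, (u i < u j) = (r i < r j)%N.
Proof.
move=> uI; pose rk i := #|finset (fun j => u j < u i)|.
have rk_lt i : (rk i < n)%N.
  rewrite -[X in (_ < X)%N]card_ord; apply: proper_card; apply/properP.
  by split; [exact/fintype.subsetP|exists i => //; rewrite inE ltxx].
have mono i j : u i < u j -> (rk i < rk j)%N.
  move=> uij; apply: proper_card; apply/properP; split.
    by apply/fintype.subsetP => k; rewrite !inE => /lt_trans; exact.
  by exists i; rewrite inE ?ltxx.
have E i j : (u i < u j) = (rk i < rk j)%N.
  case: (ltgtP (u i) (u j)) => [/mono -> //|/mono/ltnW|/uI ->].
    by rewrite leqNgt => /negbTE.
  by rewrite ltnn.
pose r i := Ordinal (rk_lt i).
have rI : injective r.
  move=> i j /(congr1 val) /= rij; apply: uI; apply/le_anti.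
  by rewrite !leNgt !E rij ltnn.
by exists (perm rI) => i j; rewrite !permE.
Qed.

Lemma no_ties_pattern n w : no_ties n w -> exists pi : 'S_n, has_pattern pi w.
Proof.
move=> /forallP nt.
have nt' (i j : 'I_n) : i != j -> (w i).1 != (w j).1 /\ (w i).2 != (w j).2.
  by move=> ij; have /forallP/(_ j)/implyP/(_ ij)/andP := nt i.
have [r1 H1] : exists r : 'S_n, forall i j : 'I_n, ((w i).1 < (w j).1) = (r i < r j)%N.
  apply: (rank_perm (u := fun i => (w i).1)) => i j wij.
  by apply/eqP; apply: contraT => /nt'[/eqP].
have [r2 H2] : exists r : 'S_n, forall i j : 'I_n, ((w i).2 < (w j).2) = (r i < r j)%N.
  apply: (rank_perm (u := fun i => (w i).2)) => i j wij.
  by apply/eqP; apply: contraT => /nt'[_ /eqP].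
exists (r1^-1 * r2)%g; apply/existsP; exists (r1^-1)%g.
by apply/sorted_patternP => i j; rewrite H1 H2 !permKV !permM.
Qed.

Variable mu : probability pt R.
Notation Ex := (iid_expectation mu).

Lemma CSE m (s : 'S_m) : CS mu s = Ex (kern s).
Proof.
rewrite /CS iid_probE; last first.
  by under eq_fun do rewrite -has_patternE; exact: cyl_has_pattern.
by apply: eq_Ex => w; rewrite -has_patternE.
Qed.

(** Given the shared point, the two patterns are independent with the same conditional probability.
    So the nondegeneracy condition concerns the variance of the projection. *)
Lemma CS2E p (s : 'S_p.+1) :
  CS2 mu s s = Ex (fun w => pproj mu p (kern s) (w 0%N) ^+ 2).
Proof.
(* Positions of the second pattern: the shared point 0, then the fresh points [p + 1, ..., 2p]. *)
pose th k := if k is k'.+1 then (p.+1 + k')%N else 0%N.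
have thI : injective th by move=> [|a] [|b] //= ; rewrite ?addSn // => -[/addnI ->].
have bk := bcyl_kern s.
have split_seq (w : sample) : mkseq w (p.+1 + p.+1 - 1) =
    mkseq w p.+1 ++ [seq w (th k) | k <- iota 1 p].
  rewrite (_ : (p.+1 + p.+1 - 1)%N = (p.+1 + p)%N); last lia.
  rewrite /mkseq iotaD map_cat add0n; congr cat.
  rewrite -[in LHS](addn0 p.+1) -[in RHS](addn0 1%N) !iotaDl -!map_comp.
  by apply: eq_map => k.
have E w : `[< gen (take p.+1 (mkseq w (p.+1 + p.+1 - 1))) s /\
      gen (head (0, 0) (mkseq w (p.+1 + p.+1 - 1)) :: drop p.+1 (mkseq w (p.+1 + p.+1 - 1))) s >] =
    has_pattern s w && has_pattern s (fun k => w (th k)).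
  rewrite split_seq take_size_cat ?size_mkseq// drop_size_cat ?size_mkseq//.
  by rewrite !has_patternE -asbool_and.
rewrite /CS2 iid_probE; last first.
  under eq_fun do rewrite E.
  by apply: cyl_and; [|apply: cyl_comp]; exact: cyl_has_pattern.
rewrite (eq_Ex _ (g := fun w => kern s (fun k => w (th k)) * kern s w)); last first.
  by move=> w; rewrite E /kern mulrC; case: has_pattern; case: has_pattern; rewrite ?mulr0 ?mulr1.
have bc := bcyl_comp th bk.
rewrite -(Ex_Ints mu (iota 1 p) (bcylM bc bk)).
rewrite (eq_Ex _ (g := fun w => pproj mu p (kern s) (w 0%N) * kern s (fun k => w (th k)))); last first.
  move=> w; rewrite IntsMl//; first by rewrite (proj_Ints mu (@depends_kern _ s)) mulrC.
  move=> u u' uu'; apply: depends_kern => k kp; apply: uu'; rewrite mem_iota.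
  by case: k kp => //= k kp; lia.
rewrite -(Ex_Ints mu (map th (iota 1 p))); last by apply: bcylM => //; exact: bcyl_proj (depends_kern s) _.
apply: eq_Ex => w; rewrite IntsMl//; last first.
  move=> u u' uu'; congr pproj; apply: uu'; apply/mapP => -[[|k]//].
  by rewrite mem_iota.
rewrite Ints_comp// (proj_Ints mu (@depends_kern _ s)) expr2.
by [].
Qed.
End Patterns.

(** * Second differences of the statistic *)

Section Swap.
Variable n : nat.

(* The point of index [n + k] is the alternative to that of index [k < n]. *)
Definition swap (A : pred nat) (k : nat) : nat :=
  if (k < n)%N then (if A k then n + k else k)%N
  else if (k < n + n)%N && A (k - n)%N then (k - n)%N else k.

Lemma swapK A : involutive (swap A).
Proof.
move=> k; rewrite /swap; case: (ltnP k n) => kn.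
  case: (boolP (A k)) => Ak; last by rewrite kn (negbTE Ak).
  rewrite (_ : n + k < n = false)%N ?ltn_add2l ?kn ?addKn ?Ak//.
  by apply/negbTE; rewrite -leqNgt leq_addr.
case: (boolP (_ && _)) => [/andP[k2 Ak]|H].
  by rewrite (_ : k - n < n)%N ?Ak; lia.
by rewrite ltnNge kn/= (negbTE H).
Qed.

Lemma swap_inj A : injective (swap A).
Proof. exact: can_inj (swapK A). Qed.

Lemma swap_lt A k : (k < n)%N -> swap A k = if A k then (n + k)%N else k.
Proof. by rewrite /swap => ->. Qed.

Lemma swap_add A k : (k < n)%N -> swap A (n + k)%N = if A k then k else (n + k)%N.
Proof. by move=> kn; rewrite /swap ltnNge leq_addr/= ltn_add2l kn/= addKn. Qed.

End Swap.

Section SecondDifference.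
Variable R : realType.
Notation pt := (R * R)%type.
Notation sample := (nat -> pt).
Variable mu : probability pt R.
Notation Ex := (iid_expectation mu).

Definition swapped n (i : nat) (w : sample) : sample := fun k => w (swap n (pred1 i) k).

Lemma swapped_lt n i w k : (k < n)%N ->
  swapped n i w k = if k == i then w (n + i)%N else w k.
Proof. by move=> kn; rewrite /swapped swap_lt//=; case: eqP => // ->. Qed.

Lemma bcyl_swapped n i (f : sample -> R) : bcyl f -> bcyl (fun w => f (swapped n i w)).
Proof. exact: bcyl_comp. Qed.

Lemma Ex_swapped n i (f : sample -> R) : bcyl f -> Ex (fun w => f (swapped n i w)) = Ex f.
Proof. by move=> bf; rewrite /swapped (Ex_comp mu (@swap_inj n (pred1 i)) bf). Qed.

Section Kernel.
Variables (n p : nat).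
Hypothesis pn : (p.+1 <= n)%N.
Variable g : sample -> R.
Hypothesis bg : bcyl g.
Hypothesis dg : depends (fun i => (i < p.+1)%N) g.
Hypothesis g01 : forall w, 0 <= g w <= 1.
Hypothesis gsym : forall w (f : {ffun 'I_p.+1 -> 'I_n}) (s : 'S_p.+1),
  g (sub w [ffun a => f (s a)]) = g (sub w f).
Notation m := p.+1.
Notation T := (Ustat n m g).
Notation U := (@hit_avg R n p g).
Notation h := (pproj mu p g).

Lemma sub_swapped (w : sample) (i : 'I_n) (f : {ffun 'I_m -> 'I_n}) :
  (forall a, f a != i) -> g (sub (swapped n i w) f) = g (sub w f).
Proof.
move=> fi; apply: dg => k km; rewrite /sub -[k]/(val (Ordinal km)) relabel_ord.
by rewrite swapped_lt//; have := fi (Ordinal km); rewrite -val_eqE/= => /negbTE ->.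
Qed.

Lemma sum_hit (f : {ffun 'I_m -> 'I_n}) (i : 'I_n) (a : 'I_m) : injective f -> f a = i ->
  \sum_(b : 'I_m) (f b == i)%:R = 1 :> R.
Proof.
move=> fI fai; rewrite (bigD1 a)//= fai eqxx big1 ?addr0// => b ba.
by rewrite -fai (inj_eq fI) (negbTE ba).
Qed.

(** Only occurrences using point [i] change, and by the symmetry of [g] each of the [m] positions of
    [i] contributes as much as position 0. *)
Lemma Ustat_diff (w : sample) (i : 'I_n) :
  n%:R * (T (swapped n i w) - T w) = m%:R * (U i (swapped n i w) - U i w).
Proof.
pose d (f : {ffun 'I_m -> 'I_n}) := g (sub (swapped n i w) f) - g (sub w f).
rewrite /Ustat /hit_avg -avgB -[X in _ = _ * X]mulrBr -avgB [RHS]mulrCA; congr (_ * _).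
rewrite (eq_avg (G := fun f => \sum_(a : 'I_m) (f a == i)%:R * d f)); last first.
  move=> f fI; case: (boolP [exists a, f a == i]) => [/existsP[a /eqP fai]|H].
    by rewrite -mulr_suml (sum_hit fI fai) mul1r.
  have fi a : f a != i by apply: contra H => fai; apply/existsP; exists a.
  by rewrite sub_swapped// subrr big1// => a _; rewrite (negbTE (fi a)) mul0r.
rewrite avg_sum (eq_bigr (fun=> avg (fun f => (f ord0 == i)%:R * d f))); last first.
  move=> a _; rewrite -(avg_permr (tperm ord0 a) (fun f => (f a == i)%:R * d f)).
  by apply: eq_avg => f _; rewrite ffunE tpermR /d !gsym.
rewrite sumr_const card_ord -[LHS]mulr_natl; congr (_ * _).
by apply: eq_avg => f _; rewrite /d mulrBr.
Qed.

Lemma hit_avg01 i w : 0 <= U i w <= 1.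
Proof.
have n0 : n%:R != 0 :> R by rewrite pnatr_eq0 -lt0n (leq_ltn_trans _ pn).
rewrite /hit_avg; apply/andP; split.
  by rewrite mulr_ge0//; apply: avg_ge0 => // f _; rewrite mulr_ge0//; case/andP: (g01 (sub w f)).
rewrite -[leRHS](divff n0) -(avg_hit1 R pn ord0 i) ler_wpM2l//.
by apply: le_avg => f _; apply: ler_piMr => //; case/andP: (g01 (sub w f)).
Qed.

Lemma Ustat_diff_bound (w : sample) (i : 'I_n) :
  `|n%:R * (T (swapped n i w) - T w)| <= m%:R.
Proof.
rewrite Ustat_diff normrM normr_nat -[leRHS]mulr1 ler_wpM2l//.
by apply: norm_sub01; exact: hit_avg01.
Qed.

(** Only injections hitting both [i] and [j] contribute, each at most 2. There are at most [m^2]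
    pairs of positions, each of frequency [1 / (n (n - 1))], and [n / (n - 1) <= 2]. *)
Lemma Ustat_diff2_bound (w : sample) (i j : 'I_n) : i != j ->
  `|n%:R ^+ 2 * (T (swapped n j (swapped n i w)) - T (swapped n i w) -
     T (swapped n j w) + T w)| <= 4 * m%:R ^+ 2.
Proof.
move=> ij.
have n2 : (2 <= n)%N.
  by move: ij; rewrite -val_eqE/=; have := ltn_ord i; have := ltn_ord j; lia.
have n0 : n%:R != 0 :> R by rewrite pnatr_eq0; lia.
have n10 : n.-1%:R != 0 :> R by rewrite pnatr_eq0; lia.
pose d (f : {ffun 'I_m -> 'I_n}) := g (sub (swapped n j (swapped n i w)) f) -
  g (sub (swapped n i w) f) - g (sub (swapped n j w) f) + g (sub w f).
have -> : T (swapped n j (swapped n i w)) - T (swapped n i w) - T (swapped n j w) + T w = avg d.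
  by rewrite /Ustat /d avgD !avgB.
have dB : `|avg d| <= avg (fun f => \sum_(a : 'I_m) \sum_(b : 'I_m | a != b)
    2 * ((f a == i) && (f b == j))%:R).
  apply: (@le_trans _ _ (avg (fun f => `|d f|))).
    rewrite /avg normrM ger0_norm ?invr_ge0// ler_wpM2l ?invr_ge0//.
    exact: ler_norm_sum.
  apply: le_avg => f fI.
  have S0 : 0 <= \sum_(a : 'I_m) \sum_(b : 'I_m | a != b) 2 * ((f a == i) && (f b == j))%:R :> R.
    by do 2 (apply: sumr_ge0 => ? _); rewrite mulr_ge0.
  case: (boolP [exists a, f a == i]) => [/existsP[a /eqP fai]|H]; last first.
    have fi a : f a != i by apply: contra H => fai; apply/existsP; exists a.
    rewrite (_ : d f = 0) ?normr0// /d (@sub_swapped w i)//.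
    have -> : g (sub (swapped n j (swapped n i w)) f) = g (sub (swapped n j w) f).
      apply: dg => k km; rewrite /sub -[k]/(val (Ordinal km)) relabel_ord.
      have fin : (f (Ordinal km) == i :> nat) = false by apply/negbTE; exact: fi.
      rewrite [LHS]swapped_lt// [RHS]swapped_lt// [swapped n i w (f _)]swapped_lt// fin.
      have ijn : (j == i :> nat) = false by apply/negbTE; rewrite eq_sym.
      by rewrite /swapped swap_add//= ijn.
    by ring.
  case: (boolP [exists b, f b == j]) => [/existsP[b /eqP fbj]|H]; last first.
    have fj b : f b != j by apply: contra H => fbj; apply/existsP; exists b.
    by rewrite (_ : d f = 0) ?normr0// /d (@sub_swapped (swapped n i w) j)// (@sub_swapped w j)//; ring.
  have ab : a != b by apply: contraNneq ij => ab; rewrite -fai -fbj ab.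
  rewrite (bigD1 a)//= (bigD1 b)//= fai fbj !eqxx mulr1 -addrA.
  apply: (@le_trans _ _ 2).
    have /andP[h1 h2] := g01 (sub (swapped n j (swapped n i w)) f).
    have /andP[h3 h4] := g01 (sub (swapped n i w) f).
    have /andP[h5 h6] := g01 (sub (swapped n j w) f).
    have /andP[h7 h8] := g01 (sub w f).
    by rewrite ler_norml /d; apply/andP; split; lra.
  rewrite lerDl addr_ge0//; first by apply: sumr_ge0 => ? _; rewrite mulr_ge0.
  by do 2 (apply: sumr_ge0 => ? _); rewrite mulr_ge0.
rewrite normrM ger0_norm ?sqr_ge0//.
apply: (@le_trans _ _ (n%:R ^+ 2 * (m%:R ^+ 2 * (2 / (n%:R * n.-1%:R))))).
  rewrite ler_wpM2l ?sqr_ge0//; apply: le_trans dB _.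
  rewrite avg_sum; apply: (@le_trans _ _ (\sum_(a : 'I_m) \sum_(b : 'I_m) 2 / (n%:R * n.-1%:R))).
    apply: ler_sum => a _; rewrite avg_sum big_mkcond; apply: ler_sum => b _.
    by case: ifP => ab; [rewrite avgZ avg_hit2|rewrite divr_ge0 ?mulr_ge0].
  by rewrite !sumr_const card_ord -mulrnA -[leLHS]mulr_natl natrM expr2.
have nn : n%:R = n.-1%:R + 1 :> R by rewrite natr1 prednK//; lia.
have N1 : 1 <= n.-1%:R :> R by rewrite ler1n; lia.
move: N1 n10 n0; rewrite nn; set N : R := n.-1%:R; set M : R := m%:R => N1 N0 NN0.
set L := (X in X <= _); have -> : L = 2 * M ^+ 2 * ((N + 1) / N).
  by rewrite /L; field; rewrite N0 NN0.
have -> : 4 * M ^+ 2 = 2 * M ^+ 2 * 2 by ring.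
rewrite ler_wpM2l ?mulr_ge0 ?sqr_ge0// ler_pdivrMr; lra.
Qed.

Let sq : R := Num.sqrt n%:R.

Lemma sqrt_n_gt0 : 0 < sq.
Proof. by rewrite sqrtr_gt0 ltr0n; lia. Qed.

Lemma sqrt_n_sqr : sq ^+ 2 = n%:R.
Proof. by rewrite sqr_sqrtr. Qed.

Lemma m2_ge1 : 1 <= m%:R ^+ 2 :> R.
Proof. by rewrite exprn_ege1// ler1n. Qed.

Lemma Ex_norm_sqrt (f : sample -> R) (c : R) : bcyl f -> Ex (fun w => f w ^+ 2) <= c / n%:R ->
  Ex (fun w => `|f w|) <= (1 + c) / 2 / sq.
Proof.
move=> bf fc; have s0 := sqrt_n_gt0.
(* With [l = 1 / sq] both summands of [Ex_norm_le] are of the order [1 / sqrt n]. *)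
apply: le_trans (Ex_norm_le mu bf (_ : 0 < sq^-1)) _; first by rewrite invr_gt0.
rewrite invrK.
have : Ex (fun w => f w ^+ 2) * sq <= c / sq.
  have -> : c / sq = c / n%:R * sq by rewrite -sqrt_n_sqr; field; rewrite gt_eqF.
  by rewrite ler_wpM2r// ltW.
move=> h; have -> : (1 + c) / 2 / sq = (sq^-1 + c / sq) / 2 by field; rewrite gt_eqF.
by rewrite ler_pM2r// lerD2l.
Qed.

Lemma bcyl_Ustat : bcyl T.
Proof. by apply: (bcyl_avg (F := fun f w => g (sub w f))) => f; exact: bcyl_sub. Qed.

Lemma Ex_Ustat_dev : Ex (fun w => `|T w - Ex g|) <= m%:R ^+ 2 / sq.
Proof.
have bT : bcyl (fun w => T w - Ex g) by apply: bcylB; [exact: bcyl_Ustat|exact: bcyl_cst].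
apply: le_trans (Ex_norm_sqrt bT (Ustat_variance mu pn bg dg g01)) _.
by rewrite ler_pM2r ?invr_gt0 ?sqrt_n_gt0//; have := m2_ge1; lra.
Qed.

Definition pdiff (i : nat) (w : sample) : R := h (w (n + i)%N) - h (w i).

Lemma pdiff_bound i w : `|pdiff i w| <= 1.
Proof. by apply: norm_sub01; exact: pproj01. Qed.

Lemma bcyl_pdiff i : bcyl (pdiff i).
Proof. by apply: bcylB; exact: bcyl_proj. Qed.

(** Both terms of [Ustat_diff] are replaced by their projections; the swap preserves the law, so the
    two errors have the same mean. *)
Lemma Ex_Ustat_diff (i : 'I_n) :
  Ex (fun w => `|n%:R * (T (swapped n i w) - T w) - m%:R * pdiff i w|) <= 3 * m%:R ^+ 3 / sq.
Proof.
have bUh : bcyl (fun w => U i w - h (w i)).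
  by apply: bcylB; [exact: bcyl_hit_avg|exact: bcyl_proj].
have dev := Ex_norm_sqrt bUh (hit_avg_variance mu pn bg dg g01 i).
have bN := bcyl_norm bUh; have bNs := bcyl_swapped n i bN.
apply: (@le_trans _ _ (Ex (fun w => m%:R * (`|U i (swapped n i w) - h (swapped n i w i)| +
    `|U i w - h (w i)|)))).
  apply: le_Ex.
  - apply/bcyl_norm/bcylB; last by apply: bcylZ; exact: bcyl_pdiff.
    by apply: bcylZ; apply: bcylB; [apply: bcyl_swapped|]; exact: bcyl_Ustat.
  - by apply: bcylZ; exact: bcylD.
  - move=> w; rewrite Ustat_diff -mulrBr normrM normr_nat ler_wpM2l//.
    rewrite swapped_lt// eqxx /pdiff; apply: le_trans (ler_normB _ _).
    by rewrite le_eqVlt; apply/orP; left; apply/eqP; congr `|_|; ring.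
rewrite ExZ ?ExD//; last exact: bcylD.
rewrite (Ex_swapped n i bN) exprS [3 * _]mulrCA -[leRHS]mulrA ler_wpM2l//.
have s0 := sqrt_n_gt0; move: dev; set e := Ex _ => dev.
apply: le_trans (lerD dev dev) _; rewrite -mulrDl ler_pM2r ?invr_gt0//.
by have := m2_ge1; lra.
Qed.

(** With first differences [al] and second difference [ga], scaled by [n] and [n^2], the second
    difference of the square is [al i * al j + ga * (t11 - Ex g) - ga^2 / (2 n^2)]. The deviation
    [t11 - Ex g] is of the order [1 / sqrt n] in mean, so only the product survives. *)
Lemma Ex_second_difference (i j : 'I_n) : i != j ->
  Ex (fun w => `|n%:R ^+ 2 / 2 * ((T (swapped n j (swapped n i w)) - Ex g) ^+ 2 -
      (T (swapped n i w) - Ex g) ^+ 2 - (T (swapped n j w) - Ex g) ^+ 2 + (T w - Ex g) ^+ 2) -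
      m%:R ^+ 2 * (pdiff i w * pdiff j w)|) <= 18 * m%:R ^+ 4 / sq.
Proof.
move=> ij; have s0 := sqrt_n_gt0; have M1 := m2_ge1.
pose al i w := n%:R * (T (swapped n i w) - T w).
pose ga w := n%:R ^+ 2 * (T (swapped n j (swapped n i w)) - T (swapped n i w) -
     T (swapped n j w) + T w).
have bT := bcyl_Ustat.
have bTs i' := bcyl_swapped n i' bT.
have bTij := bcyl_swapped n i (bTs j).
have bc : bcyl (fun _ : sample => Ex g) by exact: bcyl_cst.
have bal (i' : 'I_n) : bcyl (fun w => `|al i' w - m%:R * pdiff i' w|).
  apply/bcyl_norm/bcylB; last by apply: bcylZ; exact: bcyl_pdiff.
  by apply: bcylZ; exact: bcylB.
have bdev : bcyl (fun w => `|T (swapped n j (swapped n i w)) - Ex g|) by apply/bcyl_norm/bcylB.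
(* In units of [m^4 / sq] the four terms have means at most 3, 3, 4 and 8, whence the 18. *)
apply: (@le_trans _ _ (Ex (fun w => m%:R * `|al i w - m%:R * pdiff i w| +
   (m%:R * `|al j w - m%:R * pdiff j w| +
    (4 * m%:R ^+ 2 * `|T (swapped n j (swapped n i w)) - Ex g| + 8 * m%:R ^+ 4 / sq))))).
  apply: le_Ex.
  - apply/bcyl_norm/bcylB; last by apply/bcylZ/bcylM; exact: bcyl_pdiff.
    apply: bcylZ; apply: bcylD; last by apply/bcylX/bcylB.
    by do 2 (apply: bcylB; last by apply/bcylX/bcylB); apply/bcylX/bcylB.
  - apply: bcylD; first exact: bcylZ.
    apply: bcylD; first exact: bcylZ.
    by apply: bcylD; [exact: bcylZ|exact: bcyl_cst].
  move=> w; have n0 : n%:R != 0 :> R by rewrite pnatr_eq0; lia.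
  have ga4 : `|ga w| <= 4 * m%:R ^+ 2 by exact: Ustat_diff2_bound.
  set t11 := T (swapped n j (swapped n i w)); set t10 := T (swapped n i w).
  set t01 := T (swapped n j w); set t00 := T w.
  have -> : n%:R ^+ 2 / 2 * ((t11 - Ex g) ^+ 2 - (t10 - Ex g) ^+ 2 - (t01 - Ex g) ^+ 2 +
      (t00 - Ex g) ^+ 2) - m%:R ^+ 2 * (pdiff i w * pdiff j w) =
    (al i w - m%:R * pdiff i w) * al j w + (m%:R * pdiff i w * (al j w - m%:R * pdiff j w) +
    (ga w * (t11 - Ex g) - ga w ^+ 2 / (2 * n%:R ^+ 2))).
    rewrite /al /ga -/t11 -/t10 -/t01 -/t00; field; by rewrite n0.
  apply: le_trans (ler_normD _ _) _; apply: lerD.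
    by rewrite normrM mulrC ler_wpM2r//; exact: Ustat_diff_bound.
  apply: le_trans (ler_normD _ _) _; apply: lerD.
    rewrite normrM ler_wpM2r// normrM normr_nat -[leRHS]mulr1 ler_wpM2l//.
    exact: pdiff_bound.
  apply: le_trans (ler_normB _ _) _; apply: lerD.
    by rewrite normrM ler_wpM2r.
  rewrite normrM normrX [X in _ * X]ger0_norm ?invr_ge0 ?mulr_ge0 ?sqr_ge0//.
  apply: (@le_trans _ _ ((4 * m%:R ^+ 2) ^+ 2 / (2 * n%:R ^+ 2))).
    by rewrite ler_wpM2r ?invr_ge0 ?mulr_ge0 ?sqr_ge0// ler_pXn2r ?nnegrE// mulr_ge0 ?sqr_ge0.
  have -> : (4 * m%:R ^+ 2) ^+ 2 / (2 * n%:R ^+ 2) = 8 * m%:R ^+ 4 * n%:R ^- 2 :> R.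
    by field.
  rewrite ler_wpM2l ?mulr_ge0 ?exprn_ge0// lef_pV2 ?posrE//; last by rewrite exprn_gt0// ltr0n; lia.
  have nge1 : 1 <= n%:R :> R by rewrite ler1n; lia.
  have sge1 : 1 <= sq by rewrite -[1]sqrtr1 ler_wsqrtr.
  rewrite -sqrt_n_sqr -exprM -[leLHS]expr1; apply: ler_weXn2l => //.
have dev : Ex (fun w => `|T (swapped n j (swapped n i w)) - Ex g|) <= m%:R ^+ 2 / sq.
  apply: le_trans Ex_Ustat_dev; rewrite le_eqVlt; apply/orP; left; apply/eqP.
  have b1 : bcyl (fun w => `|T w - Ex g|) by apply/bcyl_norm/bcylB.
  by rewrite -(Ex_swapped n j b1) -(Ex_swapped n i (bcyl_swapped n j b1)).
rewrite ExD; last 2 first.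
- exact: bcylZ.
- apply: bcylD; first exact: bcylZ.
  by apply: bcylD; [exact: bcylZ|exact: bcyl_cst].
rewrite ExD; last 2 first.
- exact: bcylZ.
- by apply: bcylD; [exact: bcylZ|exact: bcyl_cst].
rewrite ExD; last 2 first.
- exact: bcylZ.
- exact: bcyl_cst.
rewrite Ex_cst !ExZ//; have di := Ex_Ustat_diff i; have dj := Ex_Ustat_diff j.
have M0 : 0 <= m%:R :> R by [].
have := ler_wpM2l M0 di; have := ler_wpM2l M0 dj.
have M2 : 0 <= 4 * m%:R ^+ 2 :> R by rewrite mulr_ge0 ?sqr_ge0.
have := ler_wpM2l M2 dev; rewrite -/(al i) -/(al j).
have -> : m%:R * (3 * m%:R ^+ 3 / sq) = 3 * (m%:R ^+ 4 / sq) by ring.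
have -> : 4 * m%:R ^+ 2 * (m%:R ^+ 2 / sq) = 4 * (m%:R ^+ 4 / sq) by ring.
have -> : 18 * m%:R ^+ 4 / sq = 18 * (m%:R ^+ 4 / sq) by ring.
have -> : 8 * m%:R ^+ 4 / sq = 8 * (m%:R ^+ 4 / sq) by ring.
by set e := m%:R ^+ 4 / sq; lra.
Qed.

End Kernel.
End SecondDifference.

(** Transposes two points together with their alternatives; this symmetry will turn products over
    two coordinates into squares. *)
Definition exchange n i j (x : nat) : nat :=
  if x == i then j else if x == j then i else
  if x == (n + i)%N then (n + j)%N else if x == (n + j)%N then (n + i)%N else x.

Lemma exchangeK (n i j : nat) : (i < n)%N -> (j < n)%N -> i <> j ->
  involutive (exchange n i j).
Proof.
move=> iN jN ij x; rewrite /exchange.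
have e1 : (j == i) = false by lia.
have e3 : (n + i == i) = false by lia.
have e4 : (n + i == j) = false by lia.
have e5 : (n + j == i) = false by lia.
have e6 : (n + j == j) = false by lia.
have e7 : (n + j == n + i) = false by lia.
have [->|/negbTE xi] := eqVneq x i; first by rewrite !(eqxx, e1).
have [->|/negbTE xj] := eqVneq x j; first by rewrite !(eqxx, e1).
have [->|/negbTE xni] := eqVneq x (n + i)%N; first by rewrite !(eqxx, e1, e3, e4, e5, e6, e7).
have [->|/negbTE xnj] := eqVneq x (n + j)%N; first by rewrite !(eqxx, e1, e3, e4, e5, e6, e7).
by rewrite xi xj xni xnj.
Qed.

(** * Weighted sums over patterns *)

Section WeightedSum.
Variable R : realType.

Lemma gamma_gt0 : 0 < gamma R.
Proof.
by rewrite /gamma divr_gt0 ?expR_gt0// subr_gt0 -expR0 ltr_expR oppr_lt0.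
Qed.

Lemma pw_gt0 m : 0 < pw R m.
Proof. by rewrite /pw divr_gt0 ?gamma_gt0// mulr_gt0 ?exprn_gt0// ltr0n fact_gt0. Qed.

Definition wsum (k : nat) (F : forall m, 'S_m -> R) : R :=
  \sum_(1 <= m < k.+1) \sum_(s : 'S_m) pw R m * (m%:R ^+ 2)^-1 * F m s.

Lemma weight_ge0 m : 0 <= pw R m * (m%:R ^+ 2)^-1.
Proof. by rewrite mulr_ge0 ?invr_ge0 ?sqr_ge0// ltW// pw_gt0. Qed.

Lemma le_wsum k F G : (forall m (s : 'S_m), (0 < m <= k)%N -> F m s <= G m s) ->
  wsum k F <= wsum k G.
Proof.
move=> FG; apply: ler_sum_nat => m /andP[m1 mk]; apply: ler_sum => s _.
by rewrite ler_wpM2l ?weight_ge0// FG// m1.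
Qed.

Lemma eq_wsum k F G : (forall m (s : 'S_m), F m s = G m s) -> wsum k F = wsum k G.
Proof. by move=> FG; apply: eq_bigr => m _; apply: eq_bigr => s _; rewrite FG. Qed.

Lemma wsumD k F G : wsum k (fun m s => F m s + G m s) = wsum k F + wsum k G.
Proof.
rewrite /wsum -big_split; apply: eq_bigr => m _.
by rewrite -big_split; apply: eq_bigr => s _; rewrite mulrDr.
Qed.

Lemma wsumZ k c F : wsum k (fun m s => c * F m s) = c * wsum k F.
Proof.
rewrite /wsum mulr_sumr; apply: eq_bigr => m _.
by rewrite mulr_sumr; apply: eq_bigr => s _; rewrite mulrCA.
Qed.

Lemma wsumB k F G : wsum k (fun m s => F m s - G m s) = wsum k F - wsum k G.
Proof.
rewrite -mulN1r -wsumZ -wsumD; apply: eq_wsum => m s.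
by rewrite mulN1r.
Qed.

Lemma wsum_ge_term k F m (s : 'S_m) : (0 < m <= k)%N -> (forall m (s : 'S_m), 0 <= F m s) ->
  pw R m * (m%:R ^+ 2)^-1 * F m s <= wsum k F.
Proof.
move=> mk F0; rewrite /wsum (bigD1_seq m)/= ?iota_uniq//; last by rewrite mem_index_iota ltnS.
rewrite (bigD1 s)//= -addrA lerDl addr_ge0//.
  by apply: sumr_ge0 => s' _; rewrite mulr_ge0 ?weight_ge0.
by apply: sumr_ge0 => m' _; apply: sumr_ge0 => s' _; rewrite mulr_ge0 ?weight_ge0.
Qed.

Lemma ler_norm_wsum k F : `|wsum k F| <= wsum k (fun m s => `|F m s|).
Proof.
apply: le_trans (ler_norm_sum _ _ _) _; apply: ler_sum => m _.
apply: le_trans (ler_norm_sum _ _ _) _; apply: ler_sum => s _.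
by rewrite normrM ger0_norm ?weight_ge0.
Qed.

Lemma sqr_le_fact m : (m * m <= 2 * m`!)%N.
Proof.
case: m => [|m] //; rewrite factS mulnCA leq_mul2l /=.
by case: m => [|m] //; have := fact_geq m.+1; lia.
Qed.

(** The [m!] patterns of size [m] contribute [gamma 2^-m m^2 / m!], at most [2 gamma 2^-m]. The
    bound is free of [k], and the later estimates inherit this. *)
Lemma wsum_pow4 k : wsum k (fun m _ => m%:R ^+ 4) <= 2 * gamma R.
Proof.
have g0 := gamma_gt0.
have H j : \sum_(1 <= m < j.+1) (2^-1 : R) ^+ m <= 1 - 2^-1 ^+ j.
  elim: j => [|j IH]; first by rewrite big_geq// expr0 subrr.
  rewrite big_nat_recr//=; apply: le_trans (lerD IH (lexx _)) _.
  by rewrite exprS; lra.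
apply: (@le_trans _ _ (\sum_(1 <= m < k.+1) 2 * gamma R * 2^-1 ^+ m)).
  apply: ler_sum_nat => m /andP[m1 _].
  rewrite sumr_const card_Sn -[leLHS]mulr_natl /pw.
  have f0 : m`!%:R != 0 :> R by rewrite pnatr_eq0 -lt0n fact_gt0.
  have m0 : m%:R != 0 :> R by rewrite pnatr_eq0 -lt0n.
  have p0 : 2 ^+ m != 0 :> R by rewrite expf_neq0.
  rewrite exprVn; set L := (X in X <= _).
  have -> : L = gamma R / 2 ^+ m * ((m * m)%N%:R / m`!%:R).
    by rewrite /L natrM; field; rewrite f0 m0 p0.
  have -> : 2 * gamma R / 2 ^+ m = gamma R / 2 ^+ m * 2 by ring.
  rewrite ler_wpM2l//; first by rewrite divr_ge0 ?exprn_ge0// ltW.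
  by rewrite ler_pdivrMr ?ltr0n ?fact_gt0// -natrM ler_nat sqr_le_fact.
rewrite -mulr_sumr -[leRHS]mulr1 ler_wpM2l//; first by rewrite mulr_ge0// ltW.
by apply: le_trans (H k) _; rewrite gerBl exprn_ge0.
Qed.

End WeightedSum.

Section Statistic.
Variable R : realType.
Notation pt := (R * R)%type.
Notation sample := (nat -> pt).
Variable mu : probability pt R.
Notation Ex := (iid_expectation mu).

Lemma bcyl_wsum k (F : forall m, 'S_m -> sample -> R) :
  (forall m (s : 'S_m), bcyl (F m s)) -> bcyl (fun w => wsum k (fun m s => F m s w)).
Proof.
by move=> bF; apply: bcyl_sum => m _; apply: bcyl_sum => s _; exact: bcylZ.
Qed.

Lemma Ex_wsum (nu : probability pt R) k (F : forall m, 'S_m -> sample -> R) :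
  (forall m (s : 'S_m), bcyl (F m s)) ->
  iid_expectation nu (fun w => wsum k (fun m s => F m s w)) = wsum k (fun m s => iid_expectation nu (F m s)).
Proof.
move=> bF; rewrite Ex_sum; last by move=> m _; apply: bcyl_sum => s _; exact: bcylZ.
apply: eq_bigr => m _; rewrite Ex_sum; last by move=> s _; exact: bcylZ.
by apply: eq_bigr => s _; rewrite ExZ.
Qed.

Lemma bcyl_density n m (s : 'S_m) : bcyl (density (R := R) n s).
Proof.
apply: (bcyl_avg (F := fun f w => kern s (sub (n := n) w f))) => f.
by apply: bcyl_sub; exact: bcyl_kern.
Qed.

Definition stat n k (w : sample) : R :=
  n%:R * wsum k (fun m s => (density n s w - CS mu s) ^+ 2).

Lemma bcyl_stat n k : bcyl (stat n k).
Proof.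
apply: bcylZ; apply: (@bcyl_wsum _ ( fun m s w => (density n s w - CS mu s) ^+ 2)) => m s.
by apply/bcylX/bcylB; [exact: bcyl_density|exact: bcyl_cst].
Qed.

Lemma cvmE n k (pi : 'S_n) w : (k <= n)%N -> has_pattern pi w -> cvm mu k pi = stat n k w.
Proof.
move=> kn piw; rewrite /cvm /stat; congr (_ * _); apply: eq_big_nat => m /andP[_ mk].
by apply: eq_bigr => s _; rewrite (tdensE _ _ piw)//; lia.
Qed.

(** [pdiff] takes the number of points besides the first, hence [m.-1]; the meaningless case [m = 0]
    is outside the range of [wsum]. *)
Definition kdiff n m (s : 'S_m) (i : nat) (w : sample) : R := pdiff mu n m.-1 (kern s) i w.

Definition mixed n k (i j : nat) (w : sample) : R :=
  wsum k (fun m s => m%:R ^+ 2 * (kdiff n s i w * kdiff n s j w)).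

Lemma bcyl_kdiff n m (s : 'S_m) i : bcyl (kdiff n s i).
Proof.
apply: bcyl_pdiff; first exact: bcyl_kern.
by apply: dependsW (@depends_kern _ _ s) => a; case: m s => //= m s /leq_trans; exact.
Qed.

Lemma kdiff_bound n m (s : 'S_m) i w : `|kdiff n s i w| <= 1.
Proof. by apply: pdiff_bound; [exact: bcyl_kern|exact: kern01]. Qed.

Lemma kdiff_local n m (s : 'S_m) i (w w' : sample) : w i = w' i -> w (n + i)%N = w' (n + i)%N ->
  kdiff n s i w = kdiff n s i w'.
Proof. by rewrite /kdiff /pdiff => -> ->. Qed.

Lemma bcyl_mixed n k i j : bcyl (mixed n k i j).
Proof.
apply: (@bcyl_wsum _ ( fun m s w => m%:R ^+ 2 * (kdiff n s i w * kdiff n s j w))) => m s.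
by apply/bcylZ/bcylM; exact: bcyl_kdiff.
Qed.

Lemma mixed_local n k i j (w w' : sample) : w i = w' i -> w (n + i)%N = w' (n + i)%N ->
  w j = w' j -> w (n + j)%N = w' (n + j)%N -> mixed n k i j w = mixed n k i j w'.
Proof.
move=> h1 h2 h3 h4; apply: eq_wsum => m s.
by rewrite (kdiff_local s h1 h2) (kdiff_local s h3 h4).
Qed.

Lemma mixed_bound n k i j w : `|mixed n k i j w| <= 2 * gamma R.
Proof.
apply: le_trans (ler_norm_wsum _ _) _; apply: le_trans (wsum_pow4 R k).
apply: le_wsum => m s /andP[m0 _]; rewrite normrM normrX normr_nat.
apply: (@le_trans _ _ (m%:R ^+ 2)).
  rewrite -[leRHS]mulr1 ler_wpM2l ?sqr_ge0// normrM -[leRHS]mulr1.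
  by apply: ler_pM => //; exact: kdiff_bound.
by rewrite ler_weXn2l// ler1n.
Qed.

Definition stat_diff2 n k i j (w : sample) : R :=
  n%:R / 2 * (stat n k (swapped n j (swapped n i w)) - stat n k (swapped n i w) -
              stat n k (swapped n j w) + stat n k w).

Lemma bcyl_stat_diff2 n k i j : bcyl (stat_diff2 n k i j).
Proof.
have bX := bcyl_stat n k; have bs i' := bcyl_swapped n i' bX.
apply: bcylZ; apply: bcylD => //; apply: bcylB => //; apply: bcylB => //.
exact: (bcyl_swapped n i (bs j)).
Qed.

Lemma Ex_stat_diff2 n k (i j : 'I_n) : (k <= n)%N -> i != j ->
  Ex (fun w => `|stat_diff2 n k i j w - mixed n k i j w|) <= 36 * gamma R / Num.sqrt n%:R.
Proof.
move=> kn ij.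
have s0 : 0 < Num.sqrt n%:R :> R by rewrite sqrtr_gt0 ltr0n; have := ltn_ord i; lia.
pose D m (s : 'S_m) w := n%:R ^+ 2 / 2 * ((density n s (swapped n j (swapped n i w)) - CS mu s) ^+ 2 -
      (density n s (swapped n i w) - CS mu s) ^+ 2 - (density n s (swapped n j w) - CS mu s) ^+ 2 +
      (density n s w - CS mu s) ^+ 2) - m%:R ^+ 2 * (kdiff n s i w * kdiff n s j w).
have bD m (s : 'S_m) : bcyl (D m s).
  have bX := bcyl_density n s; have bs i' := bcyl_swapped n i' bX.
  have bij := bcyl_swapped n i (bs j).
  have bc : bcyl (fun _ : sample => CS mu s) by exact: bcyl_cst.
  apply: bcylB; last by apply/bcylZ/bcylM; exact: bcyl_kdiff.
  apply: bcylZ; apply: bcylD; last by apply/bcylX/bcylB.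
  by do 2 (apply: bcylB; last by apply/bcylX/bcylB); apply/bcylX/bcylB.
have DE w : stat_diff2 n k i j w - mixed n k i j w = wsum k (fun m s => D m s w).
  rewrite /stat_diff2 /stat /mixed -!mulrBr -mulrDr mulrA.
  rewrite -!wsumB -wsumD -wsumZ -wsumB; apply: eq_wsum => m s.
  by rewrite /D; ring.
apply: (@le_trans _ _ (Ex (fun w => wsum k (fun m s => `|D m s w|)))).
  apply: le_Ex; [|apply: (@bcyl_wsum _ ( fun m s w => `|D m s w|)) => m s; exact: bcyl_norm|].
    by apply/bcyl_norm/bcylB; [exact: bcyl_stat_diff2|exact: bcyl_mixed].
  by move=> w; rewrite DE ler_norm_wsum.
rewrite (@Ex_wsum mu k ( fun m s w => `|D m s w|)); last by move=> m s; exact: bcyl_norm.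
apply: (@le_trans _ _ (wsum k (fun m _ => 18 / Num.sqrt n%:R * m%:R ^+ 4))).
  apply: le_wsum => -[//|p] s /andP[_ pk].
  apply: le_trans (_ : _ <= 18 * p.+1%:R ^+ 4 / Num.sqrt n%:R) _; last first.
    by rewrite [leRHS]mulrAC.
  have pn : (p.+1 <= n)%N by lia.
  have := @Ex_second_difference R mu n p pn (kern s) (bcyl_kern R s) (@depends_kern R _ s)
     (kern01 s) (@kern_sub_perm R n p.+1 s) i j ij.
  by rewrite -CSE.
rewrite wsumZ; have -> : 36 * gamma R / Num.sqrt n%:R = 18 / Num.sqrt n%:R * (2 * gamma R).
  by field; rewrite gt_eqF.
by rewrite ler_wpM2l ?wsum_pow4// divr_ge0// ltW.
Qed.

Section Nondegenerate.
Variables (p : nat) (s0 : 'S_p.+1).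
Hypothesis nondeg : CS2 mu s0 s0 - CS mu s0 ^+ 2 != 0.

Let h := pproj mu p (kern s0).
Let var := CS2 mu s0 s0 - CS mu s0 ^+ 2.

(** [var] is the variance of the projection of [s0], so being nonzero it is positive. *)
Lemma nondeg_var : 0 < var.
Proof.
rewrite lt0r nondeg/= /var CS2E CSE.
have bh : bcyl (fun w : sample => h (w 0%N)) by exact: bcyl_proj (bcyl_kern R s0) (@depends_kern _ _ s0) _.
rewrite -(Ex_proj mu (bcyl_kern R s0) (@depends_kern _ _ s0) 0).
have bc c : bcyl (fun _ : sample => c) by exact: bcyl_cst.
have : 0 <= Ex (fun w => (h (w 0%N) - Ex (fun w => h (w 0%N))) ^+ 2).
  by apply: Ex_ge0 => [|w]; [apply/bcylX/bcylB|exact: sqr_ge0].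
set c := Ex (fun w => h (w 0%N)).
rewrite (eq_Ex _ (g := fun w => h (w 0%N) ^+ 2 + ((- 2 * c) * h (w 0%N) + c ^+ 2))); last first.
  by move=> w; ring.
rewrite ExD; [|exact: bcylX|by apply: bcylD => //; exact: bcylZ].
rewrite ExD//; last exact: bcylZ.
rewrite ExZ// Ex_cst -/c => h0.
by apply: le_trans h0 _; rewrite le_eqVlt; apply/orP; left; apply/eqP; rewrite -/h -/c; ring.
Qed.

Lemma Ex_kdiff_sqr n i : (i < n)%N -> Ex (fun w => kdiff n s0 i w ^+ 2) = 2 * var.
Proof.
move=> iN; have bh j : bcyl (fun w : sample => h (w j)) by exact: bcyl_proj (bcyl_kern R s0) (@depends_kern _ _ s0) _.
have E2 j : Ex (fun w => h (w j) ^+ 2) = CS2 mu s0 s0.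
  have thI : injective (fun k => (k + j)%N) by move=> a b /addIn.
  by rewrite CS2E -(Ex_comp mu thI (bcylX 2 (bh 0%N))).
have E1 j : Ex (fun w => h (w j)) = CS mu s0.
  by rewrite CSE; exact: Ex_proj (bcyl_kern R s0) (@depends_kern _ _ s0) _.
have E11 : Ex (fun w => h (w i) * h (w (n + i)%N)) = CS mu s0 ^+ 2.
  rewrite (@Ex_indep _ mu (fun k => k = i))//; first by rewrite !E1 expr2.
    by move=> w w' ww'; congr h; exact: ww'.
  by move=> w w' ww'; congr h; apply: ww'; lia.
rewrite /kdiff /pdiff -/h.
rewrite (eq_Ex _ (g := fun w => h (w (n + i)%N) ^+ 2 + (h (w i) ^+ 2 +
   (- 2) * (h (w i) * h (w (n + i)%N))))); last by move=> w /=; rewrite -/h; ring.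
rewrite ExD; [|exact: bcylX|by apply: bcylD; [exact: bcylX|apply/bcylZ/bcylM]].
rewrite ExD; [|exact: bcylX|by apply/bcylZ/bcylM].
rewrite ExZ; last exact: bcylM.
by rewrite !E2 E11 /var; ring.
Qed.

(** Half of the term of [s0] in [Ex_mixed_test], where the [m^2] of the kernel cancels against the
    weight; the other half pays for [pstar]. *)
Definition kap : R := pw R p.+1 * (2 * var) ^+ 2 / 2.
Definition pstar : R := kap / (2 * gamma R).

Lemma kap_gt0 : 0 < kap.
Proof. by rewrite divr_gt0// mulr_gt0 ?pw_gt0// exprn_gt0// mulr_gt0// nondeg_var. Qed.

Lemma pstar_gt0 : 0 < pstar.
Proof. by rewrite divr_gt0 ?kap_gt0// mulr_gt0 ?gamma_gt0. Qed.

Definition large_mixed n k i j (w : sample) : bool := kap <= `|mixed n k i j w|.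

Lemma cyl_large n k i j : cyl (large_mixed n k i j).
Proof. by apply: cyl_le; [exact: cyl_cst|apply: cyl_norm; exact: (bcyl_mixed n k i j).1]. Qed.

(* Tests the positive semidefinite kernel against the projection of [s0]. *)
Lemma Ex_mixed_test n k i j : (i < n)%N -> (j < n)%N -> i != j -> (p < k)%N ->
  2 * kap <= Ex (fun w => mixed n k i j w * (kdiff n s0 i w * kdiff n s0 j w)).
Proof.
move=> iN jN ij pk.
(* The test function is a product over [i] and [j], so by independence pattern [s] contributes
   [a m s i * a m s j], which [exchange] shows to be a square. All terms being nonnegative, the one
   of [s0] is a lower bound. *)
pose a m (s : 'S_m) i := Ex (fun w => kdiff n s i w * kdiff n s0 i w).
have a_indep m (s : 'S_m) : Ex (fun w => (kdiff n s i w * kdiff n s j w) *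
    (kdiff n s0 i w * kdiff n s0 j w)) = a m s i * a m s j.
  rewrite (eq_Ex _ (g := fun w => (kdiff n s i w * kdiff n s0 i w) *
    (kdiff n s j w * kdiff n s0 j w))); last by move=> w; ring.
  apply: (@Ex_indep _ mu (fun k => k = i \/ k = (n + i)%N)).
  - by apply: bcylM; exact: bcyl_kdiff.
  - by apply: bcylM; exact: bcyl_kdiff.
  - move=> w w' ww'; congr (_ * _); apply: kdiff_local; apply: ww'; by [left|right].
  - move=> w w' ww'; congr (_ * _); apply: kdiff_local; apply: ww'; move/eqP: ij; lia.
have a_sym m (s : 'S_m) : a m s i = a m s j.
  have thK := exchangeK iN jN (elimN eqP ij); set th := exchange n i j in thK.
  have bk : bcyl (fun w => kdiff n s i w * kdiff n s0 i w) by apply: bcylM; exact: bcyl_kdiff.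
  rewrite /a -(Ex_comp mu (can_inj thK) bk); apply: eq_Ex => w.
  have h1 : th i = j by rewrite /th /exchange eqxx.
  have h2 : th (n + i)%N = (n + j)%N.
    have e3 : (n + i == i)%N = false by lia.
    have e4 : (n + i == j)%N = false by lia.
    by rewrite /th /exchange e3 e4 eqxx.
  by rewrite /kdiff /pdiff h1 h2.
rewrite (eq_Ex _ (g := fun w => wsum k (fun m s => m%:R ^+ 2 * ((kdiff n s i w * kdiff n s j w) *
    (kdiff n s0 i w * kdiff n s0 j w))))); last first.
  by move=> w; rewrite /mixed mulrC -wsumZ; apply: eq_wsum => m s; ring.
rewrite (@Ex_wsum mu k ( fun m s w => m%:R ^+ 2 * ((kdiff n s i w * kdiff n s j w) *
    (kdiff n s0 i w * kdiff n s0 j w)))); last first.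
  by move=> m s; apply/bcylZ/bcylM; apply: bcylM; exact: bcyl_kdiff.
rewrite (eq_wsum k (G := fun m s => m%:R ^+ 2 * a m s i ^+ 2)); last first.
  move=> m s; rewrite ExZ; last by apply: bcylM; apply: bcylM; exact: bcyl_kdiff.
  by rewrite a_indep -a_sym expr2.
apply: le_trans (wsum_ge_term s0 (F := fun m s => m%:R ^+ 2 * a m s i ^+ 2) _ _); last first.
- by move=> m s; rewrite mulr_ge0 ?sqr_ge0.
- by [].
have -> : a p.+1 s0 i = 2 * var.
  by rewrite -(Ex_kdiff_sqr iN); apply: eq_Ex => w; rewrite expr2.
have p0 : p.+1%:R != 0 :> R by rewrite pnatr_eq0.
rewrite le_eqVlt; apply/orP; left; apply/eqP.
by rewrite /kap; field.
Qed.

(** A reverse Markov inequality: the tested product is at most [kap] off the event and at most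
    [2 * gamma R] on it, while its mean is at least [2 * kap]. *)
Lemma Ex_large n k i j : (i < n)%N -> (j < n)%N -> i != j -> (p < k)%N ->
  pstar <= Ex (fun w => (large_mixed n k i j w)%:R).
Proof.
move=> iN jN ij pk; have g0 := gamma_gt0 R; have k0 := kap_gt0.
have cl := bcyl_nat (cyl_large n k i j).
rewrite /pstar ler_pdivrMr; last by rewrite mulr_gt0.
have : 2 * kap <= kap + 2 * gamma R * Ex (fun w => (large_mixed n k i j w)%:R).
  apply: le_trans (Ex_mixed_test iN jN ij pk) _.
  rewrite -ExZ// -(Ex_cst mu kap) -ExD; [|exact: bcyl_cst|exact: bcylZ].
  apply: le_Ex.
  - by apply: bcylM; [exact: bcyl_mixed|apply: bcylM; exact: bcyl_kdiff].
  - by apply: bcylD; [exact: bcyl_cst|exact: bcylZ].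
  move=> w; apply: le_trans (ler_norm _) _; rewrite normrM.
  apply: (@le_trans _ _ `|mixed n k i j w|).
    rewrite -[leRHS]mulr1 ler_wpM2l// normrM -[leRHS]mulr1.
    by apply: ler_pM => //; exact: kdiff_bound.
  rewrite /large_mixed; case: (leP kap) => h1; last by rewrite mulr0 addr0 ltW.
  by rewrite mulr1; apply: le_trans (mixed_bound n k i j w) _; rewrite lerDr ltW.
by set e := Ex _; rewrite mulrC; lra.
Qed.
End Nondegenerate.
End Statistic.

(** * Vanishing atoms *)

(** The indices of the sample points that enter the kernel entry of [i] and [j]. *)
Definition slots (n i j a : nat) : Prop :=
  [\/ a = i, a = (n + i)%N, a = j | a = (n + j)%N].

Lemma slots_disjoint n i j x : (i < n)%N -> (j < n)%N -> (x < n)%N -> x <> i -> x <> j ->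
  ~ slots n i j x /\ ~ slots n i j (n + x)%N.
Proof. by move=> iN jN xN xi xj; split => -[]; lia. Qed.

Section AntiConcentration.
Variable R : realType.
Notation pt := (R * R)%type.
Notation sample := (nat -> pt).
Variable mu : probability pt R.
Notation Ex := (iid_expectation mu).
Variables (p : nat) (s0 : 'S_p.+1).
Hypothesis nondeg : CS2 mu s0 s0 - CS mu s0 ^+ 2 != 0.
Notation kap := (kap mu s0).
Notation pstar := (pstar mu s0).
Notation large := (large_mixed mu s0).
Notation mixed := (mixed mu).

Section Array.
Variables (n k q : nat).
Hypotheses (qn : (q <= n)%N) (pk : (p < k)%N).
Variables (Rr M : {set 'I_q}).
Hypothesis dRM : [disjoint Rr & M]%B.

Definition num_large (w : sample) : R :=
  \sum_(j in Rr) \sum_(i in M) (large n k i j w)%:R.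

Lemma large_local i j (w w' : sample) : w i = w' i -> w (n + i)%N = w' (n + i)%N ->
  w j = w' j -> w (n + j)%N = w' (n + j)%N -> large n k i j w = large n k i j w'.
Proof. by move=> h1 h2 h3 h4; rewrite /large_mixed (mixed_local mu k h1 h2 h3 h4). Qed.

Lemma bcyl_large i j : bcyl (fun w : sample => (large n k i j w)%:R).
Proof. by apply: bcyl_nat; exact: cyl_large. Qed.

Lemma bcyl_num_large : bcyl num_large.
Proof. by apply: bcyl_sum => j _; apply: bcyl_sum => i _; exact: bcyl_large. Qed.

(** Chebyshev's inequality for a count of mean at least [pstar * r * N]. Entries in different rows
    and different columns are independent, which leaves at most [r * N * (r + N)] pairs in the
    variance. *)
Lemma Ex_num_large_small : (0 < #|Rr|)%N -> (0 < #|M|)%N ->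
  Ex (fun w => (num_large w < pstar * (#|Rr|%:R * #|M|%:R) / 2)%R%:R) <=
  4 * (#|Rr|%:R + #|M|%:R) / (pstar ^+ 2 * (#|Rr|%:R * #|M|%:R)).
Proof.
move=> Rr0 M0; set r : R := #|Rr|%:R; set N : R := #|M|%:R.
have r0 : 0 < r by rewrite ltr0n.
have N0 : 0 < N by rewrite ltr0n.
have ps0 : 0 < pstar by exact: pstar_gt0.
pose e i j := Ex (fun w => (large n k i j w)%:R).
pose Y (j i : 'I_q) (w : sample) : R := (large n k i j w)%:R - e i j.
have bY j i : bcyl (Y j i) by apply: bcylB; [exact: bcyl_large|exact: bcyl_cst].
have Y0 j i : Ex (Y j i) = 0.
  by rewrite ExB; [rewrite Ex_cst subrr|exact: bcyl_large|exact: bcyl_cst].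
have Y1 j i w : `|Y j i w| <= 1.
  apply: norm_sub01; first by case: large; rewrite ?lexx ler01.
  rewrite /e Ex_ge0/=; [|exact: bcyl_large|by []].
  by apply: Ex_le_cst; [exact: bcyl_large|move=> u; case: large; rewrite ?ler01].
pose S w := \sum_(j in Rr) \sum_(i in M) Y j i w.
have bS : bcyl S by apply: bcyl_sum => j _; apply: bcyl_sum => i _.
have varS : Ex (fun w => S w ^+ 2) <= r * N * (r + N).
  rewrite (eq_Ex _ (g := fun w => \sum_(j in Rr) \sum_(i in M) \sum_(j' in Rr) \sum_(i' in M)
      Y j i w * Y j' i' w)); last first.
    move=> w; rewrite expr2 /S mulr_suml; apply: eq_bigr => j _.
    rewrite mulr_suml; apply: eq_bigr => i _.
    by rewrite mulr_sumr; apply: eq_bigr => j' _; rewrite mulr_sumr.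
  have bYY j i j' i' : bcyl (fun w => Y j i w * Y j' i' w) by exact: bcylM.
  rewrite Ex_sum; last by move=> j _; do 3 (apply: bcyl_sum => ? _).
  under eq_bigr do (rewrite Ex_sum; last by move=> i _; do 2 (apply: bcyl_sum => ? _)).
  under eq_bigr do under eq_bigr do
    (rewrite Ex_sum; last by move=> i _; apply: bcyl_sum => ? _).
  under eq_bigr do under eq_bigr do under eq_bigr do rewrite Ex_sum//.
  apply: (@le_trans _ _ (\sum_(j in Rr) \sum_(i in M) \sum_(j' in Rr) \sum_(i' in M)
      ((j' == j)%:R + (i' == i)%:R))).
    apply: ler_sum => j jR; apply: ler_sum => i iM; apply: ler_sum => j' j'R; apply: ler_sum => i' i'M.
    case: (eqVneq j' j) => [_|jj] /=.
      by apply: le_trans (Ex_normM_le1 mu (bY j i) (bY j' i') (Y1 j i) (Y1 j' i')) _; rewrite lerDl.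
    case: (eqVneq i' i) => [_|ii] /=.
      by apply: le_trans (Ex_normM_le1 mu (bY j i) (bY j' i') (Y1 j i) (Y1 j' i')) _; rewrite lerDr.
    rewrite (@Ex_indep _ mu (slots n i j))//.
    - by rewrite Y0 mul0r addr0.
    - move=> w w' ww'; congr ((nat_of_bool _)%:R - _).
      by apply: large_local; apply: ww'; [exact: Or41|exact: Or42|exact: Or43|exact: Or44].
    - move=> w w' ww'; congr ((nat_of_bool _)%:R - _).
      (* A row of one entry never equals a column of the other, because [Rr] and [M] are
         disjoint. *)
      have ji' : i' != j by apply: contraTneq jR => <-; rewrite (disjointFl dRM i'M).
      have ij' : j' != i by apply: contraTneq iM => <-; rewrite (disjointFr dRM j'R).
      have ltn (x : 'I_q) : (x < n)%N := leq_trans (ltn_ord x) qn.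
      have neq (x y : 'I_q) : x != y -> (x : nat) <> y by move=> /eqP H /val_inj.
      have [H1 H2] := slots_disjoint (ltn i) (ltn j) (ltn i') (neq _ _ ii) (neq _ _ ji').
      have [H3 H4] := slots_disjoint (ltn i) (ltn j) (ltn j') (neq _ _ ij') (neq _ _ jj).
      by apply: large_local; exact: ww'.
  have one (A : {set 'I_q}) (a : 'I_q) : a \in A -> \sum_(b in A) (b == a)%:R = 1 :> R.
    by move=> aA; rewrite (bigD1 a)//= eqxx big1 ?addr0// => b /andP[_ /negbTE ->].
  rewrite (eq_bigr (fun=> N * (N + r))); last first.
    move=> j jR; rewrite (eq_bigr (fun=> N + r)); last first.
      move=> i iM; rewrite (eq_bigr (fun j' => (j' == j)%:R * N + 1)); last first.
        by move=> j' _; rewrite big_split/= (one _ _ iM) sumr_const mulr_natr.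
      by rewrite big_split/= -mulr_suml (one _ _ jR) mul1r sumr_const.
    by rewrite sumr_const -[LHS]mulr_natl.
  by rewrite sumr_const -[leLHS]mulr_natl -/r le_eqVlt; apply/orP; left; apply/eqP; ring.
set c := pstar * (r * N) / 2; have c0 : 0 < c by apply: divr_gt0 => //; apply: mulr_gt0 => //; exact: mulr_gt0.
apply: (@le_trans _ _ (Ex (fun w => S w ^+ 2) / c ^+ 2)).
  apply: Ex_markov; first exact: bcylX.
  - by apply: cyl_lt; [exact: bcyl_num_large.1|exact: cyl_cst].
  - by rewrite exprn_gt0.
  - by move=> w; exact: sqr_ge0.
  move=> w; rewrite -/c => Qc.
  have SE : S w <= num_large w - pstar * (r * N).
    rewrite /S /num_large lerBrDr -lerBrDl.
    have -> : \sum_(j in Rr) \sum_(i in M) (large n k i j w)%:R -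
        \sum_(j in Rr) \sum_(i in M) Y j i w = \sum_(j in Rr) \sum_(i in M) e i j.
      rewrite -sumrB; apply: eq_bigr => j _; rewrite -sumrB; apply: eq_bigr => i _.
      by rewrite /Y; ring.
    have -> : pstar * (r * N) = \sum_(j in Rr) \sum_(i in M) pstar.
      by rewrite !sumr_const -mulrnA -[RHS]mulr_natr natrM mulrC [N * r]mulrC mulrC.
    apply: ler_sum => j jR; apply: ler_sum => i iM; apply: Ex_large => //.
    - exact: leq_trans (ltn_ord i) qn.
    - exact: leq_trans (ltn_ord j) qn.
    - apply: contraTneq jR => /val_inj <-.
      by rewrite (disjointFl dRM iM).
  have cc : pstar * (r * N) = 2 * c by rewrite /c; field.
  by rewrite -[S w ^+ 2]sqrrN ler_pXn2r ?nnegrE//; [|exact: ltW|]; lra.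
rewrite ler_pdivrMr ?exprn_gt0//; apply: le_trans varS _.
rewrite le_eqVlt; apply/orP; left; apply/eqP; rewrite /c; field.
by rewrite !gt_eqF.
Qed.

End Array.
End AntiConcentration.

Lemma swap_pred1U n (A A' : pred nat) (i a : nat) : (i < n)%N -> A i = false ->
  (forall b, A' b = (b == i) || A b) -> swap n A' a = swap n A (swap n (pred1 i) a).
Proof.
move=> iN Ai A'E; case: (ltnP a n) => an.
  rewrite !(swap_lt _ an) A'E/=; case: eqVneq => [->|ai] /=.
    by rewrite swap_add// Ai.
  by rewrite swap_lt.
have [b ->] : exists b, a = (n + b)%N by exists (a - n)%N; lia.
case: (ltnP b n) => bn.
  rewrite !(swap_add _ bn) A'E/=; case: eqVneq => [->|bi] /=.
    by rewrite swap_lt// Ai.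
  by rewrite swap_add.
have big (B : pred nat) : swap n B (n + b)%N = (n + b)%N.
  by rewrite /swap ltnNge leq_addr/= ltnNge leq_add2l bn.
by rewrite !big.
Qed.

(** * Averaging over the cube of alternatives *)

Section Cube.
Variable R : realType.
Notation pt := (R * R)%type.
Notation sample := (nat -> pt).
Variable mu : probability pt R.
Notation Ex := (iid_expectation mu).
Variables (p : nat) (s0 : 'S_p.+1).
Hypothesis nondeg : CS2 mu s0 s0 - CS mu s0 ^+ 2 != 0.
Notation kap := (kap mu s0).
Notation pstar := (pstar mu s0).
Variables (n k q : nat).
Hypotheses (qn : (q <= n)%N) (pk : (p < k)%N) (kn : (k <= n)%N).

Definition nat_pred_of (A : {set 'I_q}) : pred nat :=
  fun b => if insub b is Some a then a \in A else false.

Lemma nat_pred_of_ord (A : {set 'I_q}) (a : 'I_q) : nat_pred_of A a = (a \in A).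
Proof. by rewrite /nat_pred_of valK. Qed.

Definition cube (A : {set 'I_q}) (w : sample) : sample :=
  fun b => w (swap n (nat_pred_of A) b).

Let ltq (i : 'I_q) : (i < n)%N := leq_trans (ltn_ord i) qn.

Lemma cube_setU1 (A : {set 'I_q}) (i : 'I_q) w : i \notin A -> cube (i |: A) w = swapped n i (cube A w).
Proof.
move=> iA; apply/funext => b; rewrite /cube /swapped; congr w.
apply: swap_pred1U => //; first by rewrite nat_pred_of_ord (negbTE iA).
move=> c; rewrite /nat_pred_of; case: insubP => [a _ <-|cq]; first by rewrite !inE.
by case: eqVneq => // ci; move: cq; rewrite ci ltn_ord.
Qed.

Lemma mixed_cube (A : {set 'I_q}) (i j : 'I_q) w : i \notin A -> j \notin A ->
  mixed mu n k i j (cube A w) = mixed mu n k i j w.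
Proof.
have lt_cube (x : 'I_q) : x \notin A -> cube A w x = w x /\ cube A w (n + x)%N = w (n + x)%N.
  by move=> xA; rewrite /cube swap_lt// swap_add// nat_pred_of_ord (negbTE xA).
by move=> /lt_cube[h1 h2] /lt_cube[h3 h4]; exact: mixed_local.
Qed.

(** With the factor [n / 2] the second differences approximate [mixed] without further scaling. *)
Definition cube_stat (w : sample) (A : {set 'I_q}) : R :=
  n%:R / 2 * stat mu n k (cube A w).

Lemma cube_stat_diff2 w (A : {set 'I_q}) (i j : 'I_q) : i != j ->
  diff1 i (diff1 j (cube_stat w)) A = stat_diff2 mu n k i j (cube (A :\ i :\ j) w).
Proof.
move=> ij; set B := A :\ i :\ j.
have iB : i \notin B by rewrite !inE eqxx andbF.
have jB : j \notin B by rewrite !inE eqxx.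
have jiB : j \notin i |: B by rewrite !inE eqxx orbF eq_sym.
rewrite /diff1 (_ : j |: (i |: A) = j |: (i |: B)); last first.
  by apply/setP => x; rewrite !inE; case: (x == j); case: (x == i).
rewrite (_ : (i |: A) :\ j = i |: B); last first.
  apply/setP => x; rewrite !inE; case: (eqVneq x j) => [->|] /=; last by case: (x == i).
  by rewrite orbF eq_sym (negbTE ij).
rewrite (_ : j |: (A :\ i) = j |: B); last first.
  by apply/setP => x; rewrite !inE; case: (eqVneq x j).
by rewrite /stat_diff2 /cube_stat !cube_setU1//; ring.
Qed.

Variables (Rr M : {set 'I_q}).
Hypothesis dRM : [disjoint Rr & M]%B.

Definition approx_quadratic (w : sample) : bool :=
  [forall A : {set 'I_q}, forall i : 'I_q, forall j : 'I_q, (i != j) ==>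
    (`|stat_diff2 mu n k i j (cube A w) - mixed mu n k i j (cube A w)| <= kap / 2)%R].

Definition many_large (w : sample) : bool :=
  (pstar * (#|Rr|%:R * #|M|%:R) / 2 <= num_large mu s0 n k Rr M w)%R.

Lemma cyl_approx_quadratic : cyl approx_quadratic.
Proof.
apply: cyl_all => A; apply: cyl_all => i; apply: cyl_all => j.
case: (i != j) => /=; last exact: cyl_cst.
apply: cyl_le; last exact: cyl_cst.
apply: (cyl_comp (f := fun w => `|stat_diff2 mu n k i j w - mixed mu n k i j w|)
  (swap n (nat_pred_of A))).
apply: cyl_norm; apply: (proj1 (bcylB (bcyl_stat_diff2 mu n k i j) (bcyl_mixed mu n k i j))).
Qed.

Lemma cyl_many_large : cyl many_large.
Proof. by apply: cyl_le; [exact: cyl_cst|exact: (bcyl_num_large mu s0 n k Rr M).1]. Qed.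

Lemma many_large_rows (r' N' : nat) w : (0 < #|Rr|)%N -> (0 < #|M|)%N ->
  r'%:R <= pstar * #|Rr|%:R / 4 -> N'%:R <= pstar * #|M|%:R / 4 -> many_large w ->
  (r' <= #|finset (fun j => (j \in Rr) &&
     (N' <= #|finset (fun i => (i \in M) && (kap <= `|mixed mu n k i j w|)%R)|)%N)|)%N.
Proof.
move=> Rr0 M0 hr hN; rewrite /many_large => Q; set J := finset _.
rewrite leqNgt; apply/negP => Jr; move: Q; apply/negP; rewrite -ltNge.
pose row (j : 'I_q) : R := \sum_(i in M) (large_mixed mu s0 n k i j w)%:R.
have rowE j : row j = #|finset (fun i => (i \in M) && (kap <= `|mixed mu n k i j w|)%R)|%:R.
  rewrite /row -sum1_card natr_sum big_mkcond [RHS]big_mkcond/=; apply: eq_bigr => i _.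
  by rewrite inE /large_mixed; case: (i \in M) => //=; case: (_ <= _).
have N0 : 0 < #|M|%:R :> R by rewrite ltr0n.
have r0 : 0 < #|Rr|%:R :> R by rewrite ltr0n.
apply: (@le_lt_trans _ _ (\sum_(j in Rr) (#|M|%:R * (j \in J)%:R + N'%:R))).
  apply: ler_sum => j jR; rewrite -/(row j) rowE inE jR/=.
  case: (leqP N' _) => h.
    rewrite mulr1 -natrD ler_nat; apply: leq_trans (leq_addr _ _).
    by apply: subset_leq_card; apply/fintype.subsetP => i; rewrite inE => /andP[].
  by rewrite mulr0 add0r ler_nat ltnW.
rewrite big_split/= -mulr_sumr sumr_const -[X in _ + X]mulr_natl.
have -> : \sum_(j in Rr) (j \in J)%:R = #|J|%:R :> R.
  rewrite -sum1_card natr_sum big_mkcond [RHS]big_mkcond/=; apply: eq_bigr => i _.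
  by rewrite inE; case: (i \in Rr) => //=; case: (_ <= _)%N.
have J1 : #|J|%:R < pstar * #|Rr|%:R / 4 by apply: lt_le_trans hr; rewrite ltr_nat.
have -> : pstar * (#|Rr|%:R * #|M|%:R) / 2 =
  #|M|%:R * (pstar * #|Rr|%:R / 4) + #|Rr|%:R * (pstar * #|M|%:R / 4) by field.
by apply: ltr_leD; [rewrite ltr_pM2l|rewrite ler_pM2l].
Qed.

(** The bound of [quadratic_LO] with [Bd = 2 * gamma R + kap / 2], the size of [mixed] plus the
    approximation error. *)
Definition cube_bound (r' N' : nat) : R :=
  rho R r' + #|Rr|%:R * ((4 * #|Rr|%:R * (2 * gamma R + kap / 2) / kap + 1) * rho R N').

Lemma cube_LO (r' N' : nat) (x : R) w : (0 < #|Rr|)%N -> (0 < #|M|)%N ->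
  r'%:R <= pstar * #|Rr|%:R / 4 -> N'%:R <= pstar * #|M|%:R / 4 ->
  many_large w -> approx_quadratic w ->
  \sum_(A : {set 'I_q}) (stat mu n k (cube A w) == x)%:R <= cube_bound r' N' * 2 ^+ q.
Proof.
move=> Rr0 M0 hr hN ml aq; have k0 := kap_gt0 nondeg; have g0 := gamma_gt0 R.
have n0 : n%:R / 2 != 0 :> R.
  rewrite mulf_neq0 ?invr_neq0// pnatr_eq0.
  by case/card_gt0P: Rr0 => i _; have := ltq i; lia.
have aqP A (i j : 'I_q) : i != j ->
    `|diff1 i (diff1 j (cube_stat w)) A - mixed mu n k i j w| <= kap / 2.
  move=> ij; rewrite cube_stat_diff2// -(mixed_cube (A := A :\ i :\ j)).
  - by have /forallP/(_ i)/forallP/(_ j)/implyP := forallP aq (A :\ i :\ j); exact.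
  - by rewrite !inE eqxx andbF.
  - by rewrite !inE eqxx.
have := @quadratic_LO R 'I_q (cube_stat w) Rr M (fun j i => mixed mu n k i j w) kap
   (2 * gamma R + kap / 2) (n%:R / 2 * x) r' N' k0 _ dRM _ _ _.
rewrite card_ord => H; apply: le_trans (H _ _ _ _).
- apply: ler_sum => A _; rewrite /cube_stat (inj_eq (mulfI n0)).
  exact: lexx.
- by apply: addr_gt0; [exact: mulr_gt0|exact: divr_gt0].
- move=> A i j _ _ ij; have h1 := aqP A i j ij.
  have h2 := mixed_bound mu n k i j w.
  have := ler_normD (diff1 i (diff1 j (cube_stat w)) A - mixed mu n k i j w) (mixed mu n k i j w).
  rewrite subrK => h3; apply: le_trans h3 _; rewrite addrC.
  exact: lerD.
- move=> A i j iM jR; apply: aqP; apply: contraTneq jR => <-.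
  by rewrite (disjointFl dRM iM).
- exact: many_large_rows.
Qed.

(** A union bound over [2^q] corners and [q^2] pairs. Each corner has the law of the original
    sample, and Markov's inequality at [kap / 2] doubles the 36 of [Ex_stat_diff2]. *)
Lemma Ex_not_approx_quadratic : (0 < n)%N ->
  Ex (fun w => (~~ approx_quadratic w)%:R) <=
  2 ^+ q * q%:R ^+ 2 * (72 * gamma R / kap) / Num.sqrt n%:R.
Proof.
move=> n0; have k0 := kap_gt0 nondeg; have g0 := gamma_gt0 R.
have s0' : 0 < Num.sqrt n%:R :> R by rewrite sqrtr_gt0 ltr0n.
pose bad (i j : 'I_q) (w : sample) : bool :=
  (i != j) && (kap / 2 < `|stat_diff2 mu n k i j w - mixed mu n k i j w|).
have bnorm (i j : 'I_q) : bcyl (fun w => `|stat_diff2 mu n k i j w - mixed mu n k i j w|).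
  by apply/bcyl_norm/bcylB; [exact: bcyl_stat_diff2|exact: bcyl_mixed].
have cbad i j : cyl (bad i j).
  rewrite /bad; case: (i != j) => /=; last exact: cyl_cst.
  by apply: cyl_lt; [exact: cyl_cst|exact: (bnorm i j).1].
have bbad i j := bcyl_nat (cbad i j).
have bbadA A i j : bcyl (fun w => (bad i j (cube A w))%:R) := bcyl_comp _ (bbad i j).
apply: (@le_trans _ _ (Ex (fun w => \sum_(A : {set 'I_q}) \sum_i \sum_j (bad i j (cube A w))%:R))).
  apply: le_Ex.
  - by apply: bcyl_nat; apply: cyl_neg; exact: cyl_approx_quadratic.
  - by do 3 (apply: bcyl_sum => ? _).
  move=> w; case: (boolP (approx_quadratic w)) => [_|] /=.
    by do 3 (apply: sumr_ge0 => ? _).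
  rewrite negb_forall => /existsP[A]; rewrite negb_forall => /existsP[i].
  rewrite negb_forall => /existsP[j]; rewrite negb_imply -ltNge => bad_ij.
  rewrite (bigD1 A)//= (bigD1 i)//= (bigD1 j)//= {1}/bad bad_ij/= -!addrA lerDl.
  by do ?apply: addr_ge0; do ?(apply: sumr_ge0 => ? _).
rewrite Ex_sum; last by move=> A _; do 2 (apply: bcyl_sum => ? _).
apply: (@le_trans _ _ (\sum_(A : {set 'I_q}) \sum_(i : 'I_q) \sum_(j : 'I_q)
    (72 * gamma R / kap) / Num.sqrt n%:R)).
  apply: ler_sum => A _; rewrite Ex_sum; last by move=> i _; apply: bcyl_sum => ? _.
  apply: ler_sum => i _; rewrite Ex_sum//; apply: ler_sum => j _.
  rewrite /cube (Ex_comp mu (@swap_inj n (nat_pred_of A)) (bbad i j)).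
  case: (eqVneq i j) => [ij|ij].
    rewrite (eq_Ex _ (g := fun _ => 0)) ?Ex_cst; last by move=> w; rewrite /bad ij eqxx.
    by apply: divr_ge0; [apply: divr_ge0; [apply: mulr_ge0 => //|]|]; exact: ltW.
  apply: le_trans (Ex_markov mu (bnorm i j) (cbad i j) (_ : 0 < kap / 2) _ _) _.
  - exact: divr_gt0.
  - by [].
  - by move=> w /andP[_ /ltW].
  have k2 : 0 < kap / 2 by exact: divr_gt0.
  rewrite ler_pdivrMr//.
  have := @Ex_stat_diff2 R mu n k (widen_ord qn i) (widen_ord qn j) kn ij.
  move=> /= h; apply: le_trans h _; rewrite le_eqVlt; apply/orP; left; apply/eqP.
  by field; rewrite !gt_eqF.
rewrite !sumr_const card_ord (_ : #|_| = 2 ^ q)%N; last first.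
  by rewrite -cardsT -powersetT card_powerset cardsT card_ord.
rewrite -!mulrnA -[leLHS]mulr_natl !natrM natrX le_eqVlt; apply/orP; left; apply/eqP.
by ring.
Qed.

Lemma Ex_stat_atom (r' N' : nat) (x : R) : (0 < #|Rr|)%N -> (0 < #|M|)%N ->
  r'%:R <= pstar * #|Rr|%:R / 4 -> N'%:R <= pstar * #|M|%:R / 4 ->
  Ex (fun w => (stat mu n k w == x)%:R) <=
  cube_bound r' N' + 4 * (#|Rr|%:R + #|M|%:R) / (pstar ^+ 2 * (#|Rr|%:R * #|M|%:R)) +
  2 ^+ q * q%:R ^+ 2 * (72 * gamma R / kap) / Num.sqrt n%:R.
Proof.
move=> Rr0 M0 hr hN.
have n0 : (0 < n)%N by case/card_gt0P: Rr0 => i _; have := ltq i; lia.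
have cX : cyl (fun w => stat mu n k w == x) by apply: cyl_eq; [exact: (bcyl_stat mu n k).1|exact: cyl_cst].
have bX := bcyl_nat cX; have bXA A := bcyl_comp (swap n (nat_pred_of A)) bX.
have bml : bcyl (fun w => (~~ many_large w)%:R) by apply/bcyl_nat/cyl_neg; exact: cyl_many_large.
have baq : bcyl (fun w => (~~ approx_quadratic w)%:R).
  by apply/bcyl_nat/cyl_neg; exact: cyl_approx_quadratic.
have q0 : 0 < 2 ^+ q :> R by rewrite exprn_gt0.
have cB : 0 <= cube_bound r' N'.
  have k0 := kap_gt0 nondeg; have g0 := gamma_gt0 R.
  rewrite /cube_bound; apply: addr_ge0; first exact: rho_ge0.
  apply: mulr_ge0 => //; apply: mulr_ge0; last exact: rho_ge0.
  apply: addr_ge0 => //; apply: divr_ge0; last exact: ltW.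
  apply: mulr_ge0; first exact: mulr_ge0.
  by apply: addr_ge0; [apply: mulr_ge0 => //|apply: divr_ge0 => //]; exact: ltW.
(* All corners have the same law, so the atom equals the expected proportion of corners with value
   [x]. *)
have -> : Ex (fun w => (stat mu n k w == x)%:R) =
    Ex (fun w => 2 ^- q * \sum_(A : {set 'I_q}) (stat mu n k (cube A w) == x)%:R).
  rewrite ExZ; last by apply: bcyl_sum => A _; exact: bXA.
  rewrite Ex_sum; last by move=> A _; exact: bXA.
  rewrite (eq_bigr (fun=> Ex (fun w => (stat mu n k w == x)%:R))); last first.
    by move=> A _; rewrite /cube (Ex_comp mu (@swap_inj n (nat_pred_of A)) bX).
  rewrite sumr_const (_ : #|_| = 2 ^ q)%N; last first.
    by rewrite -cardsT -powersetT card_powerset cardsT card_ord.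
  by rewrite -[X in _ * X]mulr_natl natrX mulKf// gt_eqF.
have E1 := Ex_num_large_small nondeg qn pk dRM Rr0 M0.
have E2 := Ex_not_approx_quadratic n0.
apply: (@le_trans _ _ (Ex (fun w => cube_bound r' N' + (~~ many_large w)%:R +
    (~~ approx_quadratic w)%:R))).
  apply: le_Ex.
  - by apply: bcylZ; apply: bcyl_sum => A _; exact: bXA.
  - by apply: bcylD => //; apply: bcylD => //; exact: bcyl_cst.
  move=> w; rewrite ler_pdivrMl//.
  have triv : \sum_(A : {set 'I_q}) (stat mu n k (cube A w) == x)%:R <= 2 ^+ q :> R.
    apply: (@le_trans _ _ (\sum_(A : {set 'I_q}) 1)).
      by apply: ler_sum => A _; case: (_ == _).
    rewrite sumr_const (_ : #|_| = 2 ^ q)%N ?natrX//.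
    by rewrite -cardsT -powersetT card_powerset cardsT card_ord.
  case: (boolP (many_large w)) => ml /=; last first.
    apply: le_trans triv _; rewrite -[leLHS]mulr1 ler_pM2l// -addrA.
    by rewrite -[leLHS]add0r; apply: lerD => //; rewrite lerDl.
  case: (boolP (approx_quadratic w)) => aq /=; last first.
    apply: le_trans triv _; rewrite -[leLHS]mulr1 ler_pM2l// addr0.
    by rewrite lerDr.
  by rewrite !addr0 mulrC; exact: cube_LO.
rewrite ExD//; last by apply: bcylD => //; exact: bcyl_cst.
rewrite ExD//; last exact: bcyl_cst.
rewrite Ex_cst; apply: lerD => //; rewrite lerD2l; apply: le_trans E1.
rewrite le_eqVlt; apply/orP; left; apply/eqP; apply: eq_Ex => w.
by rewrite /many_large -ltNge.
Qed.

End Cube.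

Section Vanishing.
Variable R : realType.
Variable mu : probability (R * R)%type R.
Variables (p : nat) (s0 : 'S_p.+1).
Hypothesis nondeg : CS2 mu s0 s0 - CS mu s0 ^+ 2 != 0.
Notation kap := (kap mu s0).
Notation pstar := (pstar mu s0).

Lemma exists_nat_ge (x : R) : exists m : nat, x <= m%:R.
Proof. by exists (Num.truncn x).+1; exact/ltW/truncnS_gt. Qed.

(** The parameters are fixed in the order [r'], [r], [N'], [N], [n]. The row term, the column term,
    the Chebyshev term and the approximation term receive [e / 4] each. *)
Lemma stat_atoms_vanish (e : R) : 0 < e -> exists n0 : nat, forall n k x,
  (n0 <= n)%N -> (p < k)%N -> (k <= n)%N ->
  iid_expectation mu (fun w => (stat mu n k w == x)%:R) <= e.
Proof.
move=> e0; have k0 := kap_gt0 nondeg; have ps0 := pstar_gt0 nondeg; have g0 := gamma_gt0 R.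
have e4 : 0 < e / 4 by exact: divr_gt0.
have [r' hr'] := rho_to0 e4.
(* The first entry secures [r'] good rows. The second controls the Chebyshev term, which is at most
   [8 / (pstar^2 r)] once [N] is at least [r]. *)
have [r hr] : exists r : nat, Num.max (4 * r'%:R / pstar) (8 / pstar ^+ 2 / (e / 4)) <= r%:R by exact: exists_nat_ge.
have {hr} [hr1 hr2] : 4 * r'%:R / pstar <= r.+1%:R /\ 8 / pstar ^+ 2 / (e / 4) <= r.+1%:R.
  have rr : r%:R <= r.+1%:R :> R by rewrite ler_nat.
  by move: hr; rewrite ge_max => /andP[h1 h2]; split; [exact: le_trans h1 rr|exact: le_trans h2 rr].
move: r.+1 (ltn0Sn r) hr1 hr2 => {}r r0 hr1 hr2.
have rR : 0 < r%:R :> R by rewrite ltr0n.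
pose c := r%:R * (4 * r%:R * (2 * gamma R + kap / 2) / kap + 1).
have c0 : 0 < c.
  apply: mulr_gt0 => //; apply: ltr_wpDl => //; apply: divr_ge0; last exact: ltW.
  apply: mulr_ge0; first exact: mulr_ge0.
  by apply: addr_ge0; [apply: mulr_ge0 => //|apply: divr_ge0 => //]; exact: ltW.
have ec : 0 < e / 4 / c by exact: divr_gt0.
have [N' hN'] := rho_to0 ec.
have [N hN] : exists N : nat, Num.max (4 * N'%:R / pstar) r%:R <= N%:R by exact: exists_nat_ge.
move: hN; rewrite ge_max => /andP[hN1 hN2].
pose q := (r + N)%N.
pose D := 2 ^+ q * q%:R ^+ 2 * (72 * gamma R / kap).
have D0 : 0 <= D.
  apply: mulr_ge0; first by apply: mulr_ge0; rewrite ?exprn_ge0.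
  by apply: divr_ge0; [apply: mulr_ge0 => //|]; exact: ltW.
have [n1 hn1] := exists_nat_ge ((D / (e / 4)) ^+ 2).
exists (maxn n1 q) => n k x; rewrite geq_max => /andP[n1n qn] pk kn.
pose Rr := finset (fun i : 'I_q => (i < r)%N).
pose M := finset (fun i : 'I_q => (r <= i)%N).
have cR : #|Rr| = r.
  rewrite -sum1_card (eq_bigl (fun i : 'I_q => (i < r)%N)); last by move=> i; rewrite inE.
  by rewrite (big_ord_narrow (leq_addr N r)) sum1_card card_ord.
have MC : M = ~: Rr by apply/setP => i; rewrite !inE -leqNgt.
have cM : #|M| = N by rewrite MC cardsCs finset.setCK cR card_ord /q addKn.
have dRM : [disjoint Rr & M]%B by rewrite MC -finset.subsets_disjoint.
have N0 : (0 < N)%N by rewrite -(ltr_nat R); exact: lt_le_trans rR hN2.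
have NR : 0 < N%:R :> R by rewrite ltr0n.
have H := @Ex_stat_atom R mu p s0 nondeg n k q qn pk kn Rr M dRM r' N' x.
rewrite cR cM in H; apply: le_trans (H r0 N0 _ _) _.
- by rewrite ler_pdivlMr// mulrC [pstar * _]mulrC -ler_pdivrMr.
- by rewrite ler_pdivlMr// mulrC [pstar * _]mulrC -ler_pdivrMr.
have B1 : cube_bound mu s0 Rr r' N' <= e / 4 + e / 4.
  rewrite /cube_bound cR; apply: lerD => //.
  by rewrite mulrA -/c mulrC -ler_pdivlMr.
have B2 : 4 * (r%:R + N%:R) / (pstar ^+ 2 * (r%:R * N%:R)) <= e / 4.
  have pp : 0 < pstar ^+ 2 by exact: exprn_gt0.
  have pr : 0 < pstar ^+ 2 * (r%:R * N%:R) by apply: mulr_gt0 => //; exact: mulr_gt0.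
  rewrite ler_pdivrMr//.
  have h2 : 8 <= r%:R * (e / 4) * pstar ^+ 2 by rewrite -ler_pdivrMr// -ler_pdivrMr.
  apply: (@le_trans _ _ (8 * N%:R)); first by lra.
  have -> : e / 4 * (pstar ^+ 2 * (r%:R * N%:R)) = r%:R * (e / 4) * pstar ^+ 2 * N%:R by ring.
  by rewrite ler_pM2r.
have B3 : D / Num.sqrt n%:R <= e / 4.
  have n0 : (0 < n)%N by apply: leq_trans qn; rewrite /q addn_gt0 r0.
  have sn : 0 < Num.sqrt n%:R :> R by rewrite sqrtr_gt0 ltr0n.
  rewrite ler_pdivrMr// mulrC -ler_pdivrMr//.
  rewrite -[leLHS]ger0_norm; last by apply: divr_ge0 => //; exact: ltW.
  rewrite -sqrtr_sqr ler_wsqrtr//; apply: le_trans hn1 _.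
  by rewrite ler_nat.
rewrite -/D.
by lra.
Qed.
End Vanishing.

(** * Ranks and identification of the copula *)

Section Marginal.
Variable R : realType.
Notation pt := (R * R)%type.
Notation sample := (nat -> pt).
Variable mu : probability pt R.
Notation Ex := (iid_expectation mu).

(** The distribution function of the uniform law on the unit interval. *)
Definition clamp (x : R) : R := Num.max 0 (Num.min 1 x).

Lemma clamp01 x : 0 <= clamp x <= 1.
Proof. by rewrite /clamp le_max lexx/= ge_max ler01 ge_min lexx. Qed.

Lemma le_clamp x y : x <= y -> clamp x <= clamp y.
Proof.
move=> xy; rewrite /clamp ge_max le_max lexx/= le_max; apply/orP; right.
by rewrite le_min !ge_min lexx/= xy orbT.
Qed.

Lemma clamp_id x : 0 <= x <= 1 -> clamp x = x.
Proof. by move=> /andP[x0 x1]; rewrite /clamp min_r// max_r. Qed.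

Lemma clamp_lipschitz x y : x <= y -> clamp y - clamp x <= y - x.
Proof.
move=> xy; rewrite /clamp !maxEle !minEle; case: (leP 1 x) => x1; case: (leP 1 y) => y1;
  rewrite ?ler01; case: (leP 0 x) => x0; case: (leP 0 y) => y0; lra.
Qed.

Lemma Ex_single i (b : pt -> bool) : cyl (fun w : sample => b (w i)) ->
  Ex (fun w => (b (w i))%:R) = fine (mu [set z | b z]).
Proof.
move=> cb; have bb := bcyl_nat cb.
rewrite -(Ints_full (l := [:: i]) mu (@w0 R) bb); last first.
  by move=> w w' ww'; rewrite ww'// inE.
rewrite /= /Int /Rintegral; congr fine.
have mb : measurable [set z : pt | b z].
  rewrite (_ : [set z | b z] = b @^-1` [set true]); last first.
    by apply/seteqP; split=> z /=; case: (b z).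
  rewrite -[X in measurable X]setTI.
  exact: (cb.2 _ _ (fun _ (z : pt) => z) (fun _ => @measurable_id _ _ setT)).
rewrite -[X in mu X]setIT -(integral_indic mu measurableT mb).
apply: eq_integral => z _.
rewrite /upd eqxx indicE (_ : (z \in [set z | b z]) = b z)//.
by apply/idP/idP => [/set_mem//|]; exact: mem_set.
Qed.

(** Stands for either coordinate of a point. *)
Variable pr : pt -> R.
Hypothesis cpr : forall i, cyl (fun w : sample => pr (w i)).
Hypothesis upr : forall x : R, 0 <= x <= 1 -> mu [set z | pr z <= x] = x%:E.

Lemma bcyl_le_cst i u : bcyl (fun w : sample => (pr (w i) <= u)%R%:R).
Proof. by apply/bcyl_nat/cyl_le => //; exact: cyl_cst. Qed.

Lemma Ex_marginal i u : Ex (fun w => (pr (w i) <= u)%R%:R) = clamp u.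
Proof.
have H x : 0 <= x <= 1 -> Ex (fun w => (pr (w i) <= x)%R%:R) = x.
  move=> x01; rewrite (Ex_single (b := fun z => pr z <= x)) ?upr//.
  by apply: cyl_le => //; exact: cyl_cst.
have mono x y : x <= y -> Ex (fun w => (pr (w i) <= x)%R%:R) <= Ex (fun w => (pr (w i) <= y)%R%:R).
  move=> xy; apply: le_Ex; try exact: bcyl_le_cst.
  by move=> w; rewrite ler_nat; case: (leP (pr (w i)) x) => // /le_trans ->.
have [u0|u0] := ltP u 0.
  have -> : clamp u = 0 by rewrite /clamp max_l// ge_min (ltW u0) orbT.
  apply/eqP; rewrite eq_le -{1}(H 0) ?lexx ?ler01// mono ?(ltW u0)//=.
  by apply: Ex_ge0; [exact: bcyl_le_cst|move=> w].
have [u1|u1] := leP u 1; first by rewrite H ?u0// clamp_id// u0.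
have -> : clamp u = 1 by rewrite /clamp min_l ?(ltW u1)// max_r.
apply/eqP; rewrite eq_le; apply/andP; split.
  by apply: Ex_le_cst; [exact: bcyl_le_cst|move=> w; rewrite lern1 leq_b1].
by rewrite -{1}(H 1) ?lexx ?ler01// mono// ltW.
Qed.

Lemma Int_marginal i j w : i != j ->
  Int mu i (fun w => (pr (w i) <= pr (w j))%R%:R) w = clamp (pr (w j)).
Proof.
move=> ij; rewrite -(Ex_marginal i (pr (w j))).
rewrite -(Ints_full (l := [:: i]) mu w (bcyl_le_cst i _)); last first.
  by move=> u u' uu'; rewrite uu'// inE.
by apply: eq_Rintegral => z _; rewrite /upd eqxx eq_sym (negbTE ij).
Qed.

(** Given point [j], a tie forces point [i] into an interval of length [d], whose probability is at
    most [d], for every positive [d]. *)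
Lemma Ex_tie i j : i != j -> Ex (fun w => (pr (w i) == pr (w j))%:R) = 0.
Proof.
move=> ij; have ce : cyl (fun w : sample => pr (w i) == pr (w j)) by exact: cyl_eq.
have be := bcyl_nat ce; apply/eqP; rewrite eq_le Ex_ge0// andbT.
apply/ler_addgt0Pr => d d0; rewrite add0r.
rewrite -(Ex_Ints mu [:: i] be); apply: Ex_le_cst; first exact: bcyl_Int.
move=> w /=; set c := pr (w j).
apply: (@le_trans _ _ (Int mu i (fun w => (pr (w i) <= c)%R%:R - (pr (w i) <= c - d)%R%:R) w)).
  have -> : Int mu i (fun w => (pr (w i) == pr (w j))%:R) w = Int mu i (fun w => (pr (w i) == c)%:R) w.
    have ji : (j == i) = false by rewrite eq_sym (negbTE ij).
    by apply: eq_Rintegral => z _; rewrite /upd eqxx ji.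
  apply: le_Int.
  - by apply/bcyl_nat/cyl_eq => //; exact: cyl_cst.
  - by apply: bcylB; exact: bcyl_le_cst.
  move=> u; case: eqVneq => [->|_] /=.
    by rewrite lexx (_ : c <= c - d = false) ?subr0//; apply/negbTE; rewrite -ltNge; lra.
  rewrite subr_ge0 ler_nat; case: (leP _ (c - d)) => // h.
  by rewrite (_ : pr (u i) <= c)//; lra.
have bB : bcyl (fun w : sample => (pr (w i) <= c)%R%:R - (pr (w i) <= c - d)%R%:R).
  by apply: bcylB; exact: bcyl_le_cst.
have := Ints_full (l := [:: i]) mu w bB => /= ->; last first.
  by move=> u u' uu'; rewrite uu'// inE.
rewrite ExB; try exact: bcyl_le_cst.
rewrite !Ex_marginal; apply: le_trans (clamp_lipschitz _) _; lra.
Qed.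

Variable n : nat.

Definition rank (i : 'I_n) (w : sample) : R :=
  \sum_(j < n) (pr (w j) <= pr (w i))%R%:R.

Lemma cyl_le_pr (i j : nat) : cyl (fun w : sample => (pr (w j) <= pr (w i))%R).
Proof. exact: cyl_le. Qed.

Lemma bcyl_rank i : bcyl (rank i).
Proof. by apply: bcyl_sum => j _; apply: bcyl_nat; exact: cyl_le_pr. Qed.

Lemma bcyl_clamp i : bcyl (fun w : sample => clamp (pr (w i))).
Proof.
split; last by exists 1 => w; rewrite ger0_norm; case/andP: (clamp01 (pr (w i))).
split; first by have [[N HN] _] := cpr i; exists N => w w' ww'; rewrite (HN _ _ ww').
move=> d T phi mphi.
apply: measurable_maxr => //; apply: measurable_minr => //.
exact: (cpr i).2.
Qed.

Lemma Ex_clamp i t : Ex (fun w => (clamp (pr (w i)) <= t)%R%:R) = clamp t.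
Proof.
have [t0|t0] := ltP t 0.
  rewrite (eq_Ex _ (g := fun _ => 0)) => [|w]; last first.
    by have /andP[h _] := clamp01 (pr (w i)); rewrite leNgt (lt_le_trans t0 h).
  by rewrite Ex_cst /clamp max_l// ge_min (ltW t0) orbT.
have [t1|t1] := leP 1 t.
  rewrite (eq_Ex _ (g := fun _ => 1)) => [|w]; last first.
    by have /andP[_ h] := clamp01 (pr (w i)); rewrite (le_trans h t1).
  by rewrite Ex_cst /clamp min_l// max_r.
rewrite -(Ex_marginal i); apply: eq_Ex => w; congr (nat_of_bool _)%:R.
by rewrite /clamp ge_max t0/= ge_min leNgt t1.
Qed.

(** Given point [i], the indicators of the other points are independent with mean
    [clamp (pr (w i))]. Only pairs with [j' = j], [j = i] or [j' = i] contribute, at most [3 n] of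
    them. *)
Lemma Ex_rank_deviation (i : 'I_n) :
  Ex (fun w => (rank i w / n%:R - clamp (pr (w i))) ^+ 2) <= 3 / n%:R.
Proof.
have n0 : (0 < n)%N := leq_ltn_trans (leq0n i) (ltn_ord i).
have nR : 0 < n%:R :> R by rewrite ltr0n.
pose V (j : 'I_n) (w : sample) : R := (pr (w j) <= pr (w i))%R%:R - clamp (pr (w i)).
have bV j : bcyl (V j).
  by apply: bcylB; [apply: bcyl_nat; exact: cyl_le_pr|exact: bcyl_clamp].
have V1 j w : `|V j w| <= 1.
  by apply: norm_sub01; [rewrite ler0n lern1 leq_b1|exact: clamp01].
rewrite (eq_Ex _ (g := fun w => n%:R ^- 2 * \sum_(j < n) \sum_(j' < n) V j w * V j' w)); last first.
  move=> w; have -> : \sum_(j < n) \sum_(j' < n) V j w * V j' w = (\sum_(j < n) V j w) ^+ 2.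
    by rewrite expr2 mulr_suml; apply: eq_bigr => j _; rewrite mulr_sumr.
  have -> : \sum_(j < n) V j w = rank i w - n%:R * clamp (pr (w i)).
    by rewrite /V sumrB sumr_const card_ord [RHS]addrC mulr_natl addrC.
  by field; rewrite gt_eqF.
have bVV j j' : bcyl (fun w => V j w * V j' w) by exact: bcylM.
rewrite ExZ; last by do 2 (apply: bcyl_sum => ? _).
rewrite Ex_sum; last by move=> j _; apply: bcyl_sum => ? _.
apply: (@le_trans _ _ (n%:R ^- 2 * \sum_(j < n) \sum_(j' < n)
    ((j' == j)%:R + ((j == i)%:R + (j' == i)%:R)))).
  rewrite ler_wpM2l ?invr_ge0 ?sqr_ge0//; apply: ler_sum => j _.
  rewrite Ex_sum//; apply: ler_sum => j' _.
  have le1 : Ex (fun w => V j w * V j' w) <= 1 by exact: Ex_normM_le1.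
  case: (eqVneq j' j) => [_|jj]; first by apply: le_trans le1 _; rewrite lerDl addr_ge0.
  case: (eqVneq j i) => [_|ji]; first by apply: le_trans le1 _; rewrite add0r lerDl.
  case: (eqVneq j' i) => [_|j'i]; first by apply: le_trans le1 _; rewrite !add0r.
  (* Integrating out point [j] annihilates [V j], while [V j'] does not involve that point. *)
  rewrite !addr0 -(Ex_Ints mu [:: (j : nat)] (bVV j j')) (eq_Ex _ (g := fun _ => 0)) ?Ex_cst// => w.
  have jin : (j : nat) != i by [].
  rewrite (eq_Ints _ _ _ (g := fun w => V j' w * V j w)); last by move=> u; rewrite mulrC.
  rewrite IntsMl//; last first.
    move=> u u' uu'; rewrite /V !uu'//; by rewrite inE// eq_sym.
  rewrite [X in _ * X](_ : _ = 0) ?mulr0//.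
  have bi : bcyl (fun w : sample => - clamp (pr (w i))) by apply: bcylN; exact: bcyl_clamp.
  rewrite (IntsD mu [:: (j : nat)] w _ bi)/=; last by apply: bcyl_nat; exact: cyl_le_pr.
  rewrite Int_marginal// Int_indep ?subrr//.
  by move=> u u' uu'; rewrite uu'// eq_sym.
have one (a : 'I_n) : \sum_(b < n) (b == a)%:R = 1 :> R.
  by rewrite (bigD1 a)//= eqxx big1 ?addr0// => b /negbTE ->.
rewrite (eq_bigr (fun j => 2 + (j == i)%:R * n%:R)); last first.
  move=> j _; rewrite !big_split/= !one sumr_const card_ord -[_ *+ n]mulr_natr.
  by ring.
rewrite big_split/= sumr_const card_ord -mulr_suml one mul1r -[X in X + _]mulr_natl.
by rewrite le_eqVlt; apply/orP; left; apply/eqP; field; rewrite gt_eqF.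
Qed.

(* The rank indicator can differ from [pr (w i) <= u] only if the rank
   deviates by [d] or if [pr (w i)] lies within [d] of [u]. *)
Lemma Ex_rank_indicator (i : 'I_n) (u d : R) : 0 <= u <= 1 -> 0 < d ->
  Ex (fun w => `|(rank i w / n%:R <= u)%R%:R - (pr (w i) <= u)%R%:R|) <=
  3 / n%:R / d ^+ 2 + 3 * d.
Proof.
move=> /andP[u0 u1] d0.
have br : bcyl (fun w => rank i w / n%:R) by apply: bcylM; [exact: bcyl_rank|exact: bcyl_cst].
have cr : cyl (fun w => rank i w / n%:R <= u) by apply: cyl_le; [exact: br.1|exact: cyl_cst].
have bdev : bcyl (fun w => (rank i w / n%:R - clamp (pr (w i))) ^+ 2).
  by apply/bcylX/bcylB => //; exact: bcyl_clamp.
have bcl t : bcyl (fun w : sample => (clamp (pr (w i)) <= t)%R%:R).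
  by apply/bcyl_nat/cyl_le; [exact: (bcyl_clamp i).1|exact: cyl_cst].
have E : Ex (fun w => (clamp (pr (w i)) <= u + d)%R%:R - (clamp (pr (w i)) <= u - 2 * d)%R%:R) <= 3 * d.
  rewrite ExB// !Ex_clamp; apply: le_trans (clamp_lipschitz _) _; lra.
apply: (@le_trans _ _ (Ex (fun w => d ^- 2 * (rank i w / n%:R - clamp (pr (w i))) ^+ 2 +
  ((clamp (pr (w i)) <= u + d)%R%:R - (clamp (pr (w i)) <= u - 2 * d)%R%:R)))); last first.
  rewrite ExD; [|exact: bcylZ|exact: bcylB].
  rewrite ExZ//; apply: lerD => //; rewrite mulrC ler_pM2r ?invr_gt0 ?exprn_gt0//.
  exact: Ex_rank_deviation.
apply: le_Ex.
- by apply/bcyl_norm/bcylB; [exact: bcyl_nat|exact: bcyl_le_cst].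
- by apply: bcylD; [exact: bcylZ|exact: bcylB].
move=> w; set r := rank i w / n%:R; set x := pr (w i).
have diff0 : 0 <= (clamp x <= u + d)%R%:R - (clamp x <= u - 2 * d)%R%:R :> R.
  by rewrite subr_ge0 ler_nat; case: (leP _ (u - 2 * d)) => // h; rewrite (_ : clamp x <= u + d)//; lra.
have sq0 : 0 <= d ^- 2 * (r - clamp x) ^+ 2 by rewrite mulr_ge0 ?invr_ge0 ?sqr_ge0.
have lhs1 : `|(r <= u)%R%:R - (x <= u)%R%:R| <= 1 :> R.
  by apply: norm_sub01; rewrite ler0n lern1 leq_b1.
case: (ltP d `|r - clamp x|) => dev.
  apply: le_trans lhs1 _; apply: le_trans (_ : d ^- 2 * (r - clamp x) ^+ 2 <= _); last by rewrite lerDl.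
  rewrite ler_pdivlMl ?exprn_gt0// mulr1 -[leRHS]real_normK ?num_real//.
  by rewrite ler_pXn2r ?nnegrE// ?ltW.
have cu : clamp u = u by rewrite clamp_id// u0.
move: dev; rewrite ler_norml => /andP[dev1 dev2].
case: (leP r u) => ru; case: (leP x u) => xu /=.
- by rewrite subrr normr0 addr_ge0.
- have ux := le_clamp (ltW xu); rewrite cu in ux.
  have -> : (clamp x <= u + d) = true by lra.
  have -> : (clamp x <= u - 2 * d) = false by apply/negbTE; rewrite -ltNge; lra.
  by rewrite !subr0 normr1 lerDr.
- have ux := le_clamp xu; rewrite cu in ux.
  have -> : (clamp x <= u + d) = true by lra.
  have -> : (clamp x <= u - 2 * d) = false by apply/negbTE; rewrite -ltNge; lra.
  by rewrite subr0 sub0r normrN normr1 lerDr.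
- by rewrite subrr normr0 addr_ge0.
Qed.

End Marginal.

Section Copula.
Variable R : realType.
Notation pt := (R * R)%type.
Notation sample := (nat -> pt).

Section OneCopula.
Variable mu : probability pt R.
Notation Ex := (iid_expectation mu).
Hypothesis cop : is_copula mu.

Let ufst (x : R) : 0 <= x <= 1 -> mu [set z : pt | z.1 <= x] = x%:E := cop.2.1 x.
Let usnd (x : R) : 0 <= x <= 1 -> mu [set z : pt | z.2 <= x] = x%:E := cop.2.2 x.

Definition has_any n (w : sample) : bool := [exists pi : 'S_n, has_pattern pi w].

Lemma cyl_has_any n : cyl (has_any n).
Proof. by apply: cyl_ex => pi; exact: cyl_has_pattern. Qed.

(** A sample without a pattern has a tie in one coordinate of some pair, and each such tie is a null
    event. *)
Lemma Ex_has_any n : Ex (fun w => (~~ has_any n w)%:R) = 0.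
Proof.
have c1 (i j : nat) : cyl (fun w : sample => (w i).1 == (w j).1) by apply: cyl_eq; exact: cyl_fst.
have c2 (i j : nat) : cyl (fun w : sample => (w i).2 == (w j).2) by apply: cyl_eq; exact: cyl_snd.
have b1 i j := bcyl_nat (c1 i j); have b2 i j := bcyl_nat (c2 i j).
have bh : bcyl (fun w : sample => (~~ has_any n w)%:R).
  by apply: bcyl_nat; apply: cyl_neg; exact: cyl_has_any.
apply/eqP; rewrite eq_le Ex_ge0// andbT.
apply: (@le_trans _ _ (Ex (fun w => \sum_(i < n) \sum_(j < n | i != j)
    (((w i).1 == (w j).1)%:R + ((w i).2 == (w j).2)%:R)))).
  apply: le_Ex => //; first by do 2 (apply: bcyl_sum => ? _); exact: bcylD.
  move=> w; have S0 : 0 <= \sum_(i < n) \sum_(j < n | i != j)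
      (((w i).1 == (w j).1)%:R + ((w i).2 == (w j).2)%:R) :> R.
    by do 2 (apply: sumr_ge0 => ? _); rewrite addr_ge0.
  case: (boolP (has_any n w)) => //= H.
  have : ~~ no_ties n w by apply: contra H => /no_ties_pattern[pi Hpi]; apply/existsP; exists pi.
  rewrite negb_forall => /existsP[i]; rewrite negb_forall => /existsP[j].
  rewrite negb_imply negb_and !negbK => /andP[ij tie].
  rewrite (bigD1 i)//= (bigD1 j)//= -addrA; apply: (@le_trans _ _ (1 + 0)); first by rewrite addr0.
  apply: lerD; first by case/orP: tie => ->; rewrite ?lerDl ?lerDr.
  by rewrite addr_ge0//; do ?(apply: sumr_ge0 => ? _); rewrite addr_ge0.
rewrite Ex_sum; last by move=> i _; apply: bcyl_sum => j _; exact: bcylD.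
rewrite big1// => i _; rewrite Ex_sum; last by move=> j _; exact: bcylD.
rewrite big1// => j ij; rewrite ExD//.
by rewrite (Ex_tie (@cyl_fst R) ufst ij) (Ex_tie (@cyl_snd R) usnd ij) addr0.
Qed.

(** Rank statistics see the copula only through its pattern probabilities. This serves the
    identification of the copula and, through the finiteness of the range, the quantile. *)
Lemma Ex_pattern n (F : sample -> R) (c : 'S_n -> R) : bcyl F ->
  (forall pi w, has_pattern pi w -> F w = c pi) ->
  Ex F = \sum_(pi : 'S_n) CS mu pi * c pi.
Proof.
move=> bF Fc.
have bk pi : bcyl (fun w : sample => kern pi w * c pi).
  by apply: bcylM; [exact: bcyl_kern|exact: bcyl_cst].
have bS : bcyl (fun w : sample => \sum_(pi : 'S_n) kern pi w * c pi) by exact: bcyl_sum.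
have bh : bcyl (fun w : sample => (~~ has_any n w)%:R).
  by apply: bcyl_nat; apply: cyl_neg; exact: cyl_has_any.
have E w : F w = \sum_(pi : 'S_n) kern pi w * c pi + F w * (~~ has_any n w)%:R.
  case: (boolP (has_any n w)) => [/existsP[pi Hpi]|H] /=.
    rewrite mulr0 addr0 (Fc _ _ Hpi) (bigD1 pi)//= /kern Hpi mul1r big1 ?addr0// => pi' pi'pi.
    case: (boolP (has_pattern pi' w)) => [Hpi'|]; last by rewrite mul0r.
    by case/eqP: pi'pi; exact: has_pattern_uniq Hpi' Hpi.
  rewrite mulr1 big1 ?add0r// => pi _; rewrite /kern.
  case: (boolP (has_pattern pi w)) => [Hpi|]; last by rewrite mul0r.
  by case/negP: H; apply/existsP; exists pi.
have F0 : Ex (fun w => F w * (~~ has_any n w)%:R) = 0.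
  have [B FB] := bF.2; apply/eqP; rewrite -normr_eq0 eq_le normr_ge0 andbT.
  have bFh : bcyl (fun w => F w * (~~ has_any n w)%:R) by exact: bcylM.
  apply: le_trans (ler_norm_Ex mu bFh) _.
  rewrite -(mulr0 B) -(Ex_has_any n) -ExZ//; apply: le_Ex; [exact: bcyl_norm|exact: bcylZ|].
  by move=> w; rewrite normrM [X in _ * X]ger0_norm// ler_wpM2r.
rewrite (eq_Ex _ E) ExD//; last exact: bcylM.
rewrite F0 addr0 Ex_sum//; apply: eq_bigr => pi _.
rewrite (eq_Ex _ (g := fun w => c pi * kern pi w)); last by move=> w; rewrite mulrC.
by rewrite ExZ; [rewrite CSE mulrC|exact: bcyl_kern].
Qed.

Lemma iid_prob_pattern n (b : sample -> bool) (E : 'S_n -> Prop) : cyl b ->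
  (forall pi w, has_pattern pi w -> E pi <-> b w) ->
  iid_prob mu n (fun s => exists pi : 'S_n, gen s pi /\ E pi) = Ex (fun w => (b w)%:R).
Proof.
move=> cb Eb.
have H w : `[< exists pi : 'S_n, gen (mkseq w n) pi /\ E pi >] = has_any n w && b w.
  apply/asboolP/andP => [[pi [gpi Epi]]|[/existsP[pi Hpi] bw]].
    have Hpi : has_pattern pi w by rewrite has_patternE; exact/asboolP.
    by split; [apply/existsP; exists pi|apply/(Eb _ _ Hpi)].
  exists pi; split; last exact/(Eb _ _ Hpi).
  by move: Hpi; rewrite has_patternE => /asboolP.
have ch := cyl_has_any n.
rewrite iid_probE; last by under eq_fun do rewrite H; exact: cyl_and.
rewrite (eq_Ex _ (g := fun w => (has_any n w && b w)%:R)); last by move=> w; rewrite H.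
have bhb := bcyl_nat (cyl_and ch cb); have bb := bcyl_nat cb; have bn := bcyl_nat (cyl_neg ch).
apply/eqP; rewrite eq_le; apply/andP; split.
  by apply: le_Ex => // w; case: (has_any n w) => //=.
rewrite -[leRHS]addr0 -(Ex_has_any n) -ExD//; apply: le_Ex => //; first exact: bcylD.
by move=> w; case: (has_any n w); rewrite /= ?addr0// add0r; case: (b w).
Qed.

Definition joint_rank_count n (u v : R) (w : sample) : R :=
  \sum_(i < n) (rank fst i w / n%:R <= u)%R%:R * (rank snd i w / n%:R <= v)%R%:R.

(** The value of [joint_rank_count] read off the pattern, with the points indexed by increasing
    first coordinate. *)
Definition joint_rank_pattern n (u v : R) (pi : 'S_n) : R :=
  \sum_(i < n) ((\sum_(j < n) (j <= i)%N%:R) / n%:R <= u)%R%:R *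
               ((\sum_(j < n) (pi j <= pi i)%N%:R) / n%:R <= v)%R%:R.

Lemma joint_rank_countE n u v (pi : 'S_n) w : has_pattern pi w ->
  joint_rank_count n u v w = joint_rank_pattern u v pi.
Proof.
move=> /existsP[r /sorted_patternP Hr]; rewrite /joint_rank_count (reindex_inj (@perm_inj _ r))/=.
apply: eq_bigr => i _; rewrite /rank.
have -> : \sum_(j < n) ((w j).1 <= (w (r i)).1)%R%:R = \sum_(j < n) (j <= i)%N%:R :> R.
  rewrite (reindex_inj (@perm_inj _ r))/=; apply: eq_bigr => j _.
  by rewrite leNgt (Hr i j).1 -leqNgt.
have -> // : \sum_(j < n) ((w j).2 <= (w (r i)).2)%R%:R = \sum_(j < n) (pi j <= pi i)%N%:R :> R.
rewrite (reindex_inj (@perm_inj _ r))/=; apply: eq_bigr => j _.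
by rewrite leNgt (Hr i j).2 -leqNgt.
Qed.

Lemma bcyl_rank_ind (pr : pt -> R) n (i : 'I_n) u : (forall i, cyl (fun w : sample => pr (w i))) ->
  bcyl (fun w => (rank pr i w / n%:R <= u)%R%:R).
Proof.
move=> cpr; have br : bcyl (fun w => rank pr i w / n%:R).
  by apply: bcylM; [exact: bcyl_rank|exact: bcyl_cst].
by apply: bcyl_nat; apply: cyl_le; [exact: br.1|exact: cyl_cst].
Qed.

Lemma bcyl_joint_rank_count n u v : bcyl (joint_rank_count n u v).
Proof.
by apply: bcyl_sum => i _; apply: bcylM; apply: bcyl_rank_ind => ?; [exact: cyl_fst|exact: cyl_snd].
Qed.

Lemma joint_rank_approx n u v (d : R) : (0 < n)%N -> 0 <= u <= 1 -> 0 <= v <= 1 -> 0 < d ->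
  `|Ex (joint_rank_count n u v) / n%:R - copula_df mu u v| <= 2 * (3 / n%:R / d ^+ 2 + 3 * d).
Proof.
move=> n0 u01 v01 d0; have nR : 0 < n%:R :> R by rewrite ltr0n.
have br1 i := @bcyl_rank_ind fst n i u (@cyl_fst R).
have br2 i := @bcyl_rank_ind snd n i v (@cyl_snd R).
have bx (i : 'I_n) : bcyl (fun w : sample => ((w i).1 <= u)%R%:R).
  by apply/bcyl_nat/cyl_le; [exact: cyl_fst|exact: cyl_cst].
have by_ (i : 'I_n) : bcyl (fun w : sample => ((w i).2 <= v)%R%:R).
  by apply/bcyl_nat/cyl_le; [exact: cyl_snd|exact: cyl_cst].
have dfE (i : 'I_n) : Ex (fun w => ((w i).1 <= u)%R%:R * ((w i).2 <= v)%R%:R) = copula_df mu u v.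
  rewrite (eq_Ex _ (g := fun w => (((w i).1 <= u)%R && ((w i).2 <= v)%R)%:R)); last first.
    by move=> w; rewrite -natrM mulnb.
  rewrite (@Ex_single _ mu i (fun z => (z.1 <= u) && (z.2 <= v))).
    congr (fine (mu _)); apply/seteqP; split=> z /=; first by move=> /andP.
    by move=> [-> ->].
  by apply: cyl_and; apply: cyl_le; try exact: cyl_cst; [exact: cyl_fst|exact: cyl_snd].
pose t (i : 'I_n) (w : sample) : R := (rank fst i w / n%:R <= u)%R%:R * (rank snd i w / n%:R <= v)%R%:R -
  ((w i).1 <= u)%R%:R * ((w i).2 <= v)%R%:R.
have bt i : bcyl (t i) by apply: bcylB; exact: bcylM.
have -> : Ex (joint_rank_count n u v) / n%:R - copula_df mu u v = n%:R^-1 * \sum_(i < n) Ex (t i).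
  rewrite (eq_bigr (fun i => Ex (fun w => (rank fst i w / n%:R <= u)%R%:R * (rank snd i w / n%:R <= v)%R%:R) -
     copula_df mu u v)); last by move=> i _; rewrite ExB ?dfE//; exact: bcylM.
  rewrite sumrB sumr_const card_ord /joint_rank_count Ex_sum; last by move=> i _; exact: bcylM.
  by rewrite mulrBr -[copula_df mu u v *+ n]mulr_natl mulKf ?gt_eqF// mulrC.
rewrite normrM ger0_norm ?invr_ge0// ler_pdivrMl//.
apply: le_trans (ler_norm_sum _ _ _) _.
apply: (@le_trans _ _ (\sum_(i < n) 2 * (3 / n%:R / d ^+ 2 + 3 * d))); last first.
  by rewrite sumr_const card_ord -[leLHS]mulr_natl.
apply: ler_sum => i _; apply: le_trans (ler_norm_Ex mu (bt i)) _.
have e1 := Ex_rank_indicator (@cyl_fst R) ufst i u01 d0.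
have e2 := Ex_rank_indicator (@cyl_snd R) usnd i v01 d0.
apply: le_trans (_ : _ <= (3 / n%:R / d ^+ 2 + 3 * d) + (3 / n%:R / d ^+ 2 + 3 * d)) _; last first.
  by rewrite -mulr2n -[leLHS]mulr_natl.
apply: le_trans (lerD e1 e2); rewrite -ExD; try by apply/bcyl_norm/bcylB.
apply: le_Ex; [exact: bcyl_norm|by apply: bcylD; apply/bcyl_norm/bcylB|].
move=> w; rewrite /t; case: (rank fst i w / _ <= _); case: (rank snd i w / _ <= _);
  case: ((w i).1 <= u); case: ((w i).2 <= v);
  by rewrite ?mulr0 ?mul0r ?mulr1 ?subrr ?subr0 ?sub0r ?normrN ?normr1 ?normr0 ?addr0 ?add0r ?lexx ?lerDl.
Qed.

End OneCopula.

Lemma patterns_determine_copula (mu nu : probability pt R) (u v : R) :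
  is_copula mu -> is_copula nu -> 0 <= u <= 1 -> 0 <= v <= 1 ->
  (forall p (s : 'S_p.+1), CS mu s = CS nu s) -> copula_df mu u v = copula_df nu u v.
Proof.
move=> cmu cnu u01 v01 H.
have sameE n : (0 < n)%N -> iid_expectation mu (joint_rank_count n u v) = iid_expectation nu (joint_rank_count n u v).
  case: n => // n _; have bJ := bcyl_joint_rank_count n.+1 u v.
  rewrite (Ex_pattern cmu bJ (@joint_rank_countE n.+1 u v)).
  rewrite (Ex_pattern cnu bJ (@joint_rank_countE n.+1 u v)).
  by apply: eq_bigr => pi _; rewrite H.
apply/eqP; rewrite -subr_eq0 -normr_eq0 eq_le normr_ge0 andbT.
apply/ler_addgt0Pr => e e0; rewrite add0r.
(* The two approximations cost [4 * (3 / n / d^2 + 3 * d)] in total, and both summands are made at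
   most [e / 8]. *)
pose d := e / 24; have d0 : 0 < d by exact: divr_gt0.
have [n hn] := exists_nat_ge (24 / d ^+ 2 / e).
have nR : 0 < n.+1%:R :> R by [].
have hn' : 24 / d ^+ 2 / e <= n.+1%:R by apply: le_trans hn _; rewrite ler_nat.
have H1 := joint_rank_approx cmu (ltn0Sn n) u01 v01 d0.
have H2 := joint_rank_approx cnu (ltn0Sn n) u01 v01 d0.
rewrite sameE// in H1; set E := iid_expectation nu _ / _ in H1 H2.
have small : 3 / n.+1%:R / d ^+ 2 <= e / 8.
  move: hn'; rewrite ler_pdivrMr// => h.
  have -> : 3 / n.+1%:R / d ^+ 2 = (24 / d ^+ 2) / (8 * n.+1%:R).
    by field; rewrite !gt_eqF.
  rewrite ler_pdivrMr ?mulr_gt0//; apply: le_trans h _.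
  by rewrite le_eqVlt; apply/orP; left; apply/eqP; field.
have -> : copula_df mu u v - copula_df nu u v = (E - copula_df nu u v) - (E - copula_df mu u v) by ring.
apply: le_trans (ler_normB _ _) _; apply: le_trans (lerD H2 H1) _.
have d3 : 3 * d = e / 8 by rewrite /d; field.
by move: small; rewrite d3; set a := 3 / n.+1%:R / d ^+ 2; lra.
Qed.

End Copula.

(** * Level and power *)

Section Quantile.
Variable R : realType.
Notation pt := (R * R)%type.
Notation sample := (nat -> pt).

Lemma cvm_probE (mu mu0 : probability pt R) n k (b : R -> bool) : is_copula mu -> (k <= n)%N ->
  cyl (fun w => b (stat mu0 n k w)) ->
  cvm_prob mu mu0 n k b = iid_expectation mu (fun w => (b (stat mu0 n k w))%:R).
Proof.
move=> cmu kn cb; rewrite /cvm_prob (iid_prob_pattern cmu cb)// => pi w Hpi.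
by rewrite (cvmE mu0 kn Hpi).
Qed.

(** The statistic takes finitely many values almost surely, so tail events do not change in a small
    interval on either side of the quantile; this stands in for continuity of the measure. *)
Lemma gap_around (I : finType) (x : I -> R) (c : R) :
  exists2 eta, 0 < eta & forall i, x i != c -> eta <= `|x i - c|.
Proof.
exists (\big[Num.min/1]_(i | x i != c) `|x i - c|).
  by apply: lt_bigmin => // i xi; rewrite normr_gt0 subr_eq0.
by move=> i xi; exact: bigmin_le_cond.
Qed.

Section Null.
Variable mu0 : probability pt R.
Hypothesis cop : is_copula mu0.
Notation Ex := (iid_expectation mu0).
Variables (n k : nat) (alpha : R).
Hypotheses (n0 : (0 < n)%N) (kn : (k <= n)%N) (halpha : 0 < alpha < 1).
Notation X := (stat mu0 n k).

Lemma stat_ge0 w : 0 <= X w.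
Proof.
rewrite mulr_ge0// /wsum sumr_ge0// => m _; apply: sumr_ge0 => s _.
by rewrite mulr_ge0 ?weight_ge0 ?sqr_ge0.
Qed.

Lemma Ex_stat_le : Ex X <= 2 * gamma R.
Proof.
have nR : 0 < n%:R :> R by rewrite ltr0n.
have bd m (s : 'S_m) : bcyl (fun w : sample => (density n s w - CS mu0 s) ^+ 2).
  by apply/bcylX/bcylB; [exact: bcyl_density|exact: bcyl_cst].
rewrite ExZ; last by apply: (@bcyl_wsum _ _ (fun m s w => (density n s w - CS mu0 s) ^+ 2)).
rewrite (@Ex_wsum _ mu0 k (fun m s w => (density n s w - CS mu0 s) ^+ 2))//.
rewrite -wsumZ; apply: le_trans (wsum_pow4 R k); apply: le_wsum => m s /andP[m0 mk].
have mn : (m <= n)%N := leq_trans mk kn.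
have := Ustat_variance mu0 mn (bcyl_kern R s) (@depends_kern R _ s) (kern01 s).
rewrite -CSE => h; apply: (@le_trans _ _ (m%:R ^+ 2)).
  by rewrite mulrC -ler_pdivlMr.
by rewrite ler_weXn2l// ler1n.
Qed.

Lemma cyl_stat_gt t : cyl (fun w => t < X w).
Proof. by apply: cyl_lt; [exact: cyl_cst|exact: (bcyl_stat mu0 n k).1]. Qed.

Lemma cyl_stat_ge t : cyl (fun w => t <= X w).
Proof. by apply: cyl_le; [exact: cyl_cst|exact: (bcyl_stat mu0 n k).1]. Qed.

Notation c := (cq mu0 n k alpha).

Let S : set R := [set t | Ex (fun w => (t < X w)%R%:R) <= alpha].

Let cE : c = inf S.
Proof.
congr inf; apply/seteqP; split=> t /=;
  by rewrite (cvm_probE (b := fun x => t < x))//; exact: cyl_stat_gt.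
Qed.

Lemma Ex_stat_event (b : R -> bool) : cyl (fun w => b (X w)) ->
  Ex (fun w => (b (X w))%:R) = \sum_(pi : 'S_n) CS mu0 pi * (b (cvm mu0 k pi))%:R.
Proof.
move=> cb; apply: Ex_pattern => //; first exact: bcyl_nat.
by move=> pi w Hpi; rewrite (cvmE mu0 kn Hpi).
Qed.

Lemma CS_ge0 (pi : 'S_n) : 0 <= CS mu0 pi.
Proof. by rewrite CSE; apply: Ex_ge0 => [|w]; [exact: bcyl_kern|case/andP: (kern01 pi w)]. Qed.

(** An infimum is meaningful only for a nonempty set bounded below. Boundedness comes from
    [alpha < 1]; a member of [S] is given next by Markov's inequality and [0 < alpha]. *)
Let lbS : lbound S 0.
Proof.
have /andP[a0 a1] := halpha.
move=> t; rewrite /S/= => tS; rewrite leNgt; apply/negP => t0.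
move: tS; rewrite (eq_Ex _ (g := fun _ => 1)) ?Ex_cst ?leNgt ?a1// => w.
by rewrite (lt_le_trans t0 (stat_ge0 w)).
Qed.

Let S_markov : S (2 * gamma R / alpha).
Proof.
have /andP[a0 _] := halpha; have g0 := gamma_gt0 R.
have g1 : 0 < 2 * gamma R / alpha by apply: divr_gt0 => //; exact: mulr_gt0.
rewrite /S/=; apply: le_trans (Ex_markov mu0 (bcyl_stat mu0 n k) (cyl_stat_gt _) g1 stat_ge0 _) _.
  by move=> w /ltW.
by rewrite ler_pdivrMr// mulrC divfK ?gt_eqF// Ex_stat_le.
Qed.

Lemma quantile_le : c <= 2 * gamma R / alpha.
Proof. by rewrite cE; apply: ge_inf => //; exists 0. Qed.

(** Some [t] in [S] lies within [eta] of the infimum, and there is no value of the statistic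
    strictly between [c] and [c + eta]. *)
Lemma quantile_gt : Ex (fun w => (c < X w)%R%:R) <= alpha.
Proof.
have [eta eta0 gap] := gap_around (fun pi : 'S_n => cvm mu0 k pi) c.
have [|t St tc] := @inf_adherent _ S eta eta0.
  by split; [exists (2 * gamma R / alpha)|exists 0].
rewrite -cE in tc; apply: le_trans St.
rewrite (Ex_stat_event (b := fun x => c < x)) ?(Ex_stat_event (b := fun x => t < x));
  try exact: cyl_stat_gt.
apply: ler_sum => pi _; rewrite ler_wpM2l ?CS_ge0// ler_nat.
case: (ltP c (cvm mu0 k pi)) => // cx; have := gap pi; rewrite gt_eqF// => /(_ isT).
rewrite gtr0_norm ?subr_gt0// => h; rewrite (_ : t < cvm mu0 k pi)//; lra.
Qed.

(** The point [c - eta / 2] lies below the infimum, hence outside [S], and no value of the statistic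
    lies between it and [c]. *)
Lemma quantile_ge : alpha <= Ex (fun w => (c <= X w)%R%:R).
Proof.
have [eta eta0 gap] := gap_around (fun pi : 'S_n => cvm mu0 k pi) c.
have tS : alpha < Ex (fun w => (c - eta / 2 < X w)%R%:R).
  rewrite ltNge; apply/negP => tS; have : c <= c - eta / 2.
    by rewrite {1}cE; apply: ge_inf => //; exists 0.
  by rewrite lerBrDr gerDl leNgt divr_gt0.
apply: le_trans (ltW tS) _.
rewrite (Ex_stat_event (b := fun x => c - eta / 2 < x)); last exact: cyl_stat_gt.
rewrite (Ex_stat_event (b := fun x => c <= x)); last exact: cyl_stat_ge.
apply: ler_sum => pi _; rewrite ler_wpM2l ?CS_ge0// ler_nat.
case: (leP c (cvm mu0 k pi)) => [|xc]; first by rewrite leq_b1.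
have := gap pi; rewrite lt_eqF// => /(_ isT).
rewrite ltr0_norm ?subr_lt0// => h.
by rewrite (_ : (c - eta / 2 < cvm mu0 k pi) = false)//; apply/negbTE; rewrite -leNgt; lra.
Qed.

Lemma level_error (e : R) : Ex (fun w => (X w == c)%:R) <= e ->
  `|alpha - Ex (fun w => (c <= X w)%R%:R)| <= e.
Proof.
move=> atom; have h1 := quantile_gt; have h2 := quantile_ge.
have bgt := bcyl_nat (cyl_stat_gt c).
have beq : bcyl (fun w => (X w == c)%:R).
  by apply/bcyl_nat/cyl_eq; [exact: (bcyl_stat mu0 n k).1|exact: cyl_cst].
have E : Ex (fun w => (c <= X w)%R%:R) = Ex (fun w => (c < X w)%R%:R) + Ex (fun w => (X w == c)%:R).
  rewrite -ExD//; apply: eq_Ex => w; rewrite -natrD le_eqVlt eq_sym; congr _%:R.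
  by case: eqVneq => [->|] /=; rewrite ?ltxx// addn0.
by rewrite ler_norml; apply/andP; split; lra.
Qed.

End Null.

(** If the test does not reject, the term of [s] keeps the density closer to [CS mu0 s] than half
    the distance of the two pattern probabilities. The density is then at least that half away from
    its mean [CS mu s], and Chebyshev's inequality applies. *)
Lemma power_error (mu mu0 : probability pt R) n k p (s : 'S_p.+1) (alpha : R) :
  is_copula mu -> is_copula mu0 -> (0 < n)%N -> (k <= n)%N -> (p < k)%N -> 0 < alpha < 1 ->
  CS mu s != CS mu0 s ->
  let d2 := ((CS mu s - CS mu0 s) / 2) ^+ 2 in
  2 * gamma R / alpha <= n%:R * (pw R p.+1 * (p.+1%:R ^+ 2)^-1 * d2) ->
  1 - iid_expectation mu (fun w => (cq mu0 n k alpha <= stat mu0 n k w)%R%:R) <= p.+1%:R ^+ 2 / n%:R / d2.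
Proof.
move=> cmu cmu0 n0 kn pk ha sne d2 hn; set c := cq _ _ _ _.
have cc : c <= 2 * gamma R / alpha by exact: quantile_le.
have bge := bcyl_nat (cyl_stat_ge mu0 n k c).
have d20 : 0 < d2.
  by rewrite /d2 exprn_even_gt0//= mulf_neq0// subr_eq0.
have nR : 0 < n%:R :> R by rewrite ltr0n.
pose b w := d2 <= (density n s w - CS mu s) ^+ 2.
have bdev : bcyl (fun w : sample => (density n s w - CS mu s) ^+ 2).
  by apply/bcylX/bcylB; [exact: bcyl_density|exact: bcyl_cst].
have cb : cyl b by apply: cyl_le; [exact: cyl_cst|exact: bdev.1].
apply: (@le_trans _ _ (iid_expectation mu (fun w => (b w)%:R))).
  rewrite lerBlDr -[leLHS](Ex_cst mu) -ExD//; last exact: bcyl_nat.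
  apply: le_Ex; [exact: bcyl_cst|by apply: bcylD => //; exact: bcyl_nat|].
  move=> w; case: (leP c (stat mu0 n k w)) => [_|Xc]; first by rewrite lerDr.
  rewrite addr0 (_ : b w)//.
  have term : pw R p.+1 * (p.+1%:R ^+ 2)^-1 * (density n s w - CS mu0 s) ^+ 2 <=
      wsum k (fun m s => (density n s w - CS mu0 s) ^+ 2).
    apply: (wsum_ge_term (F := fun m s => (density n s w - CS mu0 s) ^+ 2)) => //.
    by move=> m s'; exact: sqr_ge0.
  have W0 : 0 < pw R p.+1 * (p.+1%:R ^+ 2)^-1.
    by rewrite mulr_gt0 ?pw_gt0// invr_gt0 exprn_gt0.
  have lt_d2 : (density n s w - CS mu0 s) ^+ 2 < d2.
    rewrite -(ltr_pM2l W0) -(ltr_pM2l nR); apply: le_lt_trans (lt_le_trans Xc (le_trans cc hn)).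
    by rewrite /stat ler_pM2l.
  rewrite /b; move: lt_d2; rewrite /d2.
  set x := density n s w; set a := CS mu s; set a0 := CS mu0 s => lt_d2.
  have h0 := sqr_ge0 (2 * x - a - a0).
  rewrite leNgt; apply/negP => h; move: lt_d2 h.
  have [aa|aa] := leP a a0; move=> h1 h2.
    have k1 : `|x - a0| < (a0 - a) / 2.
      rewrite -(@ltr_pXn2r _ 2) ?nnegrE//; last by rewrite divr_ge0// subr_ge0.
      by rewrite real_normK ?num_real//; apply: lt_le_trans h1 _; rewrite le_eqVlt; apply/orP; left; apply/eqP; field.
    have k2 : `|x - a| < (a0 - a) / 2.
      rewrite -(@ltr_pXn2r _ 2) ?nnegrE//; last by rewrite divr_ge0// subr_ge0.
      by rewrite real_normK ?num_real//; apply: lt_le_trans h2 _; rewrite le_eqVlt; apply/orP; left; apply/eqP; field.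
    by move: k1 k2; rewrite !ltr_norml => /andP[? ?] /andP[? ?]; lra.
  have k1 : `|x - a0| < (a - a0) / 2.
    rewrite -(@ltr_pXn2r _ 2) ?nnegrE//; last by rewrite divr_ge0// subr_ge0 ltW.
    by rewrite real_normK ?num_real.
  have k2 : `|x - a| < (a - a0) / 2.
    rewrite -(@ltr_pXn2r _ 2) ?nnegrE//; last by rewrite divr_ge0// subr_ge0 ltW.
    by rewrite real_normK ?num_real.
  by move: k1 k2; rewrite !ltr_norml => /andP[? ?] /andP[? ?]; lra.
apply: le_trans (Ex_markov mu bdev cb d20 _ _) _; [by move=> w; exact: sqr_ge0|by []|].
rewrite ler_pM2r ?invr_gt0// CSE.
apply: Ustat_variance; [lia|exact: bcyl_kern|exact: depends_kern|exact: kern01].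
Qed.
End Quantile.

Theorem theorem4p1 (R : realType) (mu0 : probability (R * R)%type R)
  (hC0 : is_copula mu0)
  (hnondeg : exists (k : nat) (sigma : 'S_k),
      (0 < k)%N /\ CS2 mu0 sigma sigma - CS mu0 sigma ^+ 2 != 0)
  (kn : nat -> nat) (hkn : forall n, (kn n <= n)%N)
  (hkinf : forall M : nat, exists N : nat, forall n, (N <= n)%N -> (M <= kn n)%N)
  (alpha : R) (halpha : 0 < alpha < 1) :
  ((fun n : nat => cvm_prob mu0 mu0 n (kn n) (fun x => cq mu0 n (kn n) alpha <= x))
     @ \oo --> alpha)
  /\
  (forall mu : probability (R * R)%type R, is_copula mu ->
     (exists u v : R, 0 <= u <= 1 /\ 0 <= v <= 1 /\
        copula_df mu u v <> copula_df mu0 u v) ->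
     (fun n : nat => cvm_prob mu mu0 n (kn n) (fun x => cq mu0 n (kn n) alpha <= x))
       @ \oo --> (1 : R)).
Proof.
have probE mu n : is_copula mu ->
    cvm_prob mu mu0 n (kn n) (fun x => cq mu0 n (kn n) alpha <= x) =
    iid_expectation mu (fun w => (cq mu0 n (kn n) alpha <= stat mu0 n (kn n) w)%R%:R).
  move=> cmu; apply: (cvm_probE (b := fun x => cq mu0 n (kn n) alpha <= x)) => //.
  exact: cyl_stat_ge.
split.
  case: hnondeg => -[|p] [s0 [//]] _ nondeg.
  apply/cvgrPdist_le => e e0.
  have [n0 hn0] := stat_atoms_vanish nondeg e0.
  have [N hN] := hkinf p.+1.
  (* The 1 supplies [0 < n], on which the moment bound behind the quantile relies. *)
  exists (maxn n0 (maxn N 1)) => // n /=; rewrite !geq_max => /andP[n0n /andP[Nn n1]].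
  by rewrite probE//; apply: level_error => //; apply: hn0 => //; exact: hN.
move=> mu cmu [u [v [u01 [v01 neq]]]].
have [p [s sne]] : exists p, exists s : 'S_p.+1, CS mu s != CS mu0 s.
  apply: contrapT => H; apply: neq; apply: patterns_determine_copula => // p s.
  by apply/eqP; apply/negPn/negP => sne; apply: H; exists p; exists s.
apply/cvgrPdist_le => e e0.
pose d2 := ((CS mu s - CS mu0 s) / 2) ^+ 2.
have d20 : 0 < d2 by rewrite /d2 exprn_even_gt0//= mulf_neq0// subr_eq0.
pose W := pw R p.+1 * (p.+1%:R ^+ 2)^-1 * d2.
have W0 : 0 < W by rewrite /W; apply: mulr_gt0 => //; rewrite mulr_gt0 ?pw_gt0// invr_gt0 exprn_gt0.
(* [n1] lifts the drift [n * W] above the bound on the quantiles; [n2] brings the Chebyshev error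
   below [e]. *)
have [n1 hn1] := exists_nat_ge (2 * gamma R / alpha / W).
have [n2 hn2] := exists_nat_ge (p.+1%:R ^+ 2 / d2 / e).
have [N hN] := hkinf p.+1.
exists (maxn n1 (maxn n2 (maxn N 1))) => // n /=.
rewrite !geq_max => /andP[n1n /andP[n2n /andP[Nn n0]]].
have nR : 0 < n%:R :> R by rewrite ltr0n.
rewrite probE// ger0_norm; last first.
  rewrite subr_ge0; apply: Ex_le_cst; first by apply: bcyl_nat; exact: cyl_stat_ge.
  by move=> w; rewrite lern1 leq_b1.
apply: le_trans (power_error cmu hC0 n0 (hkn n) (hN n Nn) halpha sne _) _.
  rewrite -/d2 -/W -ler_pdivrMr//; apply: le_trans hn1 _; by rewrite ler_nat.
rewrite -/d2 mulrAC ler_pdivrMr// [leRHS]mulrC -ler_pdivrMr//.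
by apply: le_trans hn2 _; rewrite ler_nat.
Qed.
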